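(* Consider minimal finite $T_0$-spaces $X$ with $|X|=10$ that are homotopically trivial and not contractible. For such an $X$ let $C=\operatorname{Min}(X)$, $A=\operatorname{Max}(X)$ and $B_X=X\setminus(C\cup A)$. Then the following hold. (1) No such space exists with $|B_X|=1$. (2) No such space exists with $|B_X|=2$. (3) There are exactly six such spaces with $|B_X|=3$, up to homeomorphism, namely the spaces of Types I, II, III (which have $(|C|,|A|)=(3,4)$) and their order-duals $\mathrm{I}^{\mathrm{op}}$, $\mathrm{II}^{\mathrm{op}}$, $\mathrm{III}^{\mathrm{op}}$. (4) There are exactly four such spaces with $|B_X|=4$, up to homeomorphism, namely the spaces of Types IV, V, VI, VII (which have $(|C|,|A|)=(3,3)$). Moreover, all spaces in items (3) and (4) have height two, have $B_X$ an antichain, and have a contractible order complex. Types I--VII are the posets listed explicitly in the context.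
   Context: Finite $T_0$-spaces are identified with finite posets via the specialisation order; homeomorphisms correspond to order isomorphisms. For $x\in X$ put $\hat U_x=\{y\in X: y<x\}$ and $\hat F_x=\{y\in X: y>x\}$. A point $x$ is an up-beat point if $\hat F_x$ has a minimum, and a down-beat point if $\hat U_x$ has a maximum. $X$ is minimal if it has no beat points (up-beat or down-beat). The order complex $\mathcal K(X)$ is the simplicial complex whose simplices are the nonempty chains of $X$. $X$ is homotopically trivial if (the geometric realisation of) $\mathcal K(X)$ is contractible (equivalently, $X$ is path-connected and all its homotopy groups are trivial). $X$ is contractible if it deformation retracts to a point as a finite topological space (equivalently, its core, obtained by successively removing beat points, is a single point). $\operatorname{Min}(X)$ and $\operatorname{Max}(X)$ are the sets of minimal and maximal elements. A chain $x_0<\dots<x_k$ has length $k$; the height of $X$ is the maximum length of a chain. $X^{\mathrm{op}}$ denotes the order-dual of $X$. Types: in each case the order is the reflexive-transitive closure of the listed relations, where $x<\{y,z,\dots\}$ means $x<y$, $x<z$, etc. For Types I--III the underlying set is $\{c_1,c_2,c_3\}\cup\{b_1,b_2,b_3\}\cup\{a_1,a_2,a_3,a_4\}$; for Types IV--VII it is $\{c_1,c_2,c_3\}\cup\{b_1,b_2,b_3,b_4\}\cup\{a_1,a_2,a_3\}$. Type I: $c_1<\{b_1,b_2\}$, $c_2<\{b_1,b_3\}$, $c_3<\{b_2,b_3\}$; $b_1<\{a_1,a_2\}$, $b_2<\{a_1,a_3,a_4\}$, $b_3<\{a_1,a_2,a_3,a_4\}$. Type II: $c_1<\{b_1,b_2\}$,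 $c_2<\{b_1,b_3\}$, $c_3<\{b_2,b_3\}$; $b_1<\{a_1,a_2,a_3\}$, $b_2<\{a_1,a_2,a_4\}$, $b_3<\{a_1,a_3,a_4\}$. Type III: $c_1<\{b_1,b_3\}$, $c_2<\{b_2,b_3\}$, $c_3<\{b_1,b_2,b_3\}$; $b_1<\{a_1,a_2,a_3\}$, $b_2<\{a_1,a_2,a_4\}$, $b_3<\{a_3,a_4\}$. Type IV: $c_1<\{b_1,b_3\}$, $c_2<\{b_2,b_4\}$, $c_3<\{b_1,b_2,b_3,b_4\}$; $b_1<\{a_1,a_2\}$, $b_2<\{a_1,a_2\}$, $b_3<\{a_1,a_3\}$, $b_4<\{a_1,a_3\}$. Type V: $c_1<\{b_1,b_3\}$, $c_2<\{b_1,b_2,b_4\}$, $c_3<\{b_2,b_3,b_4\}$; $b_1<\{a_1,a_2\}$, $b_2<\{a_1,a_2\}$, $b_3<\{a_1,a_3\}$, $b_4<\{a_1,a_3\}$. Type VI: $c_1<\{b_1,b_3\}$, $c_2<\{b_2,b_4\}$, $c_3<\{b_1,b_2,b_3,b_4\}$; $b_1<\{a_1,a_2\}$, $b_2<\{a_1,a_2\}$, $b_3<\{a_1,a_3\}$, $b_4<\{a_2,a_3\}$. Type VII: $c_1<\{b_1,b_3\}$, $c_2<\{b_1,b_2,b_4\}$, $c_3<\{b_2,b_3,b_4\}$; $b_1<\{a_1,a_2\}$, $b_2<\{a_1,a_2\}$, $b_3<\{a_1,a_3\}$, $b_4<\{a_2,a_3\}$. *)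

(* Defs.v *)
From HB Require Import structures.
From mathcomp Require Import all_boot all_order all_algebra.
From mathcomp Require Import all_classical all_reals topology normedtype.

Set Implicit Arguments.
Unset Strict Implicit.
Unset Printing Implicit Defensive.

Import Order.TTheory GRing.Theory Num.Theory.
Import numFieldNormedType.Exports.

Local Open Scope classical_set_scope.
Local Open Scope ring_scope.

(* A deformation retraction is only required to fix the points of A at time 1;
   for A a singleton this says that the identity is null-homotopic.  The values
   of H outside the time interval [0, 1] are irrelevant. *)
Definition deformation_retracts_to (R : realType) (T : topologicalType)
    (A : set T) : Prop :=
  exists H : T * R -> T,
    [/\ {within setT `*` `[0, 1], continuous H},
        forall x, H (x, 0) = x,
        forall x, A (H (x, 1))
      & forall a, A a -> H (a, 1) = a].

Definition contractible (R : realType) (T : topologicalType) : Prop :=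
  exists x0 : T, deformation_retracts_to R [set x0].

Definition homeomorphic (S T : topologicalType) : Prop :=
  exists (f : S -> T) (g : T -> S),
    [/\ continuous f, continuous g, cancel f g & cancel g f].

(* The finite T0-space of a finite poset: the open sets are the down-sets, so
   that the minimal open neighbourhood of x is [set y | y <= x]. *)
Definition T0space (d : Order.disp_t) (X : finPOrderType d) : Type := X.

Section T0spaceTopology.
Context {d : Order.disp_t} {X : finPOrderType d}.

HB.instance Definition _ := Choice.on (T0space X).

Definition down_set (U : set (T0space X)) : Prop :=
  forall x y : X, (y <= x)%O -> U x -> U y.

Lemma down_setT : down_set setT. Proof. by []. Qed.

Lemma down_setI : setI_closed down_set.
Proof.
by move=> U V dU dV x y yx [Ux Vx]; split; [exact: dU Ux | exact: dV Vx].
Qed.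

Lemma down_set_bigcup (I : Type) (F : I -> set (T0space X)) :
  (forall i, down_set (F i)) -> down_set (\bigcup_i F i).
Proof. by move=> dF x y yx [i _ Fix]; exists i => //; exact: dF Fix. Qed.

HB.instance Definition _ :=
  isOpenTopological.Build (T0space X) down_setT down_setI down_set_bigcup.

End T0spaceTopology.

(* The geometric realisation, in barycentric coordinates, of the abstract
   simplicial complex with finite vertex set V and set of simplices K, with
   the subspace topology of R^V (here set_type coerces sets to types). *)
Definition realisation (R : realType) (V : finType) (K : {set {set V}}) :
    set {ptws V -> R} :=
  [set t | [/\ forall v, 0 <= t v, \sum_v t v = 1
             & [set v | t v != 0]%SET \in K]].

Arguments realisation R {V} K.

Section Posets.
Context {d : Order.disp_t}.
Local Open Scope order_scope.
Implicit Type X : finPOrderType d.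

Definition up_beat X (x : X) : Prop :=
  exists2 m : X, x < m & forall y, x < y -> m <= y.

Definition down_beat X (x : X) : Prop :=
  exists2 m : X, m < x & forall y, y < x -> y <= m.

Definition minimal_space X : Prop :=
  forall x : X, ~ up_beat x /\ ~ down_beat x.

Definition is_chain X (s : {set X}) : bool :=
  [forall x in s, forall y in s, x >=< y].

Definition order_complex X : {set {set X}} :=
  [set s : {set X} | (s != finset.set0) && is_chain s]%SET.

Definition height X : nat := (\max_(s : {set X} | is_chain s) #|s|).-1.

Definition Min X : {set X} := [set x : X | [forall y : X, ~~ (y < x)]]%SET.

Definition Max X : {set X} := [set x : X | [forall y : X, ~~ (x < y)]]%SET.

Definition Mid X : {set X} := (~: (Min X :|: Max X))%SET.

Definition is_antichain X (s : {set X}) : Prop :=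
  {in s &, forall x y : X, x <= y -> x = y}.

Definition order_complex_contractible (R : realType) X : Prop :=
  contractible R (realisation R (order_complex X)).

Definition homotopically_trivial (R : realType) X : Prop :=
  order_complex_contractible R X.

End Posets.

Definition exceptional (R : realType) d (X : finPOrderType d) : Prop :=
  [/\ #|X| = 10%N, minimal_space X, homotopically_trivial R X
    & ~ contractible R (T0space X)].

(* Bundling the display lets a poset and an order-dual sit in one family. *)
Record finPoset := FinPoset {
  finPoset_disp : Order.disp_t;
  finPoset_sort :> finPOrderType finPoset_disp }.

Definition classifies_up_to_homeo (n : nat)
    (P : forall d, finPOrderType d -> Prop) (S : 'I_n -> finPoset) : Prop :=
  [/\ forall i, P _ (S i),
      forall i j, homeomorphic (T0space (S i)) (T0space (S j)) ->
        i = j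
    & forall d (X : finPOrderType d), P d X ->
        exists i, homeomorphic (T0space X) (T0space (S i))].

(* T ordered by the reflexive-transitive closure of the relations x < y, for y
   in e x. *)
Definition generated_poset (T : finType) (e : T -> seq T)
  (e_anti : antisymmetric (connect (grel e))) : Type := T.

Section GeneratedPoset.
Context {T : finType} {e : T -> seq T}.
Context {e_anti : antisymmetric (connect (grel e))}.

HB.instance Definition _ := Finite.on (generated_poset e_anti).

Fact generated_display : Order.disp_t. Proof. exact: Order.Disp tt tt. Qed.

HB.instance Definition _ :=
  Order.Le_isPOrder.Build generated_display (generated_poset e_anti)
    (@connect0 T (grel e)) e_anti (@connect_trans T (grel e)).

End GeneratedPoset.

Lemma graded_anti (T : finType) (e : T -> seq T) (rk : T -> nat) :
  (forall x, all (fun y => rk x < rk y)%N (e x)) ->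
  antisymmetric (connect (grel e)).
Proof.
move=> e_rk.
have lt_path p : forall x, path (grel e) x p ->
    p = [::] \/ (rk x < rk (last x p))%N.
  elim: p => [|y p IHp] x /=; first by left.
  case/andP=> exy yp; right; have xy := allP (e_rk x) _ exy.
  by case: (IHp _ yp) => [->//|]; exact: ltn_trans.
move=> x y /andP[/connectP[p xp ->] /connectP[q yq xq]].
case: (lt_path _ _ xp) => [->//|lt_xy].
case: (lt_path _ _ yq) => [q0|]; first by rewrite {1}xq q0.
by rewrite -xq ltnNge (ltnW lt_xy).
Qed.

Local Open Scope nat_scope.

Module Points334.

Inductive point := c1 | c2 | c3 | b1 | b2 | b3 | a1 | a2 | a3 | a4.

Definition points := [:: c1; c2; c3; b1; b2; b3; a1; a2; a3; a4].

Definition code (x : point) : nat :=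
  match x with
  | c1 => 0 | c2 => 1 | c3 => 2 | b1 => 3 | b2 => 4 | b3 => 5
  | a1 => 6 | a2 => 7 | a3 => 8 | a4 => 9
  end.

Lemma codeK : cancel code (nth c1 points). Proof. by case. Qed.

#[export] HB.instance Definition _ := Countable.copy point (can_type codeK).

Lemma points_enum : Finite.axiom points. Proof. by case. Qed.

#[export] HB.instance Definition _ := isFinite.Build point points_enum.

Definition rk (x : point) : nat :=
  match x with
  | c1 | c2 | c3 => 0
  | b1 | b2 | b3 => 1
  | a1 | a2 | a3 | a4 => 2
  end.

Definition relI (x : point) : seq point :=
  match x with
  | c1 => [:: b1; b2] | c2 => [:: b1; b3] | c3 => [:: b2; b3]
  | b1 => [:: a1; a2] | b2 => [:: a1; a3; a4] | b3 => [:: a1; a2; a3; a4]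
  | _ => [::]
  end.

Definition relII (x : point) : seq point :=
  match x with
  | c1 => [:: b1; b2] | c2 => [:: b1; b3] | c3 => [:: b2; b3]
  | b1 => [:: a1; a2; a3] | b2 => [:: a1; a2; a4] | b3 => [:: a1; a3; a4]
  | _ => [::]
  end.

Definition relIII (x : point) : seq point :=
  match x with
  | c1 => [:: b1; b3] | c2 => [:: b2; b3] | c3 => [:: b1; b2; b3]
  | b1 => [:: a1; a2; a3] | b2 => [:: a1; a2; a4] | b3 => [:: a3; a4]
  | _ => [::]
  end.

Lemma relI_anti : antisymmetric (connect (grel relI)).
Proof. by apply: (@graded_anti _ _ rk); case. Qed.

Lemma relII_anti : antisymmetric (connect (grel relII)).
Proof. by apply: (@graded_anti _ _ rk); case. Qed.

Lemma relIII_anti : antisymmetric (connect (grel relIII)).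
Proof. by apply: (@graded_anti _ _ rk); case. Qed.

Module Exports. HB.reexport. End Exports.

End Points334.
Export Points334.Exports.

Module Points343.

Inductive point := c1 | c2 | c3 | b1 | b2 | b3 | b4 | a1 | a2 | a3.

Definition points := [:: c1; c2; c3; b1; b2; b3; b4; a1; a2; a3].

Definition code (x : point) : nat :=
  match x with
  | c1 => 0 | c2 => 1 | c3 => 2 | b1 => 3 | b2 => 4 | b3 => 5 | b4 => 6
  | a1 => 7 | a2 => 8 | a3 => 9
  end.

Lemma codeK : cancel code (nth c1 points). Proof. by case. Qed.

#[export] HB.instance Definition _ := Countable.copy point (can_type codeK).

Lemma points_enum : Finite.axiom points. Proof. by case. Qed.

#[export] HB.instance Definition _ := isFinite.Build point points_enum.

Definition rk (x : point) : nat :=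
  match x with
  | c1 | c2 | c3 => 0
  | b1 | b2 | b3 | b4 => 1
  | a1 | a2 | a3 => 2
  end.

Definition relIV (x : point) : seq point :=
  match x with
  | c1 => [:: b1; b3] | c2 => [:: b2; b4] | c3 => [:: b1; b2; b3; b4]
  | b1 => [:: a1; a2] | b2 => [:: a1; a2]
  | b3 => [:: a1; a3] | b4 => [:: a1; a3]
  | _ => [::]
  end.

Definition relV (x : point) : seq point :=
  match x with
  | c1 => [:: b1; b3] | c2 => [:: b1; b2; b4] | c3 => [:: b2; b3; b4]
  | b1 => [:: a1; a2] | b2 => [:: a1; a2]
  | b3 => [:: a1; a3] | b4 => [:: a1; a3]
  | _ => [::]
  end.

Definition relVI (x : point) : seq point :=
  match x with
  | c1 => [:: b1; b3] | c2 => [:: b2; b4] | c3 => [:: b1; b2; b3; b4]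
  | b1 => [:: a1; a2] | b2 => [:: a1; a2]
  | b3 => [:: a1; a3] | b4 => [:: a2; a3]
  | _ => [::]
  end.

Definition relVII (x : point) : seq point :=
  match x with
  | c1 => [:: b1; b3] | c2 => [:: b1; b2; b4] | c3 => [:: b2; b3; b4]
  | b1 => [:: a1; a2] | b2 => [:: a1; a2]
  | b3 => [:: a1; a3] | b4 => [:: a2; a3]
  | _ => [::]
  end.

Lemma relIV_anti : antisymmetric (connect (grel relIV)).
Proof. by apply: (@graded_anti _ _ rk); case. Qed.

Lemma relV_anti : antisymmetric (connect (grel relV)).
Proof. by apply: (@graded_anti _ _ rk); case. Qed.

Lemma relVI_anti : antisymmetric (connect (grel relVI)).
Proof. by apply: (@graded_anti _ _ rk); case. Qed.

Lemma relVII_anti : antisymmetric (connect (grel relVII)).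
Proof. by apply: (@graded_anti _ _ rk); case. Qed.

Module Exports. HB.reexport. End Exports.

End Points343.
Export Points343.Exports.

Definition typeI := FinPoset (generated_poset Points334.relI_anti).
Definition typeII := FinPoset (generated_poset Points334.relII_anti).
Definition typeIII := FinPoset (generated_poset Points334.relIII_anti).
Definition typeIV := FinPoset (generated_poset Points343.relIV_anti).
Definition typeV := FinPoset (generated_poset Points343.relV_anti).
Definition typeVI := FinPoset (generated_poset Points343.relVI_anti).
Definition typeVII := FinPoset (generated_poset Points343.relVII_anti).

Definition opposite (X : finPoset) : finPoset := FinPoset (X^d)%O.

Definition types_I_III (i : 'I_3) : finPoset :=
  match val i with 0 => typeI | 1 => typeII | _ => typeIII end.

Definition types_I_III_op (i : 'I_6) : finPoset :=
  match val i with
  | 0 => typeI | 1 => typeII | 2 => typeIII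
  | 3 => opposite typeI | 4 => opposite typeII | _ => opposite typeIII
  end.

Definition types_IV_VII (i : 'I_4) : finPoset :=
  match val i with 0 => typeIV | 1 => typeV | 2 => typeVI | _ => typeVII end.

(* Main.v *)
Require Import Defs.
From mathcomp Require Import all_boot all_order all_algebra.
From mathcomp Require Import all_classical all_reals topology normedtype sequences.
Set Implicit Arguments.
Unset Strict Implicit.
Unset Printing Implicit Defensive.
From mathcomp Require Import ring zify.
Import Order.TTheory GRing.Theory Num.Theory.
Import numFieldNormedType.Exports.

(** Homology is taken mod 2, and K denotes the order complex of the poset X.

If the realisation of K is contractible, K is acyclic ([acyclic]).  Four
consequences concern the poset: X is connected ([poset_connected]); removing
an edge of K that lies in no triangle cuts X in two ([bridge_cut]); K contains
no octahedron one of whose triangles is a maximal chain ([no_sphere]); and the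
Euler characteristic is one ([euler_chains]).

If moreover X is minimal and has at most five middle points, K has no edge as
in the second consequence ([no_bridge]): one side of the cut has at most two
middle points, and minimality forces an octahedron or a beat point inside a
smallest such side.  Hence every relation between a minimal and a maximal
point passes through a middle point, and X is recorded by finitely many bits,
its [code]: the order of the middle points, and the sets of middle points
above each minimal and below each maximal point.  The absence of beat points
restricts these sets so much that for ten points and at most four middle
points all codes can be enumerated.  Those that contain no octahedron and have
Euler characteristic one are codes of the listed types, and there is none with
one or two middle points ([classification_checked], [poset_classified]).

Conversely, the order complex of each type collapses to a vertex, and an
elementary collapse comes from an explicit homotopy ([ambient_collapse],
[collapsible_contractible]).  None of the types is contractible as a finite
space, since a homotopy that starts at the identity of a minimal finite space
is constant ([minimal_contractible]).  The types are told apart by the number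
of points above and below each point ([homeomorphic_profile]), and the
remaining assertions are read off their codes. *)

(** * Mod 2 cochains on tuples, subdivision and prisms *)

Section Cochains.
Context {T : eqType}.
Implicit Types (s t u : seq T) (f g : seq T -> bool) (c : seq (seq T)).

(** The empty tuple is the only face of a singleton, so that cohomology below
is reduced. *)
Fixpoint faces s : seq (seq T) :=
  if s is x :: s' then s' :: map (cons x) (faces s') else [::].

Definition xsum f c : bool := \big[addb/false]_(t <- c) f t.

Definition cobd f s := xsum f (faces s).

Arguments cobd : simpl never.

Lemma xsum_cons f s c : xsum f (s :: c) = f s (+) xsum f c.
Proof. by rewrite /xsum big_cons. Qed.

Lemma xsum_map f (h : seq T -> seq T) c : xsum f (map h c) = xsum (f \o h) c.
Proof. by rewrite /xsum big_map. Qed.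

Lemma xsum_add f g c :
  xsum (fun s => f s (+) g s) c = xsum f c (+) xsum g c.
Proof. by rewrite /xsum big_split. Qed.

Lemma xsum_cat f c1 c2 : xsum f (c1 ++ c2) = xsum f c1 (+) xsum f c2.
Proof. by rewrite /xsum big_cat. Qed.

Lemma xsum_flatten f (h : seq T -> seq (seq T)) c :
  xsum f (flatten (map h c)) = xsum (fun s => xsum f (h s)) c.
Proof.
elim: c => [|s c IHc]; first by rewrite /xsum !big_nil.
by rewrite /= xsum_cat IHc xsum_cons.
Qed.

Lemma eq_in_xsum f g c : {in c, f =1 g} -> xsum f c = xsum g c.
Proof. by move=> fg; exact: eq_big_seq. Qed.

Lemma eq_xsum f g c : f =1 g -> xsum f c = xsum g c.
Proof. by move=> fg; apply: eq_in_xsum => s _; exact: fg. Qed.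

Lemma eq_cobd f g s : f =1 g -> cobd f s = cobd g s.
Proof. by move=> fg; exact: eq_xsum. Qed.

Lemma xsum0 f c : {in c, forall s, f s = false} -> xsum f c = false.
Proof. by move=> f0; rewrite (eq_in_xsum f0) /xsum big1. Qed.

Lemma cobd_nil f : cobd f [::] = false.
Proof. by rewrite /cobd /xsum big_nil. Qed.

(** The formula for a cone: peeling off the first entry reduces most
identities below to Boolean algebra. *)
Lemma cobd_cons f x s : cobd f (x :: s) = f s (+) cobd (f \o cons x) s.
Proof. by rewrite /cobd xsum_cons xsum_map. Qed.

Lemma cobd_add f g s : cobd (fun t => f t (+) g t) s = cobd f s (+) cobd g s.
Proof. exact: xsum_add. Qed.

Lemma cobd_cobd f s : cobd (cobd f) s = false.
Proof.
elim: s f => [|x s IHs] f; first exact: cobd_nil.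
have dx t : (cobd f \o cons x) t = f t (+) cobd (f \o cons x) t by exact: cobd_cons.
by rewrite cobd_cons (eq_cobd _ dx) cobd_add IHs addbF addbb.
Qed.

Lemma size_face s t : t \in faces s -> size s = (size t).+1.
Proof.
elim: s t => //= x s IHs t; rewrite inE => /orP[/eqP-> //|].
by case/mapP=> u /IHs-> ->.
Qed.

Lemma subseq_face s t : t \in faces s -> subseq t s.
Proof.
elim: s t => //= x s IHs t; rewrite inE => /orP[/eqP->|].
  exact: subseq_cons.
by case/mapP=> u /IHs us -> /=; rewrite eqxx.
Qed.

Section Subdivision.
Variable b : seq T -> T.

(** Barycentric subdivision with an arbitrary choice b of centres: the cone
from b s over the subdivided faces of s. The fuel n is the size of s, which is
one larger than that of a face. *)
Fixpoint sd_rec n s : seq (seq T) :=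
  if n is n'.+1 then
    flatten [seq map (cons (b s)) (sd_rec n' t) | t <- faces s]
  else [:: s].

Definition sd s := sd_rec (size s) s.

Lemma sd_nil : sd [::] = [:: [::]]. Proof. by []. Qed.

Lemma sd_cons x s : sd (x :: s) =
  flatten [seq map (cons (b (x :: s))) (sd t) | t <- faces (x :: s)].
Proof.
rewrite {1}/sd -[size _]/(size s).+1 -[LHS]/(flatten _).
congr flatten; apply/eq_in_map => t /size_face[ts].
by rewrite /sd ts.
Qed.

Lemma sdP s u : u \in sd s -> s != [::] ->
  exists2 t, t \in faces s & exists2 v, v \in sd t & u = b s :: v.
Proof.
case: s => // x s; rewrite sd_cons => /flattenP[_ /mapP[t ts ->]].
by case/mapP=> v vt -> _; exists t => //; exists v.
Qed.

Lemma size_sd s u : u \in sd s -> size u = size s.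
Proof.
have [n] := ubnP (size s); elim: n => // n IHn in s u *.
case: s => [|x s]; first by rewrite sd_nil inE => _ /eqP->.
move=> ltsn /sdP[//|t ts [v vt ->]] /=.
have := size_face ts; rewrite /= => -[st].
by rewrite (IHn t) ?st // -st.
Qed.

Definition sd_sum f s := xsum f (sd s).

Lemma sd_sum_cons f x s :
  sd_sum f (x :: s) = cobd (sd_sum (f \o cons (b (x :: s)))) (x :: s).
Proof.
rewrite /sd_sum sd_cons xsum_flatten; apply: eq_xsum => t.
by rewrite xsum_map.
Qed.

(** The cone formula leaves one extra term, which by induction is the
coboundary of a coboundary. *)
Lemma cobd_sd f s : cobd (sd_sum f) s = sd_sum (cobd f) s.
Proof.
have [n] := ubnP (size s); elim: n => // n IHn in s f *.
case: s => [|x s] ltsn; first by rewrite /sd_sum sd_nil /xsum big_seq1 !cobd_nil.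
rewrite sd_sum_cons; set c := b _.
have Sd t : sd_sum (cobd f \o cons c) t = sd_sum f t (+) sd_sum (cobd (f \o cons c)) t.
  by rewrite /sd_sum -xsum_add; apply: eq_xsum => u; exact: cobd_cons.
rewrite (eq_cobd _ Sd) cobd_add.
suff -> : cobd (sd_sum (cobd (f \o cons c))) (x :: s) = false by rewrite addbF.
rewrite -(cobd_cobd (sd_sum (f \o cons c)) (x :: s)); apply: eq_in_xsum => t ts.
by rewrite IHn // -(size_face ts).
Qed.

Fixpoint sdn n s : seq (seq T) :=
  if n is n'.+1 then flatten [seq sdn n' u | u <- sd s] else [:: s].

Lemma size_sdn n s u : u \in sdn n s -> size u = size s.
Proof.
elim: n s => [|n IHn] s /=; first by rewrite inE => /eqP->.
by case/flattenP=> _ /mapP[v /size_sd <- ->] /IHn.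
Qed.

(** Carries an invariant through the rounds of subdivision; the index counts
the rounds still to come. *)
Lemma sdn_ind (P : nat -> seq T -> Prop) :
  (forall n s u, P n.+1 s -> u \in sd s -> P n u) ->
  forall n s u, P n s -> u \in sdn n s -> P 0%N u.
Proof.
move=> Psd; elim=> [|n IHn] s u Ps /=; first by rewrite inE => /eqP->.
by case/flattenP=> _ /mapP[v /(Psd _ _ _ Ps) Pv ->]; exact: IHn.
Qed.

Definition sdn_sum n f s := xsum f (sdn n s).

Lemma cobd_sdn n f s : cobd (sdn_sum n f) s = sdn_sum n (cobd f) s.
Proof.
elim: n s => [|n IHn] s.
  by rewrite /sdn_sum /= [RHS]/xsum big_seq1; apply: eq_cobd => t; rewrite /xsum big_seq1.
have SnS g t : sdn_sum n.+1 g t = sd_sum (sdn_sum n g) t by rewrite /sdn_sum /= xsum_flatten.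
rewrite SnS (eq_cobd _ (SnS f)) cobd_sd.
by apply: eq_xsum => t; exact: IHn.
Qed.

End Subdivision.
End Cochains.
Arguments cobd {T} f s : simpl never.

Section Prism.
Context {T T' : eqType} (h0 h1 : T -> T').

(** The prism between the images of s under h0 and h1, cut into the pieces h0
x_0, ..., h0 x_i, h1 x_i, ..., h1 x_k. *)
Fixpoint prism (s : seq T) : seq (seq T') :=
  if s is x :: s' then
    (h0 x :: map h1 s) :: map (cons (h0 x)) (prism s')
  else [::].

Definition prism_sum (f : seq T' -> bool) s := xsum f (prism s).

Lemma prism_sum_cons f x s :
  prism_sum f (x :: s) = f (h0 x :: map h1 (x :: s)) (+) prism_sum (f \o cons (h0 x)) s.
Proof. by rewrite /prism_sum /= xsum_cons xsum_map. Qed.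

Lemma prism_sum_add f g s : prism_sum (fun t => f t (+) g t) s = prism_sum f s (+) prism_sum g s.
Proof. exact: xsum_add. Qed.

Lemma cobd_map (f : seq T' -> bool) (h : T -> T') s :
  cobd (f \o map h) s = cobd f (map h s).
Proof.
elim: s f => [|x s IHs] f; first by rewrite !cobd_nil.
by rewrite /= !cobd_cons -IHs.
Qed.

(** The boundary of a prism consists of its two ends and of the prism over the
boundary; mod 2 this is a homotopy between pulling back along h0 and along h1.
*)
Lemma prism_formula f s :
  cobd (prism_sum f) s (+) prism_sum (cobd f) s = f (map h0 s) (+) f (map h1 s).
Proof.
elim: s f => [|x s IHs] f.
  by rewrite cobd_nil /prism_sum /= /xsum big_nil addbb.
have Prd t : prism_sum (cobd f \o cons (h0 x)) t = prism_sum f t (+) prism_sum (cobd (f \o cons (h0 x))) t.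
  by rewrite -prism_sum_add; apply: eq_xsum => u; exact: cobd_cons.
have dPr t : (prism_sum f \o cons x) t =
    (f \o cons (h0 x) \o cons (h1 x) \o map h1) t (+) prism_sum (f \o cons (h0 x)) t.
  by rewrite /= prism_sum_cons.
rewrite cobd_cons prism_sum_cons Prd (eq_cobd _ dPr) cobd_add cobd_map /= !cobd_cons /=.
have xorI (p q a a' c e g : bool) : a (+) a' = g (+) e ->
    p (+) (q (+) a) (+) (c (+) (e (+) q) (+) (p (+) a')) = g (+) c.
  by move: p q a a' c e g; do 7!case.
exact: xorI (IHs _).
Qed.

Lemma prism_size s t : t \in prism s -> size t = (size s).+1.
Proof.
elim: s t => //= x s IHs t; rewrite inE => /orP[/eqP-> /=|].
  by rewrite size_map.
by case/mapP=> u /IHs us -> /=; rewrite us.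
Qed.

Lemma mem_prism s t y : t \in prism s -> y \in t ->
  exists2 x, x \in s & y = h0 x \/ y = h1 x.
Proof.
elim: s t => //= x s IHs t; rewrite inE => /orP[/eqP->|].
  rewrite !inE => /or3P[/eqP->|/eqP->|/mapP[z zs ->]].
  - by exists x; [rewrite mem_head | left].
  - by exists x; [rewrite mem_head | right].
  - by exists z; [rewrite inE zs orbT | right].
case/mapP=> u us ->; rewrite inE => /orP[/eqP->|yu].
  by exists x; [rewrite mem_head | left].
by have [z zs yz] := IHs _ us yu; exists z => //; rewrite inE zs orbT.
Qed.

End Prism.

(** * Alternating cochains and Sperner's lemma *)

Section SetCochains.
Context {V : finType}.
Implicit Types (A B : {set V}) (g h : {set V} -> bool) (s t : seq V).

Definition delta g A := \big[addb/false]_(x in A) g (A :\ x)%SET.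

(** The alternating cochain of g. It vanishes on tuples with a repetition, and
no sign appears mod 2. *)
Definition ordered_cochain g t := uniq t && g [set x in t]%SET.

Lemma faces_rem (T : eqType) (t : seq T) :
  uniq t -> faces t = [seq rem x t | x <- t].
Proof.
elim: t => //= x t IHt /andP[xt ut]; rewrite eqxx IHt // -map_comp.
congr cons; apply/eq_in_map => y yt /=.
by case: eqP => // xy; rewrite xy yt in xt.
Qed.

Lemma face_perm (T : eqType) (t u : seq T) :
  u \in faces t -> exists x, perm_eq t (x :: u).
Proof.
elim: t u => //= x t IHt u; rewrite inE => /orP[/eqP->|].
  by exists x.
case/mapP=> v /IHt[y tyv] ->; exists y.
rewrite (perm_trans (y := x :: y :: v)) ?perm_cons //.
by rewrite -[x :: _]/([:: x] ++ [:: y] ++ v) perm_catCA.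
Qed.

Lemma set_rem t x : uniq t ->
  [set y in rem x t]%SET = ([set y in t] :\ x)%SET.
Proof. by move=> ut; apply/setP=> y; rewrite !inE mem_rem_uniq // inE. Qed.

Lemma cobd_ordered_uniq g t : uniq t -> cobd (ordered_cochain g) t = delta g [set x in t]%SET.
Proof.
move=> ut; rewrite /cobd faces_rem // /xsum big_map /delta.
rewrite big_uniq //; apply: eq_big => [x|x _]; first by rewrite !inE.
by rewrite /ordered_cochain rem_uniq // set_rem.
Qed.

(** Faces that still repeat an entry contribute nothing. If a face repeats
none, the tuple has a single repeated entry, which occurs twice, and the two
faces that drop one copy of it cancel. *)
Lemma cobd_ordered_dup g t : ~~ uniq t -> cobd (ordered_cochain g) t = false.
Proof.
elim: t g => // x t IHt g; rewrite cobd_cons /= negb_and negbK.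
case: (boolP (uniq t)) => [ut|nut _]; last first.
  rewrite {1}/ordered_cochain (negbTE nut) /=.
  case: (boolP (x \in t)) => xt.
    apply: xsum0 => u ut /=; have [y tyu] := face_perm ut.
    rewrite /ordered_cochain /=; case: (boolP (x \in u)) => //= xu.
    move: xt; rewrite (perm_mem tyu) inE (negbTE xu) orbF => /eqP xy.
    by move: nut; rewrite (perm_uniq tyu) -xy /= xu /= => /negbTE->.
  rewrite -[RHS](IHt (fun B => g (x |: B)%SET) nut).
  apply: eq_in_xsum => u /subseq_face tu /=.
  have xu : x \notin u by apply: contra xt; exact: mem_subseq.
  by rewrite /ordered_cochain /= xu set_cons.
rewrite orbF => xt; rewrite /cobd faces_rem // /xsum big_map (bigD1_seq x) //=.
rewrite big1_seq => [|y /andP[yx yt]].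
  rewrite /ordered_cochain /= ut rem_uniq //= mem_rem_uniqF // set_cons set_rem //.
  by rewrite finset.setD1K ?inE //= addbF addbb.
by rewrite /ordered_cochain /= mem_rem_uniq // inE eq_sym yx xt.
Qed.

Lemma cobd_ordered g t : cobd (ordered_cochain g) t = uniq t && delta g [set x in t]%SET.
Proof. by case: (boolP (uniq t)) => [/cobd_ordered_uniq|/cobd_ordered_dup]. Qed.

Lemma delta_pred1 A x : x \in A -> delta (pred1 (A :\ x)%SET) A.
Proof.
move=> xA; rewrite /delta (bigD1 x) //= eqxx big1 // => y /andP[yA yx].
apply/negbTE/eqP => /setP/(_ y); rewrite !inE eqxx yA andbT.
by rewrite yx.
Qed.

Section Sperner.
Context {P : eqType} (b : seq P -> P) (n : nat) (e : V -> P) (L : P -> V).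
Hypothesis carrier : forall t u, uniq t -> u \in sdn b n (map e t) ->
  {subset map L u <= t}.

Let rainbow (u : seq P) := uniq (map L u).

Let label_set t u : uniq t -> u \in sdn b n (map e t) -> rainbow u ->
  [set x in map L u]%SET = [set x in t]%SET.
Proof.
move=> ut us ru; have sub := carrier ut us.
apply/setP=> x; rewrite !inE; apply/idP/idP => [/sub//|].
have [|_ ->//] := uniq_min_size ru sub.
by rewrite size_map (size_sdn us) size_map.
Qed.

Let sdn_sum_ordered g t : uniq t ->
  sdn_sum b n (ordered_cochain g \o map L) (map e t) =
  sdn_sum b n rainbow (map e t) && g [set x in t]%SET.
Proof.
move=> ut; rewrite /sdn_sum /xsum big_distrl /=.
apply: eq_big_seq => u us; rewrite /ordered_cochain /= -/(rainbow u).
by case: (boolP (rainbow u)) => // /(label_set ut us) ->.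
Qed.

(** Sperner's lemma. The indicator of one facet is a cochain whose coboundary
is 1 on the simplex. Pulled back along the labels, it shows that the parity of
the number of rainbow pieces is the same for the simplex and for that facet,
because subdivision is a chain map. *)
Lemma rainbow_odd t : uniq t -> sdn_sum b n rainbow (map e t).
Proof.
have [m] := ubnP (size t); elim: m => // m IHm in t *.
case: t => [|x t] ltm ut.
  have sd0 k : sdn b k [::] = [:: [::]] by elim: k => //= k ->.
  by rewrite /sdn_sum sd0 /xsum big_seq1.
pose g := pred1 ([set y in x :: t] :\ x)%SET.
have gt : delta g [set y in x :: t]%SET by apply: delta_pred1; rewrite inE mem_head.
have := cobd_sdn b n (ordered_cochain g \o map L) (map e (x :: t)); rewrite -cobd_map.
have -> : cobd (sdn_sum b n (ordered_cochain g \o map L) \o map e) (x :: t) = cobd (ordered_cochain g) (x :: t).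
  apply: eq_in_xsum => u uf /=; have uu := subseq_uniq (subseq_face uf) ut.
  rewrite sdn_sum_ordered // IHm ?/ordered_cochain ?uu //=.
  by have := size_face uf; rewrite /= => -[<-].
rewrite cobd_ordered ut gt => oddE; apply: etrans (esym oddE).
apply: eq_in_xsum => u us.
rewrite (cobd_map (ordered_cochain g)) cobd_ordered -/(rainbow u).
by case: (boolP (rainbow u)) => // /(label_set ut us) ->.
Qed.

(** Only rainbow pieces contribute, each with the value of g on the whole
simplex, and their number is odd: labelling a subdivision induces the identity
on alternating cochains. *)
Lemma sdn_sum_label g t : uniq t ->
  sdn_sum b n (ordered_cochain g \o map L) (map e t) = ordered_cochain g t.
Proof. by move=> ut; rewrite sdn_sum_ordered // rainbow_odd // /ordered_cochain ut. Qed.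

End Sperner.
End SetCochains.

Local Open Scope classical_set_scope.
Local Open Scope ring_scope.


(** * Topology of the realisation *)

Section Pointwise.
Context {R : realType} {V : finType}.
Local Notation P := {ptws V -> R}.
Implicit Types (x y : P) (v : V).

Lemma ptws_cvgP (F : set_system P) x : Filter F ->
  F --> x <-> forall v, (fun y : P => y v) @ F --> x v.
Proof.
move=> FF; rewrite cvg_sup; split=> Fx v; move: (Fx v).
  rewrite cvg_image; last by rewrite eqEsubset; split=> c // _; exists (cst c).
  apply: cvg_trans => W /=; rewrite ?nbhs_simpl /fmap /= => -[W' + <-].
  by apply: filterS => y W'y /=; exists y.
rewrite cvg_image; last by rewrite eqEsubset; split=> c // _; exists (cst c).
apply: cvg_trans => W /= FW; exists ((fun y : P => y v) @^-1` W) => //.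
by rewrite eqEsubset; split => [c [? + <-//]|c Wc]; exists (cst c).
Qed.

Lemma continuous_to_ptws (T : topologicalType) (f : T -> P) :
  (forall v, continuous (fun z => f z v)) -> continuous f.
Proof. by move=> cf z; apply/ptws_cvgP => v; exact: (cf v z). Qed.

Lemma coord_continuous v : continuous (fun x : P => x v).
Proof. by move=> x; have /ptws_cvgP/(_ v) : nbhs x --> x by exact: cvg_id. Qed.

Lemma nbhs_box x (W : set P) : nbhs x W ->
  exists2 r : R, 0 < r & forall y, (forall v, `|y v - x v| < r) -> W y.
Proof.
pose F : set_system P := filter_from [set r : R | 0 < r]
  (fun r => [set y : P | forall v, `|y v - x v| < r]).
have FF : Filter F.
  apply: filter_from_filter; first by exists 1 => /=.
  move=> r s /= r0 s0; exists (Num.min r s); first by rewrite /= lt_min r0.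
  by move=> y /= xy; split=> v; have := xy v; rewrite lt_min => /andP[].
have Fx : F --> x.
  apply/ptws_cvgP => v A /= /nbhs_ballP[r /= r0 rA]; exists r => //= y xy.
  by apply: rA; rewrite /ball /= distrC.
by move=> /Fx[r /= r0 rW]; exists r.
Qed.

End Pointwise.

Section Realisation.
Context {R : realType} {V : finType} (K : {set {set V}}).
Local Notation P := {ptws V -> R}.
Local Notation rK := (realisation R K).

Lemma coord_val_continuous v : continuous (fun x : rK => val x v).
Proof.
move=> x; apply: (@cvg_comp rK P R (fun y => val y) (fun y => y v)).
- exact: (@initial_continuous rK P (fun y => val y)).
- exact: coord_continuous.
Qed.

Lemma continuous_to_realisation (T : topologicalType) (f : T -> rK) :
  (forall v, continuous (fun z => val (f z) v)) -> continuous f.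
Proof.
move=> cf; apply: (@continuous_comp_initial _ _ _ (fun x : rK => val x : P)).
exact: continuous_to_ptws.
Qed.

Lemma nbhs_realisation_box (x : rK) (W : set rK) : nbhs x W ->
  exists2 r : R, 0 < r & forall y, (forall v, `|val y v - val x v| < r) -> W y.
Proof.
move=> [_ /= [[U oU <-]]] /= Ux UW.
have /nbhs_box[r r0 rU] : nbhs (val x : P) U by exact: open_nbhs_nbhs.
by exists r => // y /rU Uy; exact: UW.
Qed.

Lemma realisation_le1 (x : P) v : rK x -> x v <= 1.
Proof.
by case=> x0 <- _; rewrite (bigD1 v) //= lerDl sumr_ge0.
Qed.

Hypothesis K_face : forall A B : {set V}, A \in K -> B != finset.set0 ->
  B \subset A -> B \in K.

(** The realisation is closed in a cube: it is cut out by the sum of the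
coordinates and, for each non-simplex A, by the vanishing of the product of
the coordinates in A. *)
Lemma compact_realisation_set : compact (rK : set P).
Proof.
pose C := [set x : P | forall v, `[0, 1]%classic (x v)].
have cC : compact C.
  by apply: (@tychonoff V (fun=> R) (fun=> `[0, 1]%classic)) => v; exact: segment_compact.
have cprod (A : {set V}) : continuous (fun x : P => \prod_(v in A) x v).
  apply: (continuous_big (@mul_continuous R)) => v _.
  exact: coord_continuous.
have csum : continuous (fun x : P => \sum_v x v).
  apply: (continuous_big (@add_continuous R)) => v _.
  exact: coord_continuous.
pose Z := (fun x : P => \sum_v x v) @^-1` [set 1] `&`
  \bigcap_(A in [set A : {set V} | A \notin K /\ A != finset.set0])
    ((fun x : P => \prod_(v in A) x v) @^-1` [set 0]).
suff -> : rK = C `&` Z :> set P.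
  apply: compact_closedI => //.
  apply: closedI; first by apply: preimage_closed => [x _|]; [exact: csum|exact: closed_eq].
  apply: closed_bigI => A _.
  by apply: preimage_closed => [x _|]; [exact: cprod|exact: closed_eq].
apply/seteqP; split=> x.
  move=> rx; have [x0 x1 xK] := rx; split.
    by move=> v /=; rewrite in_itv /= x0 realisation_le1.
  split=> // A [AK A0] /=.
  have [/fintype.subsetP Ax|] := boolP (A \subset [set v | x v != 0]%SET).
    by case/negP: AK; apply: (K_face xK) => //; exact/fintype.subsetP.
  by case/subsetPn => v vA; rewrite inE negbK => /eqP xv0; rewrite (bigD1 v) //= xv0 mul0r.
move=> [xC [/= x1 xA]]; split=> // [v|].
  by have := xC v; rewrite /= in_itv /= => /andP[].
apply: contrapT => /negP xK; pose A := [set v | x v != 0]%SET.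
suff A0 : A != finset.set0.
  have /eqP := xA A (conj xK A0).
  by apply/negP/prodf_neq0 => v; rewrite inE.
apply: contra_eq_neq x1 => /setP x0.
rewrite big1 ?[0 == _]eq_sym ?oner_eq0 // => v _.
by have := x0 v; rewrite !inE => /negbFE/eqP.
Qed.

Lemma compact_realisation : compact [set: rK].
Proof.
have [[x0 x0K]|noK] := pselect (exists x, rK x); last first.
  suff -> : [set: rK] = set0 by exact: compact0.
  apply/seteqP; split=> // x _; apply: noK; exists (val x).
  exact: set_valP.
pose g (x : P) : rK := insubd (exist _ x0 (mem_set x0K)) x.
have gK x : rK x -> val (g x) = x by move=> rx; rewrite val_insubd mem_set.
have -> : [set: rK] = g @` rK.
  apply/seteqP; split=> // x _; exists (val x); first exact: set_valP.
  by apply: val_inj; rewrite gK //; exact: set_valP.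
apply: continuous_compact compact_realisation_set.
apply: (@continuous_comp_initial _ _ _ (fun x : rK => val x : P)).
apply: (@subspace_eq_continuous P rK P id (fun x => val (g x))); last first.
  exact: (@continuous_subspaceT P P rK id (fun x => cvg_id)).
by move=> x /set_mem/gK.
Qed.

End Realisation.

(** * Uniform continuity of homotopies *)

Section UniformContinuity.
Context {R : realType} {V : finType} (K : {set {set V}}).
Local Notation rK := (realisation R K).
Hypothesis K_face : forall A B : {set V}, A \in K -> B != finset.set0 ->
  B \subset A -> B \in K.

Definition close (e : R) (x y : {ptws V -> R}) := forall v, `|x v - y v| < e.

Lemma near_close (x : rK) (e : R) : 0 < e ->
  \forall y \near x, close e (val y) (val x).
Proof.
move=> e0; apply: (@filter_forall rK V (fun v y => `|val y v - val x v| < e) (nbhs x) _) => v.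
have /cvgrPdist_lt/(_ _ e0) := @coord_val_continuous R V K v x.
by apply: filterS => y; rewrite distrC.
Qed.

(** Uniform continuity on the compact product of the realisation and [0, 1],
from a covering by neighbourhoods on which H moves by less than e / 2. The
conditions on s and t are there because H is only continuous within [0, 1]. *)
Lemma homotopy_uniform (H : rK * R -> rK) (e : R) :
  {within setT `*` `[0, 1], continuous H} -> 0 < e ->
  exists2 r : R, 0 < r & forall x y s t, `[0, 1]%classic s ->
    `[0, 1]%classic t -> close r (val x) (val y) -> `|s - t| < r ->
    close e (val (H (x, s))) (val (H (y, t))).
Proof.
move=> cH e0; pose A : set (rK * R) := setT `*` `[0, 1].
have cA : compact A.
  by apply: compact_setX; [exact: compact_realisation|exact: segment_compact].
pose Q (r : R) (z : rK * R) := forall y t, `[0, 1]%classic t ->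
  close r (val z.1) (val y) -> `|z.2 - t| < r ->
  close e (val (H z)) (val (H (y, t))).
have Hnear (z : rK * R) : A z ->
    \forall w \near z, A w -> close (e / 2) (val (H w)) (val (H z)).
  move=> Az; move/subspace_continuousP : cH => /(_ z Az) Hz.
  exact: (Hz _ (near_close (H z) (divr_gt0 e0 (ltr0Sn _ 1)))).
have nQ : \forall r \near 0^'+, A `<=` Q r.
  move/compact_near_coveringP/near_covering_withinP: cA; apply=> -[x s] Axs.
  have [[W1 W2] /= [xW1 sW2] W12] := Hnear _ Axs.
  have [r1 r1_0 r1W] := nbhs_realisation_box xW1.
  move/nbhs_ballP: sW2 => [r2 /= r2_0 r2W].
  pose r := Num.min r1 r2; have r0 : 0 < r by rewrite lt_min r1_0.
  have r20 : 0 < r / 2 by rewrite divr_gt0.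
  have inW y t : close r (val y) (val x) -> `|t - s| < r -> `[0, 1]%classic t ->
      close (e / 2) (val (H (y, t))) (val (H (x, s))).
    move=> yx ts t01; apply: (W12 (y, t)) => //=; split=> /=.
      by apply: r1W => v; apply: (lt_le_trans (yx v)); rewrite ge_min lexx.
    apply: r2W; rewrite /ball /= distrC.
    by apply: (lt_le_trans ts); rewrite ge_min lexx orbT.
  have half a b c : `|a - b| < r / 2 -> `|b - c| < r / 2 -> `|a - c| < r.
    move=> ab bc; rewrite [r]splitr -(subrKA b).
    exact: le_lt_trans (ler_normD _ _) (ltrD ab bc).
  exists ([set y | close (r / 2) (val y) (val x)] `*` [set t | `|t - s| < r / 2],
          [set i | i < r / 2]) => /=.
    split; last exact: nbhs_right_lt.
    exists ([set y | close (r / 2) (val y) (val x)], [set t | `|t - s| < r / 2]) => //=.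
    split; first exact: near_close.
    by apply/nbhs_ballP; exists (r / 2) => //= t; rewrite /ball /= distrC.
  move=> [[y t] i] /= [[yx ts] ir] [_ /= t01] y' t' t'01 yy' tt' v.
  have rlt c : c < r / 2 -> c < r by move=> /lt_trans; apply; rewrite ltr_pdivrMr // ltr_pMr // ltr1n.
  rewrite [e]splitr -(subrKA (val (H (x, s)) v)).
  apply: le_lt_trans (ler_normD _ _) (ltrD _ _).
    by apply: inW => // [u|]; apply: rlt; [exact: yx | exact: ts].
  rewrite distrC; apply: inW => // [u|].
    by apply: half (yx u); rewrite distrC; exact: lt_trans (yy' u) ir.
  by apply: half ts; rewrite distrC; exact: lt_trans tt' ir.
have r0 : \forall r \near (0 : R)^'+, 0 < r by exact: nbhs_right_gt.
have [r [rQ r_gt0]] := @filter_ex _ _ (at_right_proper_filter 0) _ (filterI nQ r0).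
by exists r => // x y s t s01 t01 xy st; exact: (rQ (x, s) _ y t).
Qed.

End UniformContinuity.

(** * Barycentric subdivision shrinks simplices *)

Section Barycentre.
Context {R : realType} {V : finType}.
Local Notation P := {ptws V -> R}.
Implicit Types (x y : P) (v : V) (s u : seq P).

Definition bary s : P := fun v => (\sum_(x <- s) x v) / (size s)%:R.

(** A weak form of convexity, which passes from a simplex to all pieces of its
iterated subdivisions. *)
Definition bary_stable (Q : P -> Prop) :=
  forall s, s != [::] -> {in s, forall x, Q x} -> Q (bary s).

Lemma sd_stable Q s u : bary_stable Q -> {in s, forall x, Q x} ->
  u \in sd bary s -> {in u, forall x, Q x}.
Proof.
move=> stQ; have [n] := ubnP (size s); elim: n => // n IHn in s u *.
case: s => [|x s] lts Qs; first by rewrite sd_nil inE => /eqP->.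
case/sdP=> // t ts [w wt ->] y; rewrite inE => /orP[/eqP->|yw].
  exact: stQ.
apply: (IHn t w) yw => //; first by rewrite -(size_face ts).
by move=> z zt; apply: Qs; exact: mem_subseq (subseq_face ts) _ zt.
Qed.

Lemma sdn_stable Q n s u : bary_stable Q -> {in s, forall x, Q x} ->
  u \in sdn bary n s -> {in u, forall x, Q x}.
Proof.
move=> stQ; apply: (sdn_ind (P := fun _ s => {in s, forall x, Q x})) => _ t w.
exact: sd_stable.
Qed.

Lemma sumr_const_seq (c : R) s : \sum_(x <- s) c = c *+ size s.
Proof. by rewrite big_const_seq count_predT iter_addr_0. Qed.

Lemma bary_sub s v c : s != [::] ->
  bary s v - c = (\sum_(x <- s) (x v - c)) / (size s)%:R.
Proof.
move=> s0; have n0 : (size s)%:R != 0 :> R by rewrite pnatr_eq0 size_eq0.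
by rewrite sumrB sumr_const_seq mulrBl -[c *+ _]mulr_natr mulfK.
Qed.

Lemma stable_dist v (c r : R) : bary_stable (fun x => `|x v - c| <= r).
Proof.
move=> s s0 sr; have n0 : 0 < (size s)%:R :> R by rewrite ltr0n lt0n size_eq0.
rewrite bary_sub // normrM normfV (gtr0_norm n0) ler_pdivrMr // mulr_natr.
rewrite -sumr_const_seq; apply: le_trans (ler_norm_sum _ _ _) _.
by rewrite big_seq [leRHS]big_seq; apply: ler_sum => x /sr.
Qed.

Definition supported (A : {set V}) x :=
  [/\ forall v, 0 <= x v, \sum_v x v = 1 & forall v, v \notin A -> x v = 0].

Lemma stable_supported A : bary_stable (supported A).
Proof.
move=> s s0 sA; have n0 : (size s)%:R != 0 :> R by rewrite pnatr_eq0 size_eq0.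
split=> [v||v vA].
- by rewrite divr_ge0 // big_seq sumr_ge0 // => x /sA[].
- rewrite -mulr_suml exchange_big /= big_seq (eq_bigr (fun=> 1)).
    by rewrite -big_seq sumr_const_seq divff.
  by move=> x /sA[].
- by rewrite /bary big_seq big1 ?mul0r // => x /sA[_ _ ->].
Qed.

Definition small (D : R) s :=
  {in s &, forall x y, forall v, `|x v - y v| <= D}.

(** Among the at most n + 1 differences with the vertex x that are averaged,
the one of x itself is zero; this produces the factor n / (n + 1). *)
Lemma dist_bary_vertex n (D : R) s x v : (size s <= n.+1)%N -> 0 <= D ->
  small D s -> x \in s -> `|bary s v - x v| <= D * (n%:R / n.+1%:R).
Proof.
move=> sn D0 sD xs; have s0 : (0 < size s)%N by case: (s) xs.
have s_nil : s != [::] by rewrite -size_eq0 -lt0n.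
have n0 : 0 < (size s)%:R :> R by rewrite ltr0n.
rewrite bary_sub // normrM normfV (gtr0_norm n0) ler_pdivrMr //.
have le_sum : `|\sum_(y <- s) (y v - x v)| <= D * (size s).-1%:R.
  apply: le_trans (ler_norm_sum _ _ _) _; rewrite (big_rem _ xs) /=.
  rewrite subrr normr0 add0r -(size_rem xs) mulr_natr -sumr_const_seq.
  rewrite big_seq [leRHS]big_seq; apply: ler_sum => y /mem_rem ys.
  exact: sD.
apply: le_trans le_sum _; rewrite -mulrA ler_wpM2l //.
rewrite mulrAC ler_pdivlMr ?ltr0n // -!natrM ler_nat.
by case: (size s) s0 sn => // k _ kn /=; rewrite !mulnS [(n * k)%N]mulnC leq_add2r.
Qed.

(** Two points of a piece either lie in a proper face, or one of them is the
barycentre of s, whose distance to the other is bounded by its distance to the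
vertices. *)
Lemma small_sd n (D : R) s u : (size s <= n.+1)%N -> 0 <= D ->
  small D s -> u \in sd bary s -> small (D * (n%:R / n.+1%:R)) u.
Proof.
have [m] := ubnP (size s); elim: m => // m IHm in s u *.
case: s => [|x s] ltsm sn D0 sD; first by rewrite sd_nil inE => /eqP-> y.
case/sdP=> // t ts [w wt ->].
have r0 : 0 <= D * (n%:R / n.+1%:R) by rewrite mulr_ge0 // divr_ge0.
have ws v : {in w, forall y, `|y v - bary (x :: s) v| <= D * (n%:R / n.+1%:R)}.
  have := sd_stable (stable_dist (v := v) (c := bary (x :: s) v) (r := _)) _ wt.
  apply=> y yt; rewrite distrC.
  by apply: dist_bary_vertex => //; exact: mem_subseq (subseq_face ts) _ yt.
have sw : small (D * (n%:R / n.+1%:R)) w.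
  have := size_face ts; rewrite /= => -[st].
  apply: (IHm t) wt => //; first by rewrite -st.
    by rewrite -st ltnW.
  by move=> y z yt zt; apply: sD; exact: mem_subseq (subseq_face ts) _ _.
move=> y z; rewrite !inE => /orP[/eqP->|yw] /orP[/eqP->|zw] v.
- by rewrite subrr normr0.
- by rewrite distrC ws.
- exact: ws.
- exact: sw.
Qed.

Lemma small_sdn n N (D : R) s u : (size s <= n.+1)%N -> 0 <= D ->
  small D s -> u \in sdn bary N s -> small (D * (n%:R / n.+1%:R) ^+ N) u.
Proof.
elim: N s D => [|N IHN] s D sn D0 sD /=.
  by rewrite inE mulr1 => /eqP->.
case/flattenP=> _ /mapP[w ws ->] uw; rewrite exprS mulrA.
apply: (IHN w) uw; first by rewrite (size_sd ws).
  by rewrite mulr_ge0 // divr_ge0.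
exact: small_sd ws.
Qed.

End Barycentre.

(** * Contractible complexes are acyclic *)

Section Acyclicity.
Context {R : realType} {V : finType} (K : {set {set V}}).
Local Notation P := {ptws V -> R}.
Local Notation rK := (realisation R K).
Hypothesis K_face : forall A B : {set V}, A \in K -> B != finset.set0 ->
  B \subset A -> B \in K.
Hypothesis contrK : contractible R rK.

Let n := #|V|.

Definition vertex (v : V) : P := fun w => (w == v)%:R.

Lemma supported_vertex (A : {set V}) v : v \in A -> supported A (vertex v).
Proof.
move=> vA; split=> [w||w wA]; rewrite /vertex ?ler0n //.
  by rewrite (bigD1 v) //= eqxx big1 ?addr0 // => w /negbTE->.
by case: eqP => // wv; rewrite wv vA in wA.
Qed.

Definition big_coord (x : P) v := n%:R^-1 <= x v.

(** A vertex whose coordinate is at least 1 / n. It exists for points of the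
realisation because the n coordinates add up to 1, the default v0 only
concerns other functions. *)
Definition label (v0 : V) (x : P) := odflt v0 [pick v | big_coord x v].

Lemma label_big v0 A x : supported A x -> n%:R^-1 <= x (label v0 x).
Proof.
case=> x0 x1 xA; rewrite /label; case: pickP => // small_x.
have n0 : (0 < n)%N by apply/card_gt0P; exists v0.
suff : \sum_v x v < 1 by rewrite x1 ltxx.
have -> : 1 = \sum_(v : V) n%:R^-1 :> R.
  by rewrite sumr_const -/n -[_ *+ n]mulr_natr mulVf // pnatr_eq0 -lt0n.
apply: ltr_sum => [|v _]; first by apply/hasP; exists v0; rewrite ?mem_index_enum.
by rewrite ltNge; apply/negbT/small_x.
Qed.

Lemma label_supp v0 A x : supported A x -> label v0 x \in A.
Proof.
move=> sx; have := label_big v0 sx; case: sx => _ _ xA.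
apply: contraTT => /xA ->; rewrite -ltNge invr_gt0 ltr0n.
by apply/card_gt0P; exists v0.
Qed.

Lemma supported_realisation A x : A \in K -> supported A x -> rK x.
Proof.
move=> AK [x0 x1 xA]; split=> //; apply: K_face AK _ _.
  apply/negP => /eqP/setP x_0; suff : \sum_v x v = 0 by rewrite x1 => /eqP; rewrite oner_eq0.
  by rewrite big1 // => v _; have := x_0 v; rewrite !inE => /negbFE/eqP.
by apply/fintype.subsetP => v; rewrite inE; apply: contraTT => /xA ->; rewrite eqxx.
Qed.

Lemma realisation_supported x : rK x -> supported [set v | x v != 0]%SET x.
Proof. by case=> x0 x1 _; split=> // v; rewrite inE negbK => /eqP. Qed.

(** If x and y are closer than 1 / n, the label of y lies in the support of x,
for the coordinate of y at its label is too large to become zero. *)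
Lemma label_simplex v0 (w : seq P) : w != [::] -> {in w, forall x, rK x} ->
  {in w &, forall x y, close n%:R^-1 x y} ->
  [set v in map (label v0) w]%SET \in K.
Proof.
case: w => // x w _ wK wc; have [_ _ xK] := wK x (mem_head _ _).
apply: K_face xK _ _.
  by apply/set0Pn; exists (label v0 x); rewrite inE mem_head.
apply/fintype.subsetP => v; rewrite inE => /mapP[y yw ->].
rewrite inE; have := label_big v0 (realisation_supported (wK y yw)).
have := wc _ _ yw (mem_head _ _) (label v0 y).
move=> cyx big_y; apply: contraTneq cyx => ->.
by rewrite subr0 -leNgt (le_trans big_y) ?ler_norm.
Qed.

Lemma sdn_label v0 N (t : seq V) u : uniq t -> u \in sdn bary N (map vertex t) ->
  {subset map (label v0) u <= t}.
Proof.
move=> ut us v /mapP[x xu ->]; rewrite -[_ \in t]/(label v0 x \in mem t).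
have sup : supported [set v in t]%SET x.
  have/(_ _ x xu) := sdn_stable (@stable_supported R V [set v in t]%SET) _ us.
  apply=> _ /mapP[w wt ->].
  by apply: supported_vertex; rewrite inE.
by have := label_supp v0 sup; rewrite inE.
Qed.

Lemma vertices_small (t : seq V) : small (1 : R) (map vertex t).
Proof.
move=> x y /mapP[v _ ->] /mapP[w _ ->] z; rewrite /vertex.
by case: (_ == _); case: (_ == _); rewrite ?subrr ?normr0 ?subr0 ?sub0r ?normrN ?normr1.
Qed.

(** Let g be a cocycle. Pulled back along labels it becomes a cochain f on
tuples of points, whose coboundary vanishes on tuples of diameter less than 1
/ n. Cut the contraction into M short steps. The prisms between consecutive
stages over a fine tuple are small, so on fine tuples f is a coboundary up to
its value at the last stage, which is a constant tuple. Iterated subdivision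
makes the vertices of a simplex into fine tuples, and by Sperner's lemma the
pull-back of f to the vertices is g. *)
Theorem acyclic m (g : {set V} -> bool) :
  (forall A, A \in K -> #|A| = m.+2 -> delta g A = false) ->
  exists h, forall A, A \in K -> #|A| = m.+1 -> g A = delta h A.
Proof.
move=> g_cocycle; have [x0 [H [cH H0 H1 _]]] := contrK.
have [v0 _] : exists v0 : V, True.
  have [_ x1 _] := set_valP x0; apply: contrapT => noV.
  have : \sum_v val x0 v = 0 by rewrite big1 // => v _; case: noV; exists v.
  by rewrite x1 => /eqP; rewrite oner_eq0.
have n0 : (0 < n)%N by apply/card_gt0P; exists v0.
pose L := label v0.
pose f : seq P -> bool := ordered_cochain g \o map L.
pose lift (x : P) : rK := insubd x0 x.
have liftK x : rK x -> val (lift x) = x by move=> rx; rewrite val_insubd mem_set.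
pose h (s : R) (x : P) : P := val (H (lift x, s)).
have hK s x : rK (h s x) by exact: set_valP.
have invn0 : 0 < n%:R^-1 :> R by rewrite invr_gt0 ltr0n.
have [r r0 Hr] := homotopy_uniform K_face cH invn0.
have df_small (w : seq P) : size w = m.+2 -> {in w, forall x, rK x} ->
    {in w &, forall x y, close n%:R^-1 x y} -> cobd f w = false.
  move=> sw wK wc; rewrite (cobd_map (ordered_cochain g)) cobd_ordered.
  case: (boolP (uniq _)) => //= ut; apply: g_cocycle.
    by apply: label_simplex => //; rewrite -size_eq0 sw.
  by rewrite cardsE (card_uniqP ut) size_map.
pose fine (q : seq P) := [/\ size q = m.+1, {in q, forall x, rK x} &
  {in q &, forall x y, close r x y}].
have [M M0 Mr] : exists2 M, (0 < M)%N & M%:R^-1 < r.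
  have r1 : 0 < r^-1 by rewrite invr_gt0.
  have bound_r := archi_boundP (ltW r1); exists (Num.bound r^-1).
    by rewrite -(ltr0n R) (lt_trans r1).
  by rewrite invf_plt // posrE ?(lt_trans r1).
pose tau j : R := j%:R / M%:R.
have tau01 j : (j <= M)%N -> `[0, 1]%classic (tau j).
  move=> jM; rewrite /= in_itv /= /tau divr_ge0 //=.
  by rewrite ler_pdivrMr ?ltr0n // mul1r ler_nat.
have tauS j : `|tau j - tau j.+1| < r.
  rewrite distrC /tau -mulrBl -natrB // subSnn mul1r.
  by rewrite ger0_norm // invr_ge0.
have step j : (j < M)%N -> exists D, forall q, fine q ->
    cobd D q = f (map (h (tau j)) q) (+) f (map (h (tau j.+1)) q).
  move=> jM; exists (prism_sum (h (tau j)) (h (tau j.+1)) f) => q [sq qK qc].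
  rewrite -prism_formula.
  suff -> : prism_sum (h (tau j)) (h (tau j.+1)) (cobd f) q = false by rewrite addbF.
  apply: xsum0 => w wq; apply: df_small; first by rewrite (prism_size wq) sq.
    by move=> y yw; have [x _ [->|->]] := mem_prism wq yw.
  move=> y z yw zw; have [x xq yE] := mem_prism wq yw.
  have [x' x'q zE] := mem_prism wq zw.
  have xx' : close r (val (lift x)) (val (lift x')).
    by rewrite !liftK; [exact: qc | exact: qK | exact: qK].
  have tj := tau01 _ (ltnW jM); have tj1 := tau01 _ jM.
  have t0 k : `|tau k - tau k| < r by rewrite subrr normr0.
  by case: yE => ->; case: zE => ->; apply: Hr => //; rewrite distrC.
have steps j : (j <= M)%N -> exists D, forall q, fine q ->
    cobd D q = f q (+) f (map (h (tau j)) q).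
  elim: j => [_|j IHj jM].
    exists (fun=> false) => q [_ qK _]; rewrite [LHS]xsum0 //.
    rewrite map_id_in ?addbb // => x /qK xK.
    by rewrite /h /tau mul0r H0 liftK.
  have [D1 dD1] := IHj (ltnW jM); have [D2 dD2] := step _ jM.
  exists (fun s => D1 s (+) D2 s) => q fq.
  by rewrite cobd_add dD1 // dD2 // addbA addbK.
have [D dD] : exists D, forall q, fine q -> cobd D q = f q.
  (* At time 1 all entries coincide: f vanishes on such a tuple unless it is a
     singleton, and then the cochain c on the empty tuple accounts for it. *)
  have [D dD] := steps M (leqnn M); pose c := f (nseq m.+1 (val x0)).
  exists (fun s => D s (+) ((m == 0)%N && c)) => q fq.
  have tauM : tau M = 1 by rewrite /tau divff // pnatr_eq0 -lt0n.
  have -> : cobd (fun s => D s (+) ((m == 0)%N && c)) q =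
      cobd D q (+) cobd (fun=> (m == 0)%N && c) q by exact: cobd_add.
  rewrite dD // tauM; have [sq _ _] := fq.
  have -> : map (h 1) q = nseq m.+1 (val x0).
    rewrite -sq; elim: (q) => //= x q' ->; congr cons.
    by rewrite /h; have /= -> := H1 (lift x).
  rewrite -/c; case: (posnP m) => [m0|m0].
    move: sq; rewrite m0 => /eqP; case: (q) => // x [|//] _.
    by rewrite cobd_cons cobd_nil /= addbF addbK.
  rewrite /= [cobd (fun=> false) q]xsum0 // addbF.
  suff -> : c = false by rewrite addbF.
  by rewrite /c /f /= /ordered_cochain; case: (m) m0 => //= k _; rewrite mem_head.
have [N Nr] : exists N, (n%:R / n.+1%:R) ^+ N < r.
  have ratio0 : 0 <= n%:R / n.+1%:R :> R by rewrite divr_ge0.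
  have ratio1 : `|n%:R / n.+1%:R| < 1 :> R.
    by rewrite ger0_norm // ltr_pdivrMr ?ltr0n // mul1r ltr_nat.
  have /cvgrPdist_lt/(_ r r0)/filter_ex[N] := cvg_expr ratio1.
  by rewrite sub0r normrN ger0_norm ?exprn_ge0 //; exists N.
pose E : seq V -> bool := sdn_sum bary N D \o map vertex.
have dE t : uniq t -> [set v in t]%SET \in K -> size t = m.+1 ->
    cobd E t = g [set v in t]%SET.
  move=> ut tK st; rewrite cobd_map cobd_sdn.
  transitivity (sdn_sum bary N f (map vertex t)); last first.
    rewrite (sdn_sum_label (n := N) _ _ ut) /ordered_cochain ?ut // => t' u'.
    exact: sdn_label.
  apply: eq_in_xsum => u us; apply: dD; split.
  - by rewrite (size_sdn us) size_map.
  - have := sdn_stable (@stable_supported R V [set v in t]%SET) _ us.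
    move=> sup x xu; apply: (supported_realisation tK); apply: sup => //.
    by move=> _ /mapP[w wt ->]; apply: supported_vertex; rewrite inE.
  - move=> x y xu yu v; apply: le_lt_trans Nr.
    have := small_sdn (n := n) _ ler01 (@vertices_small t) us.
    rewrite mul1r size_map; apply=> //.
    by rewrite -(card_uniqP ut) ltnW // ltnS max_card.
exists (fun A : {set V} => E (enum A)) => A AK sA.
have setA : [set v in enum A]%SET = A by apply/setP=> v; rewrite inE mem_enum.
rewrite -{1}setA -dE ?enum_uniq ?setA -?cardE //.
rewrite /cobd faces_rem ?enum_uniq // /xsum big_map big_uniq ?enum_uniq //=.
rewrite /delta; apply: eq_big => [x|x _]; first by rewrite mem_enum.
congr E; rewrite rem_filter ?enum_uniq // /enum_mem -filter_predI.
by apply: eq_filter => y; rewrite !inE.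
Qed.

End Acyclicity.

(** * The Euler characteristic of an acyclic complex *)

Section Euler.
Context {V : finType} (K : {set {set V}}).
Hypothesis K_face : forall A B : {set V}, A \in K -> B != finset.set0 ->
  B \subset A -> B \in K.
Hypothesis K_neq0 : finset.set0 \notin K.
Hypothesis K_vertex : exists A, A \in K.
Hypothesis K_acyclic : forall m (g : {set V} -> bool),
  (forall A, A \in K -> #|A| = m.+2 -> delta g A = false) ->
  exists h, forall A, A \in K -> #|A| = m.+1 -> g A = delta h A.

Lemma delta_delta (g : {set V} -> bool) A : delta (delta g) A = false.
Proof.
have ut := enum_uniq A.
have -> : A = [set x in enum A]%SET by apply/setP=> x; rewrite inE mem_enum.
rewrite -cobd_ordered_uniq // -[RHS](cobd_cobd (ordered_cochain g) (enum A)).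
by apply: eq_cobd => t; rewrite cobd_ordered.
Qed.

(** The faces with m elements, including the empty one: the complex is
augmented. *)
Let S (m : nat) : {set {set V}} := [set A in finset.set0 |: K | #|A| == m]%SET.

Let D m : 'M['F_2]_(#|S m|, #|S m.+1|) :=
  \matrix_(i < #|S m|, j < #|S m.+1|)
    ((enum_val i : {set V}) \subset (enum_val j : {set V}))%:R.

Let cochain m (g : {set V} -> bool) : 'rV['F_2]_(#|S m|) :=
  \row_(i < #|S m|) (g (enum_val i))%:R.

Let cochainP m (u : 'rV_(#|S m|)) : exists g, u = cochain m g.
Proof.
exists (fun A => [exists i : 'I_#|S m|, (enum_val i == A) && (u 0 i != 0)]).
apply/rowP => i; rewrite mxE.
have -> : [exists j : 'I_#|S m|, (enum_val j == enum_val i) && (u 0 j != 0)] = (u 0 i != 0).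
  apply/existsP/idP => [[j /andP[/eqP/enum_val_inj -> //]]|ui].
  by exists i; rewrite eqxx.
by case: (u 0 i) => -[|[|]] //= ?; apply: val_inj.
Qed.

Let S_face m A x : A \in S m.+1 -> x \in A -> (A :\ x)%SET \in S m.
Proof.
rewrite !inE => /andP[/predU1P[-> |AK] /eqP sA] xA; first by rewrite inE in xA.
have sAx : #|(A :\ x)%SET| = m by have := cardsD1 x A; rewrite xA sA => -[].
rewrite sAx eqxx andbT; have [//|Ax0] := eqVneq.
by apply: (K_face AK) Ax0 _; exact: subD1set.
Qed.

Let cochain_delta m g : cochain m g *m D m = cochain m.+1 (delta g).
Proof.
apply/rowP => j; rewrite !mxE; set B := enum_val j.
have BS : B \in S m.+1 := enum_valP j.
under eq_bigr do rewrite !mxE.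
rewrite -(big_enum_val (fun A => (g A)%:R * (A \subset B)%:R : 'F_2)) /=.
rewrite /delta (big_morph (fun b : bool => b%:R : 'F_2) (id1 := 0) (op1 := +%R)) //;
  last by case=> -[]; apply: val_inj.
transitivity (\sum_(A in [set (B :\ x)%SET | x in B]%SET) (g A)%:R : 'F_2); last first.
  rewrite big_imset //= => x y xB yB /setP/(_ x); rewrite !inE eqxx xB andbT.
  by case: eqP.
rewrite [LHS](big_setID [set (B :\ x)%SET | x in B]%SET) /=.
rewrite [X in _ + X]big1 ?addr0 => [|A].
  apply: eq_big => [A|A]; last first.
    by rewrite inE => /andP[_ /imsetP[x _ ->]]; rewrite subD1set mulr1.
  rewrite inE andbC; case: (boolP (A \in _)) => //= /imsetP[x xB ->].
  exact: S_face.
rewrite inE => /andP[AB AS]; case: (boolP (A \subset B)) => sAB; last by rewrite mulr0.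
case/negP: AB; apply/imsetP.
have sB : #|B| = m.+1 by have := BS; rewrite inE => /andP[_ /eqP].
have sA : #|A| = m by have := AS; rewrite inE => /andP[_ /eqP].
have /cards1P[x BAx] : #|B :\: A| == 1%N.
  by rewrite cardsD (finset.setIidPr sAB) sB sA subSnn.
have xBA : x \in (B :\: A)%SET by rewrite BAx inE.
exists x; first by move: xBA; rewrite inE => /andP[].
apply/setP => y; rewrite !inE; have /setP/(_ y) := BAx; rewrite !inE.
case: (boolP (y \in A)) => yA /=; last by move=> <-; case: (y \in B).
by rewrite (fintype.subsetP sAB _ yA) => <-.
Qed.

(** Acyclicity says that the kernel of each coboundary matrix is the row space
of the previous one. *)
Let rank_D m : (\rank (D m) + \rank (D m.+1) = #|S m.+1|)%N.
Proof.
suff eqD : (kermx (D m.+1) :=: D m)%MS.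
  by rewrite -eqD mxrank_ker subnK // rank_leq_row.
apply/eqmxP/andP; split; last first.
  apply/sub_kermxP/row_matrixP => i; rewrite row_mul row0.
  rewrite rowE; have [g ->] := cochainP (delta_mx 0 i).
  rewrite !cochain_delta; apply/rowP => j; rewrite !mxE.
  by rewrite delta_delta.
apply/row_subP => i; have [g ug] := cochainP (row i (kermx (D m.+1))).
have : cochain m.+1 g *m D m.+1 = 0.
  by apply/sub_kermxP; rewrite -ug row_sub.
rewrite cochain_delta ug => /rowP dg.
have [A AK sA|h gh] := K_acyclic (m := m) (g := g).
  have AS : A \in S m.+2 by rewrite !inE AK sA eqxx orbT.
  have := dg (enum_rank_in AS A); rewrite !mxE enum_rankK_in //.
  by case: (delta g A).
suff -> : cochain m.+1 g = cochain m h *m D m by exact: submxMl.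
rewrite cochain_delta; apply/rowP => j; rewrite !mxE gh //.
  have := enum_valP j; rewrite !inE => /andP[/predU1P[->|//]].
  by rewrite cards0.
by have := enum_valP j; rewrite !inE => /andP[_ /eqP].
Qed.

Let card_S0 : #|S 0| = 1%N.
Proof.
rewrite (_ : S 0 = [set finset.set0]%SET) ?cards1 //.
apply/setP => A; rewrite !inE cards_eq0 andbC.
by case: eqP => // ->.
Qed.

Let rank_D0 : \rank (D 0) = 1%N.
Proof.
have rank_le1 : (\rank (D 0) <= 1)%N.
  by apply: leq_trans (rank_leq_row _) _; rewrite card_S0.
apply/eqP; rewrite eqn_leq rank_le1 lt0n mxrank_eq0.
have [A AK] := K_vertex.
have /set0Pn[x xA] : A != finset.set0 by apply: contraNneq K_neq0 => <-.
have xS : [set x]%SET \in S 1.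
  rewrite !inE cards1 eqxx andbT (K_face AK) ?orbT ?finset.sub1set //.
  by apply/set0Pn; exists x; rewrite inE.
have S0 : finset.set0 \in S 0 by rewrite !inE eqxx cards0.
apply/negP => /eqP/matrixP/(_ (enum_rank_in S0 finset.set0) (enum_rank_in xS [set x]%SET)).
by rewrite !mxE !enum_rankK_in // finset.sub0set.
Qed.

(** Each number of faces is the sum of two consecutive ranks, so that the
alternating sum over all faces, including the empty one, telescopes to zero.
*)
Theorem euler : \sum_(A in K) (-1) ^+ #|A| = -1 :> int.
Proof.
have alt j : \sum_(m < j.+1) (-1) ^+ m * #|S m|%:Z = (-1) ^+ j * (\rank (D j))%:Z.
  elim: j => [|j IHj]; first by rewrite big_ord1 rank_D0 card_S0.
  rewrite big_ord_recr /= IHj.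
  have -> : #|S j.+1|%:Z = (\rank (D j))%:Z + (\rank (D j.+1))%:Z.
    by rewrite -PoszD rank_D.
  rewrite mulrDr exprS !mulN1r !mulNr.
  by rewrite addrA addrN add0r.
have := alt #|V|.+1; have -> : \rank (D #|V|.+1) = 0%N.
  apply/eqP; rewrite -leqn0 (leq_trans (rank_leq_row _)) // leqn0 cards_eq0.
  apply/eqP/setP => A; rewrite !inE; apply/negbTE/negP => /andP[_ /eqP sA].
  by have := max_card A; rewrite sA ltnn.
rewrite mulr0 => sum0.
have : \sum_(A in finset.set0 |: K) (-1) ^+ #|A| = 0 :> int.
  apply: etrans sum0; rewrite (partition_big (fun A : {set V} => inord #|A| : 'I_(#|V|.+2)) xpredT) //=.
  have ltA A : (#|(A : {set V})| < #|V|.+2)%N by rewrite ltnS ltnW // ltnS max_card.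
  apply: eq_bigr => i _; transitivity (\sum_(A in S i) (-1) ^+ i : int).
    apply: eq_big => [A|A /andP[_ /eqP <-]]; last by rewrite inordK.
    by rewrite [in RHS]inE -val_eqE /= inordK.
  by rewrite sumr_const -mulr_natr natz.
rewrite big_setU1 //= cards0 expr0 => /eqP.
by rewrite addrC addr_eq0 => /eqP.
Qed.

End Euler.

(** * Posets with an acyclic order complex *)

Section ChainAcyclicity.
Context {R : realType} {disp : Order.disp_t} {X : finPOrderType disp}.
Local Open Scope order_scope.
Implicit Types (x y z : X) (A : {set X}) (s : seq X).

Lemma order_complex_face A B : A \in order_complex X -> B != finset.set0 ->
  B \subset A -> B \in order_complex X.
Proof.
rewrite !inE => /andP[_ /forall_inP chA] -> /fintype.subsetP BA /=.
apply/forall_inP => x /BA/chA/forall_inP xA; apply/forall_inP => y /BA.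
exact: xA.
Qed.

Lemma order_complex_neq0 : finset.set0 \notin order_complex X.
Proof. by rewrite inE eqxx. Qed.

Lemma sorted_chain s : sorted <%O s -> s != [::] ->
  [set x in s]%SET \in order_complex X.
Proof.
move=> lt_s s0; rewrite inE; apply/andP; split.
  by case: s s0 {lt_s} => // x s _; apply/set0Pn; exists x; rewrite inE mem_head.
apply/forall_inP => x; rewrite inE => xs; apply/forall_inP => y; rewrite inE => ys.
have le_s : sorted <=%O s by move: lt_s; rewrite lt_sorted_uniq_le => /andP[].
rewrite /Order.comparable.
have le_index := sorted_leq_index le_trans lexx le_s.
by have [/le_index->|/ltnW/le_index->] := leqP (index x s) (index y s); rewrite ?orbT.
Qed.

(** Chains correspond to strictly increasing lists, on which cochains can be
defined by pattern matching. *)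
Definition chain_seq A : seq X := sort <=%O (enum A).

Lemma chain_seq_sorted A : is_chain A -> sorted <%O (chain_seq A).
Proof.
move=> /forall_inP chA; rewrite lt_sorted_uniq_le sort_uniq enum_uniq /=.
apply: (sort_sorted_in (P := mem A)); last by apply/allP => x; rewrite mem_enum.
by move=> x y xA yA; exact: forall_inP (chA x xA) y yA.
Qed.

Lemma mem_chain_seq A : chain_seq A =i A.
Proof. by move=> x; rewrite mem_sort mem_enum. Qed.

Lemma chain_seqK s : sorted <%O s -> chain_seq [set x in s]%SET = s.
Proof.
move=> lt_s; apply: lt_sorted_eq => //; last by move=> x; rewrite mem_chain_seq inE.
apply: chain_seq_sorted; case: (eqVneq s [::]) => [->|s0].
  by apply/forall_inP => x; rewrite inE.
by have := sorted_chain lt_s s0; rewrite inE => /andP[].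
Qed.

Hypothesis cX : order_complex_contractible R X.

Lemma chain_acyclic m (f : seq X -> bool) :
  (forall s, sorted <%O s -> size s = m.+2 -> cobd f s = false) ->
  exists h, forall s, sorted <%O s -> size s = m.+1 -> f s = cobd h s.
Proof.
move=> f_cocycle; pose g A := f (chain_seq A).
have dg s : sorted <%O s -> delta g [set x in s]%SET = cobd f s.
  move=> lt_s; rewrite -cobd_ordered_uniq ?lt_sorted_uniq //.
  apply: eq_in_xsum => t /subseq_face ts.
  have lt_t : sorted <%O t := subseq_lt_sorted ts lt_s.
  by rewrite /ordered_cochain lt_sorted_uniq //= /g chain_seqK.
have [|h gh] := acyclic order_complex_face cX (m := m) (g := g).
  move=> A; rewrite inE => /andP[_ chA] sA.
  have -> : A = [set x in chain_seq A]%SET.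
    by apply/setP => x; rewrite inE mem_chain_seq.
  rewrite dg ?chain_seq_sorted // f_cocycle ?chain_seq_sorted //.
  by rewrite size_sort -cardE.
exists (fun s => h [set x in s]%SET) => s lt_s sm.
have us := lt_sorted_uniq lt_s.
rewrite -{1}(chain_seqK lt_s) -/(g _) gh; last 2 first.
- by apply: sorted_chain => //; rewrite -size_eq0 sm.
- by rewrite cardsE (card_uniqP us).
rewrite -cobd_ordered_uniq //; apply: eq_in_xsum => t /subseq_face ts.
by rewrite /ordered_cochain (subseq_uniq ts).
Qed.

(** A locally constant function is a cocycle in degree zero, hence the
coboundary of a constant. *)
Lemma poset_connected (e : X -> bool) :
  (forall x y, x < y -> e x = e y) -> forall x y, e x = e y.
Proof.
move=> e_lt; have [|h eh] := chain_acyclic (m := 0) (f := fun s => has e s).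
  move=> [|x [|y []]] //= /andP[xy _] _.
  by rewrite !cobd_cons cobd_nil /= !orbF (e_lt _ _ xy) addbF addbb.
have const x : e x = h [::].
  by have := eh [:: x] isT erefl; rewrite cobd_cons cobd_nil /= orbF addbF.
by move=> x y; rewrite !const.
Qed.

Lemma min_nlt c x : c \in Min X -> x < c = false.
Proof. by rewrite inE => /forallP/(_ x)/negbTE. Qed.

Lemma max_nlt a x : a \in Max X -> a < x = false.
Proof. by rewrite inE => /forallP/(_ x)/negbTE. Qed.

(** An edge of the order complex that lies in no triangle. *)
Definition bridge c a :=
  [/\ c \in Min X, a \in Max X, c < a & forall x, c < x -> x < a -> False].

(** No triangle contains the edge, so its indicator is a 1-cocycle. A
primitive of it is a function of the points that changes along this edge only.
*)
Lemma bridge_cut c a : bridge c a ->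
  exists e : X -> bool, forall x y, x < y -> e x (+) e y = (x == c) && (y == a).
Proof.
move=> [cMin aMax ca no_between].
have [|h fh] := chain_acyclic (m := 1) (f := pred1 [:: c; a]).
  move=> [|x [|y [|z []]]] //= /and3P[xy yz _] _.
  rewrite !cobd_cons cobd_nil /= !eqseq_cons !eqxx !andbT addbF.
  have -> : (y == c) = false by apply: contraTF xy => /eqP->; rewrite min_nlt.
  have -> : (y == a) = false by apply: contraTF yz => /eqP->; rewrite max_nlt.
  rewrite andbF addbF /=; apply/andP => -[/eqP xc /eqP za].
  by apply: (no_between y); rewrite -?xc -?za.
exists (fun x => h [:: x]) => x y xy.
have := fh [:: x; y]; rewrite /= xy => /(_ isT erefl).
by rewrite !eqseq_cons eqxx andbT => ->; rewrite !cobd_cons cobd_nil /= addbF addbC.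
Qed.

(** The pairs c, c' and b, b' and a, a' span an octahedron, a 2-cycle. As
nothing between c and a is comparable with b, the chain c < b < a is maximal
and its indicator is a cocycle; but it takes the value 1 on the octahedron,
which has this chain among its triangles. *)
Lemma no_sphere c c' b b' a a' : c != c' -> b != b' -> a != a' ->
  c \in Min X -> a \in Max X ->
  c < b -> c' < b -> c < b' -> c' < b' -> b < a -> b < a' -> b' < a -> b' < a' ->
  (forall x, c < x -> x < a -> x < b \/ b < x -> False) -> False.
Proof.
move=> cc' bb' aa' cMin aMax cb c'b cb' c'b' ba ba' b'a b'a' isolated.
have [|h fh] := chain_acyclic (m := 2) (f := pred1 [:: c; b; a]).
  move=> [|x [|y [|z [|w []]]]] //= /and4P[xy yz zw _] _.
  rewrite !cobd_cons cobd_nil /= !eqseq_cons !eqxx !andbT addbF.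
  have -> : (y == c) = false by apply: contraTF xy => /eqP->; rewrite min_nlt.
  have -> : (z == a) = false by apply: contraTF zw => /eqP->; rewrite max_nlt.
  have -> : [&& x == c, z == b & w == a] = false.
    apply/negbTE/and3P => -[/eqP xc /eqP zb /eqP wa].
    by apply: (isolated y); [rewrite -xc|rewrite -wa (lt_trans yz)|left; rewrite -zb].
  have -> : [&& x == c, y == b & w == a] = false.
    apply/negbTE/and3P => -[/eqP xc /eqP yb /eqP wa].
    by apply: (isolated z); [rewrite -xc (lt_trans xy)|rewrite -wa|right; rewrite -yb].
  by rewrite !andbF.
pose f s := s == [:: c; b; a].
have fE x y z : x < y -> y < z -> f [:: x; y; z] = h [:: y; z] (+) h [:: x; z] (+) h [:: x; y].
  move=> xy yz; have := fh [:: x; y; z]; rewrite /= xy yz => /(_ isT erefl) E.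
  by rewrite /f E !cobd_cons cobd_nil /= addbF addbA.
(* The four triangles at y: the terms on edges through y cancel in pairs, and
   what remains does not depend on y. *)
have square y : c < y -> c' < y -> y < a -> y < a' ->
    f [:: c; y; a] (+) f [:: c; y; a'] (+) f [:: c'; y; a] (+) f [:: c'; y; a'] =
    h [:: c; a] (+) h [:: c; a'] (+) h [:: c'; a] (+) h [:: c'; a'].
  move=> cy c'y ya ya'; rewrite !fE //.
  case: (h [:: y; a]); case: (h [:: y; a']); case: (h [:: c; y]); case: (h [:: c'; y]);
  case: (h [:: c; a]); case: (h [:: c; a']); case: (h [:: c'; a]); by case: (h [:: c'; a']).
have := square b cb c'b ba ba'; rewrite -(square b') // /f !eqseq_cons !eqxx !andbT.
by rewrite (eq_sym c') (eq_sym b') (eq_sym a') (negbTE cc') (negbTE bb') (negbTE aa') /= ?andbF.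
Qed.

End ChainAcyclicity.

(** * Bridges in minimal posets *)

Section Bridges.
Local Open Scope order_scope.

Definition comparable_lt disp (X : finPOrderType disp) (x y : X) :=
  (x < y) || (y < x).

(** A part Y of the poset joined to the rest by one edge only, a bridge
between y in Y and z outside. *)
Definition pendant disp (X : finPOrderType disp) (Y : {set X}) (y z : X) :=
  [/\ bridge y z \/ bridge z y, y \in Y, z \notin Y &
    forall x w, x \in Y -> w \notin Y -> comparable_lt x w -> x = y /\ w = z].

Section Basics.
Context {disp : Order.disp_t} {X : finPOrderType disp}.
Implicit Types (x y z : X) (Y : {set X}).

Lemma not_min x : x \notin Min X -> exists c, c < x.
Proof. by rewrite inE negb_forall => /existsP[c]; rewrite negbK; exists c. Qed.

Lemma not_max x : x \notin Max X -> exists a, x < a.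
Proof. by rewrite inE negb_forall => /existsP[a]; rewrite negbK; exists a. Qed.

Lemma midP x : reflect (x \notin Min X /\ x \notin Max X) (x \in Mid X).
Proof. by rewrite finset.in_setC finset.in_setU negb_or; exact: andP. Qed.

Lemma min_notin_mid x : x \in Min X -> x \notin Mid X.
Proof. by move=> xMin; apply/midP => -[/negP]. Qed.

Lemma max_notin_mid x : x \in Max X -> x \notin Mid X.
Proof. by move=> xMax; apply/midP => -[_ /negP]. Qed.

Lemma between_mid x y z : x < y -> y < z -> y \in Mid X.
Proof.
move=> xy yz; apply/midP; split; apply/negP.
  by move/(min_nlt x); rewrite xy.
by move/(max_nlt z); rewrite yz.
Qed.

Hypothesis Xmin : minimal_space X.

(** If every point below b were below c, then b would be a down-beat point. *)
Lemma two_below b : b \notin Min X ->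
  exists c c' : X, [/\ c < b, c' < b, c != c' & ~~ (c' <= c)].
Proof.
move=> /not_min[c cb]; have [_ nb] := Xmin b.
have [c'/andP[c'b c'c]|all_le] := pickP (fun c' : X => (c' < b) && ~~ (c' <= c)).
  by exists c, c'; split=> //; apply: contraNneq c'c => ->.
case: nb; exists c => // y yb.
by have := all_le y; rewrite yb /= => /negbFE.
Qed.

(** If every point above c were above b, then c would be an up-beat point. *)
Lemma above_not_min c b : c < b -> exists2 w : X, c < w & ~~ (b <= w).
Proof.
move=> cb; have [nb _] := Xmin c.
have [w /andP[cw bw]|all_le] := pickP (fun w : X => (c < w) && ~~ (b <= w)).
  by exists w.
case: nb; exists b => // y cy.
by have := all_le y; rewrite cy /= => /negbFE.
Qed.

(** By [above_not_min] some w above c is not above b. If w is maximal, a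
middle point lies between c and w because Y contains no bridge. *)
Lemma another_mid Y b c :
  (forall p q, p \in Y -> q \in Y -> ~ bridge p q) ->
  c \in Min X -> c \in Y -> c < b -> (forall w, comparable_lt c w -> w \in Y) ->
  (forall x, x \in Y -> x \in Mid X -> forall w, comparable_lt x w -> w \in Y) ->
  exists b' : X, [/\ b' \in Y, b' \in Mid X, c < b' & ~~ (b <= b')].
Proof.
move=> no_bridge cMin cY cb cc mc; have [w cw bw] := above_not_min cb.
have wY : w \in Y by apply: cc; rewrite /comparable_lt cw.
have wNmin : w \notin Min X by apply/negP => /(min_nlt c); rewrite cw.
have [wMax|wNmax] := boolP (w \in Max X); last first.
  by exists w; split=> //; apply/midP.
have [b' /andP[cb' b'w]|none] := pickP (fun x : X => (c < x) && (x < w)).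
  exists b'; split=> //; first by apply: cc; rewrite /comparable_lt cb'.
    exact: between_mid cb' b'w.
  by apply: contra bw => /le_lt_trans/(_ b'w)/ltW.
case: (no_bridge c w) => //; split=> // x cx xw.
by have := none x; rewrite cx xw.
Qed.

End Basics.

(** The indicator of an isolated point would be a locally constant function.
*)
Lemma not_isolated (R : realType) disp (X : finPOrderType disp) (x y : X) :
  order_complex_contractible R X -> x != y -> exists w, comparable_lt x w.
Proof.
move=> cX xy; apply/not_existsP => isolated.
suff : (x == x) = (y == x) by rewrite eqxx eq_sym (negbTE xy).
apply: (poset_connected cX (e := fun t => t == x)) => t u tu.
case: eqP => [tx|_]; first by case: (isolated u); rewrite /comparable_lt -tx tu.
case: eqP => // ux; case: (isolated t).
by rewrite /comparable_lt -ux tu orbT.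
Qed.

Section Dual.
Context {disp : Order.disp_t} {X : finPOrderType disp}.

Lemma order_complex_dual : order_complex (X^d) = order_complex X.
Proof.
apply/setP => A; rewrite !inE; congr andb; rewrite /is_chain.
by apply: eq_forallb_in => x _; apply: eq_forallb_in => y _; rewrite /Order.comparable orbC.
Qed.

Lemma contractible_dual R : order_complex_contractible R X ->
  order_complex_contractible R (X^d).
Proof. by rewrite /order_complex_contractible order_complex_dual. Qed.

Lemma minimal_dual : minimal_space X -> minimal_space (X^d).
Proof. by move=> Xmin x; have [] := Xmin x. Qed.

Lemma Mid_dual : Mid (X^d) = Mid X. Proof. by rewrite /Mid finset.setUC. Qed.

Lemma bridge_dual (c a : X) : bridge c a -> @bridge _ (X^d) a c.
Proof. by case=> cMin aMax ca nb; split=> // x ax xc; exact: nb xc ax. Qed.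

Lemma comparable_lt_dual (x y : X) :
  @comparable_lt _ (X^d) x y = comparable_lt x y.
Proof. by rewrite /comparable_lt orbC. Qed.

Lemma pendant_dual (Y : {set X}) y z : pendant Y y z -> @pendant _ (X^d) Y y z.
Proof.
case=> yz yY zY cross; split=> // [|x w xY wY].
  by case: yz => /bridge_dual; [right|left].
by rewrite comparable_lt_dual; exact: cross.
Qed.

End Dual.

End Bridges.

Section NoBridge.
Local Open Scope order_scope.
Context {R : realType}.

Lemma minimal_in disp (X : finPOrderType disp) (M : {set X}) :
  M != finset.set0 -> exists2 b, b \in M & forall x, x \in M -> ~~ (x < b).
Proof.
case/set0Pn => b0 b0M; have [b bM bmin] := arg_minnP (fun b : X => #|[set x | (x < b)%O]%SET|) b0M.
exists b => // x xM; apply/negP => xb; have := bmin x xM; rewrite leqNgt => /negP; apply.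
apply: proper_card; apply/properP; split.
  by apply/fintype.subsetP => z; rewrite !inE => /lt_trans; exact.
by exists x; rewrite !inE ?ltxx.
Qed.

(** Without middle points Y is reduced to y, which z makes an up-beat point.
Otherwise let b be minimal among the middle points of Y. By [another_mid]
there is a second one b' with the same points below it as b, except perhaps y,
and every point above b is above b' too. Two common points on each side span
an octahedron with b and b'. *)
Lemma pendant_min disp (X : finPOrderType disp) (Y : {set X}) y z :
  order_complex_contractible R X -> minimal_space X ->
  pendant Y y z -> bridge y z ->
  (forall p q, p \in Y -> q \in Y -> ~ bridge p q) ->
  (#|Y :&: Mid X| <= 2)%N -> False.
Proof.
move=> cX Xmin [_ yY zY cross] [yMin zMax yz _] no_bridge small_M.
set M := (Y :&: Mid X)%SET in small_M.
have inY x w : x \in Y -> x != y -> comparable_lt x w -> w \in Y.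
  by move=> xY xy xw; apply: contraNT xy => wY; have [-> _] := cross x w xY wY xw.
have midY x : x \in Mid X -> x != y.
  by apply: contraTneq => ->; exact: min_notin_mid.
have mid_near x w : x \in Y -> x \in Mid X -> comparable_lt x w -> w \in Y.
  by move=> xY /midY; exact: inY.
have memM x : x \in Y -> x \in Mid X -> x \in M.
  by move=> xY xMid; rewrite finset.in_setI xY.
have MP x : x \in M -> x \in Y /\ x \in Mid X.
  by rewrite finset.in_setI => /andP.
have [M0|M_neq0] := eqVneq M finset.set0.
  have noMid x : x \in Y -> x \notin Mid X.
    by move=> xY; apply/negP => /(memM _ xY); rewrite M0 inE.
  have Yy x : x \in Y -> x = y.
    move=> xY; apply/eqP/negPn/negP => xy.
    have [w xw] := not_isolated cX xy.
    have wY := inY _ _ xY xy xw.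
    have no_lt p q : p \in Y -> q \in Y -> p < q -> (p == x) || (q == x) -> False.
      move=> pY qY pq pqx; case: (no_bridge p q) => //; split=> //.
      - apply/negPn/negP => pMin; case/negP: (noMid _ pY); apply/midP; split=> //.
        by apply/negP => /(max_nlt q); rewrite pq.
      - apply/negPn/negP => qMax; case/negP: (noMid _ qY); apply/midP; split=> //.
        by apply/negP => /(min_nlt p); rewrite pq.
      move=> v pv vq; suff vY : v \in Y.
        by case/negP: (noMid _ vY); exact: between_mid pv vq.
      by apply: (inY x) => //; case/orP: pqx => /eqP <-; rewrite /comparable_lt ?pv ?vq ?orbT.
    case/orP: xw => [xw|wx]; first by apply: (no_lt x w) => //; rewrite eqxx.
    by apply: (no_lt w x) => //; rewrite eqxx orbT.
  have [nb _] := Xmin y; apply: nb; exists z => // w yw.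
  have wY : w \notin Y by apply/negP => /Yy wy; rewrite wy ltxx in yw.
  by have [|_ ->] := cross y w yY wY; rewrite /comparable_lt ?yw.
have [b bM bmin] := minimal_in M_neq0; have [bY bMid] := MP _ bM.
have twoM b' : b' \in M -> b' != b -> forall x, x \in M -> x = b \/ x = b'.
  move=> b'M b'b x xM; have [->|xb] := eqVneq x b; first by left.
  right; apply/eqP/negPn/negP => xb'; move: small_M; rewrite leqNgt => /negP; apply.
  rewrite (@leq_trans #|[set b; b'; x]%SET|) //.
    by rewrite -finset.setUA cardsU1 cards2 !inE eq_sym (negbTE b'b) (eq_sym b) (negbTE xb) eq_sym xb'.
  by apply/subset_leq_card; rewrite !finset.subUset !finset.sub1set bM b'M xM.
have below_min m x : m \in M -> (forall t, t \in M -> ~~ (t < m)) -> x < m ->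
    x \in Y /\ x \in Min X.
  move=> mM mmin xm; have [mY mMid] := MP _ mM.
  have xY : x \in Y by apply: (mid_near m) => //; rewrite /comparable_lt xm orbT.
  split=> //; apply/negPn/negP => xMin.
  suff /mmin : x \in M by rewrite xm.
  by apply: memM => //; apply/midP; split=> //; apply/negP => /(max_nlt m); rewrite xm.
have another m x : m \in M -> (forall t, t \in M -> ~~ (t < m)) -> x < m -> x != y ->
    exists b', [/\ b' \in M, x < b' & ~~ (m <= b')].
  move=> mM mmin xm xy; have [xY xMin] := below_min _ _ mM mmin xm.
  have [b' [b'Y b'Mid xb' mb']] := another_mid Xmin no_bridge xMin xY xm
    (fun w => inY x w xY xy) (fun t tY tMid w => @mid_near t w tY tMid).
  by exists b'; split=> //; exact: memM.
have b_notMin : b \notin Min X by case/midP: bMid.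
have [c1 [c2 [c1b c2b c12 _]]] := two_below Xmin b_notMin.
have [c cb cy] : exists2 c, c < b & c != y.
  have [c1y|] := eqVneq c1 y; last by exists c1.
  by exists c2; rewrite // -c1y eq_sym.
have [b' [b'M cb' bb']] := another _ _ bM bmin cb cy.
have [b'Y b'Mid] := MP _ b'M.
have b'b : b' != b by apply: contraNneq bb' => ->.
have inM := twoM _ b'M b'b.
have nbb' : ~~ (b < b') by apply: contra bb' => /ltW.
have b'min t : t \in M -> ~~ (t < b') by case/inM => ->; rewrite ?ltxx.
have b'nb : ~~ (b' <= b) by rewrite le_eqVlt (negbTE b'b) /= bmin.
have c_b' x : x < b -> x != y -> x < b'.
  move=> xb xy; have [m [/inM mM xm bm]] := another _ _ bM bmin xb xy.
  by case: mM xm bm => ->; rewrite ?lexx.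
have c_b x : x < b' -> x != y -> x < b.
  move=> xb' xy; have [m [/inM mM xm bm]] := another _ _ b'M b'min xb' xy.
  by case: mM xm bm => ->; rewrite ?lexx.
(* Only y can be below one of b and b' but not the other, so the two points
   below b or the two below b' can be chosen common to both. *)
have [e [e' [eb e'b ee' eb' e'b']]] : exists e e' : X, [/\ e < b, e' < b, e != e', e < b' & e' < b'].
  have b'_notMin : b' \notin Min X by case/midP: b'Mid.
  have [c3 [c4 [c3b' c4b' c34 _]]] := two_below Xmin b'_notMin.
  have [c3y|c3y] := eqVneq c3 y.
    have c4y : c4 != y by rewrite -c3y eq_sym.
    have [yb|yb] := boolP (y < b).
      by exists c, y; split=> //; rewrite -?c3y // c_b'.
    have c1y : c1 != y by apply: contraNneq yb => <-.
    have c2y : c2 != y by apply: contraNneq yb => <-.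
    by exists c1, c2; split=> //; exact: c_b'.
  have [c4y|c4y] := eqVneq c4 y; last by exists c3, c4; split=> //; exact: c_b.
  have [yb|yb] := boolP (y < b); first by exists c, y; split=> //; rewrite -?c4y // c_b'.
  have c1y : c1 != y by apply: contraNneq yb => <-.
  have c2y : c2 != y by apply: contraNneq yb => <-.
  by exists c1, c2; split=> //; exact: c_b'.
have above a : b < a -> b' < a /\ a \in Max X.
  move=> ba; have aY : a \in Y by apply: (mid_near b) => //; rewrite /comparable_lt ba.
  have ay : a != y by apply: contraTneq ba => ->; rewrite min_nlt.
  have aMax : a \in Max X.
    apply/negPn/negP => aMax; suff /inM[] : a \in M by move=> E; move: ba nbb'; rewrite E ?ltxx // => ->.
    by apply: memM => //; apply/midP; split=> //; apply/negP => /(min_nlt b); rewrite ba.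
  split=> //.
  have [|||m [mY]] := @another_mid _ (X^d) (minimal_dual Xmin) Y b a _ aMax aY ba.
  - by move=> p q pY qY /bridge_dual; exact: no_bridge.
  - by move=> w; rewrite comparable_lt_dual; exact: inY.
  - by move=> t tY; rewrite Mid_dual => tMid w; rewrite comparable_lt_dual; exact: mid_near.
  rewrite Mid_dual => mMid am mb.
  have /inM[mE|<- //] := memM _ mY mMid.
  by rewrite mE lexx in mb.
have [a [a' [ba ba' aa' _]]] := @two_below _ (X^d) (minimal_dual Xmin) b (proj2 (midP _ bMid)).
have [b'a aMax] := above _ ba; have [b'a' _] := above _ ba'.
have [_ eMin] := below_min _ _ bM bmin eb.
apply: (@no_sphere R _ X cX e e' b b' a a') => // [|x ex xa xb]; first by rewrite eq_sym.
have xY : x \in Y by apply: (mid_near b) => //; rewrite /comparable_lt orbC; apply/orP.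
have /inM[xE|xE] := memM _ xY (between_mid ex xa).
  by rewrite xE ltxx in xb; case: xb.
by rewrite xE (negbTE (bmin _ b'M)) (negbTE nbb') in xb; case: xb.
Qed.

Lemma comparable_ltC disp (X : finPOrderType disp) (x y : X) :
  comparable_lt x y = comparable_lt y x.
Proof. exact: orbC. Qed.

Lemma bridge_pendant disp (X : finPOrderType disp) (p q : X) :
  order_complex_contractible R X -> bridge p q ->
  exists W : {set X}, pendant W p q /\ pendant (~: W)%SET q p.
Proof.
move=> cX bpq; have [pMin qMax pq _] := bpq.
have [e cut] := bridge_cut cX bpq.
have cross x w : comparable_lt x w -> e x = e p -> e w != e p -> x = p /\ w = q.
  case/orP => [xw|wx] ex ew.
    have := cut _ _ xw; rewrite ex; case: (e w) (e p) ew => -[] //= _ /esym/andP[/eqP-> /eqP->] //.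
  have := cut _ _ wx; case: eqP => [wp|_ /=]; first by rewrite wp eqxx in ew.
  by rewrite ex; case: (e w) (e p) ew => -[].
have eq_q : e q != e p.
  by have := cut _ _ pq; rewrite !eqxx; case: (e p); case: (e q).
exists [set x | e x == e p]%SET; split; split.
- by left.
- by rewrite inE.
- by rewrite inE.
- by move=> x w; rewrite !inE => /eqP ex ew xw; exact: cross.
- by right.
- by rewrite !inE.
- by rewrite !inE eqxx.
- move=> x w; rewrite !inE negbK => ex /eqP ew xw.
  by have [|-> ->] := cross w x _ ew ex; rewrite // comparable_ltC.
Qed.

(** By induction on the size of Y. A bridge inside Y cuts X into two pendant
sides. The one that does not contain y lies in Y: its points outside Y would
be joined to no other point, while X is connected. So it is a smaller pendant
part. *)
Lemma no_pendant disp (X : finPOrderType disp) (Y : {set X}) y z :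
  order_complex_contractible R X -> minimal_space X ->
  pendant Y y z -> (#|Y :&: Mid X| <= 2)%N -> False.
Proof.
move=> cX Xmin; have [n] := ubnP #|Y|; elim: n => // n IHn in Y y z *.
move=> ltYn pY sM.
have [yz yY zY cross] := pY.
have no_bridge p q : p \in Y -> q \in Y -> ~ bridge p q.
  move=> pInY qInY bpq.
  have small_side (Z : {set X}) r t : pendant Z r t -> r \in Y -> t \in Y ->
      y \notin Z -> False.
    move=> pZ rY tY yZ; have [_ _ _ crossZ] := pZ.
    have yz_cmp : comparable_lt z y.
      by case: yz => -[_ _ lt_yz _]; rewrite /comparable_lt lt_yz ?orbT.
    have zZ : z \notin Z.
      apply/negP => zZ; have [zr _] := crossZ z y zZ yZ yz_cmp.
      by rewrite zr rY in zY.
    have outside x w : comparable_lt x w -> x \in Z -> x \notin Y ->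
        (w \in Z) && (w \notin Y).
      move=> xw xZ xY; apply/andP; split.
        apply/negPn/negP => wZ; have [xr _] := crossZ x w xZ wZ xw.
        by rewrite xr rY in xY.
      apply/negP => wY; have [|_ xz] := cross w x wY xY; first by rewrite comparable_ltC.
      by rewrite -xz xZ in zZ.
    have ZY x : x \in Z -> x \in Y.
      move=> xZ; apply/negPn/negP => xY.
      suff : (x \in Z) && (x \notin Y) = (y \in Z) && (y \notin Y).
        by rewrite xZ xY (negbTE yZ).
      apply: (poset_connected cX (e := fun t => (t \in Z) && (t \notin Y))) => u v uv.
      apply/idP/idP => /andP[]; apply: outside; rewrite /comparable_lt uv ?orbT //.
    apply: (IHn Z r t) => //.
      apply: leq_trans (_ : #|Y| <= n)%N => //; apply: proper_card.
      by apply/properP; split; [exact/fintype.subsetP | exists y].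
    apply: leq_trans (subset_leq_card _) sM.
    by apply/finset.setSI/fintype.subsetP.
  have [W [pW pWc]] := bridge_pendant cX bpq.
  have [yW|yW] := boolP (y \in W); last exact: small_side pW _ _ yW.
  by apply: small_side pWc _ _ _; rewrite // inE yW.
case: yz => byz; first exact: (pendant_min cX Xmin pY).
apply: (pendant_min (contractible_dual cX) (minimal_dual Xmin) (pendant_dual pY)).
- exact: bridge_dual.
- by move=> p q pY' qY /bridge_dual; exact: no_bridge.
- by rewrite Mid_dual.
Qed.

(** One of the two sides of a bridge contains at most two of the at most five
middle points. *)
Theorem no_bridge disp (X : finPOrderType disp) (p q : X) :
  order_complex_contractible R X -> minimal_space X -> (#|Mid X| <= 5)%N ->
  ~ bridge p q.
Proof.
move=> cX Xmin M5 bpq; have [W [pW pWc]] := bridge_pendant cX bpq.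
have [small|large] := leqP #|W :&: Mid X| 2; first exact: no_pendant pW small.
apply: (no_pendant cX Xmin pWc); rewrite -(leq_add2l 3) (leq_trans _ M5) //.
suff -> : #|Mid X| = (#|W :&: Mid X| + #|~: W :&: Mid X|)%N by rewrite leq_add2r.
rewrite -(cardsID W (Mid X)) finset.setIC; congr addn.
by apply: eq_card => t; rewrite !inE.
Qed.

End NoBridge.

(** * Elementary collapses *)

Lemma continuous_pair (T U W : topologicalType) (f : T -> U) (g : T -> W) :
  continuous f -> continuous g -> continuous (fun z => (f z, g z)).
Proof. by move=> cf cg z; exact: (cvg_pair (cf z) (cg z)). Qed.

Section Collapse.
Context {R : realType} {V : finType}.
Local Notation P := {ptws V -> R}.
Implicit Types (K : {set {set V}}) (A s : {set V}) (x : P).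

Definition clamp (t : R) : R := Num.max 0 (Num.min 1 t).

Lemma clamp_itv t : 0 <= clamp t <= 1.
Proof. by rewrite /clamp le_max lexx /= ge_max ler01 ge_min lexx. Qed.

Lemma clamp_id t : 0 <= t <= 1 -> clamp t = t.
Proof. by case/andP=> t0 t1; rewrite /clamp (min_idPr t1) (max_idPr t0). Qed.

Lemma clamp_le0 t : t <= 0 -> clamp t = 0.
Proof.
by move=> t0; rewrite /clamp (min_idPr (le_trans t0 ler01)) (max_idPl t0).
Qed.

Lemma clamp_ge1 t : 1 <= t -> clamp t = 1.
Proof. by move=> t1; rewrite /clamp (min_idPl t1) (max_idPr ler01). Qed.

Lemma clamp_continuous : continuous clamp.
Proof.
move=> t; apply: (@continuous_max R R (fun=> 0) (fun u => Num.min 1 u)).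
  exact: cst_continuous.
by apply: (@continuous_min R R (fun=> 1) id); [exact: cst_continuous | exact: cvg_id].
Qed.

Lemma continuous_clamp (T : topologicalType) (f : T -> R) :
  continuous f -> continuous (fun z => clamp (f z)).
Proof.
by move=> cf z; apply: continuous_comp; [exact: cf | exact: clamp_continuous].
Qed.

(** The homotopy lives on the whole space of functions V -> R and is only
required to preserve the realisation: homotopies can then be composed without
gluing continuous maps along closed subsets. *)
Definition ambient_contraction K :=
  exists (H : P -> R -> P) (p : P),
    [/\ forall v, continuous (fun z : P * R => H z.1 z.2 v),
        forall x, H x 0 = x,
        forall x t, realisation R K x -> 0 <= t <= 1 -> realisation R K (H x t),
        forall x, realisation R K x -> H x 1 = p
      & realisation R K p].

Definition face_closed K :=
  forall A B : {set V}, A \in K -> B != finset.set0 -> B \subset A -> B \in K.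

(** When s is a free face, this is the complex left by the elementary collapse
at s. *)
Definition remove_star K s := [set A in K | ~~ (s \subset A)]%SET.

Lemma face_closed_remove K s : face_closed K -> face_closed (remove_star K s).
Proof.
move=> Kf A B; rewrite !inE => /andP[AK sA] B0 BA; rewrite (Kf A) //=.
by apply: contra sA => sB; exact: fintype.subset_trans sB BA.
Qed.

Lemma ambient_contractible K :
  ambient_contraction K -> contractible R (realisation R K).
Proof.
move=> [H [p [cH H0 HK H1 Kp]]].
pose p0 : realisation R K := exist _ p (mem_set Kp).
have Hin (z : realisation R K * R) :
    H (val z.1) (clamp z.2) \in (realisation R K : set P).
  by apply/mem_set/HK; [exact: set_valP | exact: clamp_itv].
exists p0, (fun z => exist _ (H (val z.1) (clamp z.2)) (Hin z)); split.
- apply: continuous_subspaceT; apply: continuous_to_realisation => v /= z.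
  pose F (z : realisation R K * R) : P * R := (val z.1 : P, clamp z.2).
  apply: (@continuous_comp _ _ _ F (fun z => H z.1 z.2 v)); last exact: cH.
  apply: continuous_pair => [y|].
    apply: (@cvg_comp _ _ _ fst (fun y : realisation R K => val y : P)).
      exact: cvg_fst.
    exact: (@initial_continuous _ P (fun y : realisation R K => val y)).
  by apply: continuous_clamp => y; exact: cvg_snd.
- by move=> x; apply: val_inj; rewrite /= clamp_id ?lexx ?ler01 ?H0.
- move=> x; apply: val_inj; rewrite /= clamp_id ?lexx ?ler01 //.
  by apply: H1; exact: set_valP.
- move=> x ->; apply: val_inj; rewrite /= clamp_id ?lexx ?ler01 //.
  by rewrite H1.
Qed.

Lemma ambient_point v : ambient_contraction [set [set v]]%SET.
Proof.
have vertexE x : realisation R [set [set v]]%SET x -> x = vertex v.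
  case=> _ x1; rewrite inE => /eqP/setP xv.
  have x0 w : w != v -> x w = 0.
    by move=> wv; have := xv w; rewrite !inE (negbTE wv) => /negbFE/eqP.
  apply/funext => w; rewrite /vertex; case: eqP => [->|/eqP/x0 //].
  by rewrite -[RHS]x1 (bigD1 v) //= big1 ?addr0.
exists (fun x _ => x), (vertex v); split=> //.
- move=> w z; apply: (@cvg_comp _ _ _ fst (fun x : P => x w)).
    exact: cvg_fst.
  exact: coord_continuous.
- split=> [w||]; first by rewrite /vertex ler0n.
    by rewrite (bigD1 v) //= /vertex eqxx big1 ?addr0 // => w /negbTE->.
  rewrite inE; apply/eqP/setP => w; rewrite !inE /vertex pnatr_eq0.
  by case: (w == v).
Qed.

Section Step.
Variables (K : {set {set V}}) (s : {set V}) (w : V).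
Hypotheses (Kf : face_closed K) (s0 : s != finset.set0) (ws : w \notin s)
  (wsK : (w |: s)%SET \in K).
Hypothesis free : forall A, A \in K -> s \subset A -> A = s \/ A = (w |: s)%SET.

(** The homotopy [push] moves x away from the face s towards the vertex w
until a coordinate on s vanishes. The direction c preserves the sum of the
coordinates, and m x vanishes unless the support of x contains s, so that
points of the smaller complex do not move. *)
Let m x := \big[Num.min/1]_(v in s) x v.

Let c v : R := if v == w then #|s|%:R else if v \in s then -1 else 0.

Let push x (t : R) : P := fun v => x v + t * m x * c v.

Let sum_c : \sum_v c v = 0.
Proof.
rewrite (bigD1 w) //= /c eqxx.
rewrite (eq_bigr (fun v => if v \in s then -1 else 0)); last by move=> v /negbTE->.
rewrite -big_mkcondr /= (eq_bigl (fun v => v \in s)) => [|v]; last first.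
  by case: eqVneq => [->|_] //=; rewrite (negbTE ws).
by rewrite sumrN sumr_const subrr.
Qed.

Let m_continuous : continuous m.
Proof.
apply: (@continuous_big R V Num.min) => [z|v _]; last exact: coord_continuous.
by apply: (@continuous_min R _ fst snd); [exact: cvg_fst | exact: cvg_snd].
Qed.

Let push_continuous v : continuous (fun z : P * R => push z.1 z.2 v).
Proof.
have c1 : continuous (fun z : P * R => z.1 v).
  move=> z; apply: (@cvg_comp _ _ _ fst (fun x : P => x v)); first exact: cvg_fst.
  exact: coord_continuous.
have cm : continuous (fun z : P * R => m z.1).
  by move=> z; apply: (@cvg_comp _ _ _ fst m); [exact: cvg_fst | exact: m_continuous].
have cs : continuous (fun z : P * R => z.2) by move=> z; exact: cvg_snd.
have c2 : continuous (fun z : P * R => z.2 * m z.1 * c v).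
  move=> z; exact: (@continuousM R _ _ _ z (@continuousM R _ _ _ z (cs z) (cm z)) (@cst_continuous _ _ (c v) z)).
by move=> z; exact: (@continuousD R R _ _ _ z (c1 z) (c2 z)).
Qed.

Let m_ge0 x : realisation R K x -> 0 <= m x.
Proof.
case=> x0 _ _; rewrite /m; elim/big_ind: _ => // a b a0 b0.
by rewrite le_min a0.
Qed.

Let m_le x v : v \in s -> m x <= x v.
Proof. by move=> vs; exact: bigmin_le_cond. Qed.

Let push_realisation x t : realisation R K x -> 0 <= t <= 1 ->
  realisation R K (push x t).
Proof.
move=> xK /andP[t0 t1]; have [x0 x1 suppK] := xK.
have m0 := m_ge0 xK.
have [m_eq0|m_neq0] := eqVneq (m x) 0.
  suff -> : push x t = x by [].
  by apply/funext => v; rewrite /push m_eq0 mulr0 mul0r addr0.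
have p1 : \sum_v push x t v = 1.
  by rewrite big_split /= x1 -mulr_sumr sum_c mulr0 addr0.
have xs : s \subset [set v | x v != 0]%SET.
  apply/fintype.subsetP => v vs; rewrite inE gt_eqF //.
  by apply: lt_le_trans (m_le x vs); rewrite lt_def m_neq0.
have supp_ws v : v \notin (w |: s)%SET -> push x t v = 0.
  rewrite !inE negb_or => /andP[vw vs]; rewrite /push /c (negbTE vw) (negbTE vs).
  rewrite mulr0 addr0; apply/eqP/negPn/negP => xv.
  by case: (free suppK xs) => /setP/(_ v); rewrite !inE xv ?(negbTE vw) (negbTE vs).
split=> // [v|].
  rewrite /push /c; case: eqP => _.
    by rewrite addr_ge0 // mulr_ge0 // mulr_ge0.
  case: ifP => vs; last by rewrite mulr0 addr0.
  rewrite mulrN1 subr_ge0 (le_trans _ (m_le x vs)) //.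
  by rewrite ler_piMl.
apply: Kf wsK _ _.
  apply/negP => /eqP/setP p0; suff : \sum_v push x t v = 0 by rewrite p1 => /eqP; rewrite oner_eq0.
  by rewrite big1 // => v _; have := p0 v; rewrite !inE => /negbFE/eqP.
by apply/fintype.subsetP => v; rewrite [v \in finset _]inE; apply: contraTT => /supp_ws ->; rewrite eqxx.
Qed.

Let push1_realisation x : realisation R K x ->
  realisation R (remove_star K s) (push x 1).
Proof.
move=> xK; have [|p0 p1 pK] := push_realisation xK (t := 1).
  by rewrite ler01 lexx.
split=> //; rewrite inE pK /=.
have [v vs] := set0Pn _ s0.
have [u us mu] := @eq_bigmin _ _ V 1 v (fun v => v \in s) (fun v => x v) vs (fun v _ => realisation_le1 v xK).
apply/negP => /fintype.subsetP/(_ u us); rewrite inE /push /c.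
have -> : (u == w) = false by apply: contraNF ws => /eqP <-.
by rewrite (us : u \in s) mul1r mulrN1 /m mu subrr eqxx.
Qed.

(** The first half of the time interval pushes the open star of s away, the
second half contracts what is left. Clamping the time freezes each homotopy
outside its half. *)
Lemma ambient_collapse :
  ambient_contraction (remove_star K s) -> ambient_contraction K.
Proof.
move=> [H [p [cH H0 HK H1 [p0 p1 pK]]]].
have subK x : realisation R (remove_star K s) x -> realisation R K x.
  by case=> x0 x1; rewrite inE => /andP[].
exists (fun x t => H (push x (clamp (2 * t))) (clamp (2 * t - 1))), p; split.
- move=> v z.
  pose F (z : P * R) : P * R := (push z.1 (clamp (2 * z.2)), clamp (2 * z.2 - 1)).
  apply: (@continuous_comp _ _ _ F (fun z => H z.1 z.2 v)); last exact: cH.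
  have c2 : continuous (fun z : P * R => 2 * z.2).
    move=> y; have cs : continuous (fun z : P * R => z.2) by move=> ?; exact: cvg_snd.
    exact: (@continuousM R _ _ _ y (@cst_continuous _ _ (2 : R) y) (cs y)).
  apply: continuous_pair.
    apply: continuous_to_ptws => u y.
    pose G (z : P * R) : P * R := (z.1, clamp (2 * z.2)).
    apply: (@continuous_comp _ _ _ G (fun z => push z.1 z.2 u)); last exact: push_continuous.
    apply: continuous_pair => [y'|]; [exact: cvg_fst | exact: continuous_clamp].
  apply: continuous_clamp => y.
  exact: (@continuousD R R _ _ _ y (c2 y) (@cst_continuous _ _ (-1 : R) y)).
- move=> x; rewrite mulr0 sub0r !clamp_le0 ?lerN10 // H0.
  by apply/funext => v; rewrite /push !mul0r addr0.
- move=> x t xK /andP[t0 t1]; have [t_le|t_gt] := leP (2 * t) 1.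
    rewrite (clamp_le0 (t := 2 * t - 1)) ?subr_le0 // H0.
    exact/push_realisation/clamp_itv.
  rewrite (clamp_ge1 (ltW t_gt)); apply/subK/HK; last exact: clamp_itv.
  exact: push1_realisation.
- move=> x xK; rewrite mulr1 !clamp_ge1 ?ler1n //; last by rewrite lerBrDr.
  exact/H1/push1_realisation.
- exact: subK.
Qed.

End Step.
End Collapse.

(** * Order complexes as lists of chains *)

Section ChainLists.
Local Open Scope nat_scope.

(** A computable list of the simplices of an order complex: the sublists of E
whose entries are pairwise related, the empty list included. *)
Fixpoint chains (T : Type) (r : rel T) (E : seq T) : seq (seq T) :=
  if E is x :: E' then
    let c := chains r E' in c ++ [seq x :: t | t <- c & all (r x) t]
  else [:: [::]].

Lemma chains_map (T T' : Type) (f : T -> T') (r : rel T') E :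
  chains r (map f E) = map (map f) (chains (relpre f r) E).
Proof.
elim: E => //= x E ->; rewrite map_cat filter_map -!map_comp; congr (_ ++ _).
by congr map; apply: eq_filter => t /=; rewrite all_map.
Qed.

Lemma mem_chains (T : eqType) (r : rel T) E l :
  l \in chains r E = subseq l E && pairwise r l.
Proof.
elim: E l => [|x E IHE] l; first by rewrite inE; case: l.
rewrite /= mem_cat IHE; case: l => [|y l]; first by rewrite sub0seq.
case: (eqVneq y x) => [->|yx].
  rewrite mem_map; last by move=> ? ? [].
  rewrite mem_filter IHE /=; case: (boolP (subseq l E)) => [slE|nslE] /=.
    by rewrite orbC; case: (all _ _ && _) => //=; rewrite andbF.
  rewrite andbF orbF; apply/negbTE; rewrite negb_and; apply/orP; left.
  by apply: contra nslE; apply: subseq_trans; exact: subseq_cons.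
rewrite orbC; case: (boolP (_ \in map _ _)) => // /mapP[t _ [yE _]].
by rewrite yE eqxx in yx.
Qed.

Lemma uniq_chains (T : eqType) (r : rel T) E : uniq E -> uniq (chains r E).
Proof.
elim: E => //= x E IHE /andP[xE /IHE uc]; rewrite cat_uniq uc /=.
rewrite map_inj_uniq ?filter_uniq ?andbT //; last by move=> ? ? [].
apply/hasPn => _ /mapP[t _ ->]; rewrite mem_chains negb_and; apply/orP; left.
by apply: contra xE => /mem_subseq; apply; rewrite mem_head.
Qed.

Lemma eq_in_chains (T : eqType) (r r' : rel T) (E : seq T) :
  {in E &, r =2 r'} -> chains r E = chains r' E.
Proof.
elim: E => //= x E IHE rr'.
have sub : {subset E <= x :: E} by move=> y yE; rewrite inE yE orbT.
rewrite IHE; last by move=> y z yE zE; apply: rr'; exact: sub.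
congr (_ ++ map _ _); apply: eq_in_filter => t; rewrite mem_chains => /andP[tE _].
by apply: eq_in_all => y /(mem_subseq tE) yE; apply: rr'; rewrite ?mem_head ?sub.
Qed.

Definition comparable_rel disp (X : finPOrderType disp) : rel X :=
  fun x y => (x >=< y)%O.

Section OrderComplex.
Context {disp : Order.disp_t} {X : finPOrderType disp} (E : seq X).
Hypotheses (uE : uniq E) (fullE : forall x, x \in E).
Local Notation chE := (chains (@comparable_rel _ X) E).

Lemma is_chain_seq l :
  is_chain [set x in l]%SET = pairwise (@comparable_rel _ X) l.
Proof.
rewrite pairwise_all2rel; last 2 first.
- by move=> x; rewrite /comparable_rel /Order.comparable lexx.
- by move=> x y; rewrite /comparable_rel /Order.comparable orbC.
apply/forall_inP/allrelP => [chl x y xl yl|chl x].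
  have xA : x \in [set z in l]%SET by rewrite inE.
  have yA : y \in [set z in l]%SET by rewrite inE.
  exact: (forall_inP (chl x xA) y yA).
by rewrite inE => xl; apply/forall_inP => y; rewrite inE; exact: chl.
Qed.

Lemma set_filter (A : {set X}) : [set x in [seq x <- E | x \in A]]%SET = A.
Proof. by apply/setP => x; rewrite inE mem_filter fullE andbT. Qed.

Lemma chains_set_inj : {in chE &, injective (fun l => [set x in l]%SET)}.
Proof.
move=> l l'; rewrite !mem_chains => /andP[lE _] /andP[l'E _] /setP ll'.
rewrite ((subseq_uniqP uE) lE) ((subseq_uniqP uE) l'E).
by apply: eq_filter => x; have := ll' x; rewrite !inE.
Qed.

Lemma order_complex_chains A : (A \in order_complex X) =
  has (fun l => (l != [::]) && (A == [set x in l]%SET)) chE.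
Proof.
rewrite inE; apply/andP/hasP => [[A0 chA]|[l lch /andP[l0 /eqP->]]]; last first.
  split; first by case: l l0 {lch} => // x l _; apply/set0Pn; exists x; rewrite inE mem_head.
  by rewrite is_chain_seq; move: lch; rewrite mem_chains => /andP[].
exists [seq x <- E | x \in A].
  by rewrite mem_chains filter_subseq -is_chain_seq set_filter.
rewrite set_filter eqxx andbT; apply: contraNneq A0 => El.
by rewrite -(set_filter A) El; apply/eqP/setP => x; rewrite !inE.
Qed.

Lemma sum_order_complex :
  (\sum_(A in order_complex X) (-1) ^+ #|A| =
   \sum_(l <- chE | l != [::]) (-1) ^+ size l :> int)%R.
Proof.
have -> : order_complex X =
    [set A in map (fun l => [set x in l]%SET) [seq l <- chE | l != [::]]]%SET.
  apply/setP => A; rewrite order_complex_chains inE.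
  apply/hasP/mapP => [[l lch /andP[l0 /eqP->]]|[l]].
    by exists l; rewrite // mem_filter l0.
  by rewrite mem_filter => /andP[l0 lch] ->; exists l; rewrite // l0 eqxx.
rewrite (eq_bigl (fun A => A \in map (fun l => [set x in l]%SET) [seq l <- chE | l != [::]]));
  last by move=> A; rewrite inE.
rewrite -big_uniq /=; last first.
  rewrite map_inj_in_uniq ?filter_uniq ?uniq_chains //.
  by move=> l l'; rewrite !mem_filter => /andP[_ lch] /andP[_ l'ch]; exact: chains_set_inj.
rewrite big_map big_filter big_seq_cond [RHS]big_seq_cond.
apply: eq_bigr => l /andP[lch _]; congr (_ ^+ _)%R; rewrite cardsE.
by apply/card_uniqP; move: lch; rewrite mem_chains => /andP[/subseq_uniq->].
Qed.

End OrderComplex.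

(** The empty chain counts among the even ones; without it the even chains are
one fewer than the odd ones. *)
Definition euler_one (T : Type) (c : seq (seq T)) : bool :=
  count (fun l => odd (size l)) c == count (fun l => ~~ odd (size l)) c.

Lemma signed_count (T : Type) (c : seq (seq T)) :
  (\sum_(l <- c) (-1) ^+ size l =
   (count (fun l => ~~ odd (size l)) c)%:Z - (count (fun l => odd (size l)) c)%:Z :> int)%R.
Proof.
elim: c => [|l c IHc]; first by rewrite big_nil.
rewrite big_cons IHc /= -signr_odd; case: (odd _) => /=.
  by rewrite add0n add1n intS expr1; ring.
by rewrite add0n add1n intS expr0; ring.
Qed.

End ChainLists.

Section EulerChains.
Context {R : realType} {disp : Order.disp_t} {X : finPOrderType disp} (E : seq X).
Hypotheses (uE : uniq E) (fullE : forall x, x \in E).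

Lemma euler_chains : order_complex_contractible R X ->
  euler_one (chains (@comparable_rel _ X) E).
Proof.
move=> cX; have [x0 _] := cX; have [_ _ x0K] := set_valP x0.
have := @euler _ (order_complex X) (@order_complex_face _ X) (@order_complex_neq0 _ X)
  (ex_intro (fun A => A \in order_complex X) _ x0K) (fun m g => acyclic (@order_complex_face _ X) cX (m := m) (g := g)).
rewrite (sum_order_complex uE fullE) => sum_eq.
have nil_in : [::] \in chains (@comparable_rel _ X) E by rewrite mem_chains sub0seq.
have := signed_count (chains (@comparable_rel _ X) E).
rewrite (bigD1_seq _ nil_in (uniq_chains _ uE)) /= sum_eq expr0 subrr => /esym/eqP.
by rewrite subr_eq0 /euler_one eq_sym.
Qed.

End EulerChains.

(** * Greedy collapses *)

Section ListCollapse.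
Context {R : realType} {V : finType}.
Implicit Types (l s : seq V) (L : seq (seq V)).

Definition seq_complex L : {set {set V}} :=
  [set A : {set V} | has (fun l => A == [set x in l]%SET) L]%SET.

Definition contains s l := all (mem l) s.

Definition same_set l l' := contains l l' && contains l' l.

Definition free_face L s :=
  let star := [seq l <- L | contains s l] in
  (s != [::]) && has (fun w => [&& w \notin s, has (same_set (w :: s)) star
    & all (fun l => same_set s l || same_set (w :: s) l) star]) (flatten star).

(** Removes the first free face until a single vertex is left, within n steps.
The greedy choice may fail for a collapsible complex, but success certifies a
sequence of collapses. *)
Fixpoint collapsible n L : bool :=
  if L is [:: [:: _]] then true
  else if n is n'.+1 then
    if [seq s <- L | free_face L s] is s :: _ then
      collapsible n' [seq l <- L | ~~ contains s l]
    else false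
  else false.

Lemma containsE s l : contains s l = ([set x in s] \subset [set x in l])%SET.
Proof.
apply/allP/fintype.subsetP => sl x; first by rewrite !inE => /sl.
by move=> xs; have := sl x; rewrite !inE => /(_ xs).
Qed.

Lemma same_setE l l' : same_set l l' = ([set x in l]%SET == [set x in l']%SET).
Proof. by rewrite /same_set !containsE finset.eqEsubset. Qed.

Lemma seq_complexP L (A : {set V}) :
  reflect (exists2 l, l \in L & A = [set x in l]%SET) (A \in seq_complex L).
Proof.
rewrite inE; apply: (iffP hasP) => -[l lL].
  by move/eqP; exists l.
by move=> ->; exists l.
Qed.

Lemma remove_star_seq L s :
  remove_star (seq_complex L) [set x in s]%SET = seq_complex [seq l <- L | ~~ contains s l].
Proof.
apply/setP => A; rewrite [A \in remove_star _ _]inE.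
apply/andP/seq_complexP => [[/seq_complexP[l lL ->] sl]|[l]].
  by exists l; rewrite // mem_filter containsE sl.
by rewrite mem_filter containsE => /andP[sl lL] ->; split=> //; apply/seq_complexP; exists l.
Qed.

Lemma collapsible_contraction n L : face_closed (seq_complex L) ->
  collapsible n L -> ambient_contraction (R := R) (seq_complex L).
Proof.
have point v : ambient_contraction (R := R) (seq_complex [:: [:: v]]).
  suff -> : seq_complex [:: [:: v]] = [set [set v]]%SET by exact: ambient_point.
  apply/setP => A; rewrite !inE /= orbF; congr (A == _).
  by apply/setP => x; rewrite !inE.
have step m : (forall L, face_closed (seq_complex L) -> collapsible m L ->
      ambient_contraction (R := R) (seq_complex L)) ->
    forall L, face_closed (seq_complex L) ->
    (if [seq s <- L | free_face L s] is s :: _ then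
      collapsible m [seq l <- L | ~~ contains s l] else false) ->
    ambient_contraction (R := R) (seq_complex L).
  move=> IH {}L Lf; case E : [seq s <- L | _] => [//|s t] col.
  have : s \in [seq s <- L | free_face L s] by rewrite E mem_head.
  rewrite mem_filter => /andP[/andP[s0 /hasP[w _ /and3P[ws /hasP[l0 l0L wsl0] star]]] sL].
  have ws_set : [set x in w :: s]%SET = (w |: [set x in s])%SET by rewrite set_cons.
  apply: (@ambient_collapse _ _ _ [set x in s]%SET w) => //.
  - by case: (s) s0 => // x s' _; apply/set0Pn; exists x; rewrite inE mem_head.
  - by rewrite inE.
  - apply/seq_complexP; exists l0.
      by move: l0L; rewrite mem_filter => /andP[].
    by rewrite -ws_set; apply/eqP; rewrite -same_setE.
  - move=> A /seq_complexP[l lL ->] sl.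
    have := allP star l; rewrite mem_filter containsE sl lL => /(_ isT).
    by rewrite !same_setE ws_set => /orP[] /eqP->; [left|right].
  rewrite remove_star_seq; apply: IH => //.
  by rewrite -remove_star_seq; exact: face_closed_remove.
elim: n L => [|n IHn] L Lf.
  by case: L Lf => [|[|v [|? ?]] [|? ?]] //= _ _; exact: point.
have := step n IHn L Lf.
by case: L Lf => [|[|v [|? ?]] [|? ?]] //= _ _; rewrite ?point //; apply.
Qed.

End ListCollapse.

(** * Finite spaces *)

Section FiniteSpaces.
Local Open Scope order_scope.

Section Nbhs.
Context {disp : Order.disp_t} {X : finPOrderType disp}.

Lemma open_down (x : X) : open ([set y | y <= x]%classic : set (T0space X)).
Proof. by move=> y z zy /= yx; exact: le_trans zy yx. Qed.

Lemma nbhs_down (x : T0space X) : nbhs x ([set y | (y : X) <= x]%classic : set (T0space X)).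
Proof. by apply: open_nbhs_nbhs; split; [exact: open_down | exact: lexx]. Qed.

Lemma nbhs_le (x y : T0space X) (U : set (T0space X)) :
  nbhs x U -> (y : X) <= x -> U y.
Proof.
by rewrite nbhsE => -[O [oO Ox] OU] yx; apply: OU; exact: (oO x y yx Ox).
Qed.

End Nbhs.


Lemma continuous_homo disp disp' (X : finPOrderType disp)
  (Y : finPOrderType disp') (f : T0space X -> T0space Y) : continuous f ->
  {homo (f : X -> Y) : x y / x <= y}.
Proof. by move=> cf x y xy; exact: (nbhs_le (cf y _ (nbhs_down (f y))) xy). Qed.

Lemma homo_continuous disp disp' (X : finPOrderType disp)
  (Y : finPOrderType disp') (f : X -> Y) : {homo f : x y / x <= y} ->
  continuous (f : T0space X -> T0space Y).
Proof.
move=> hf; apply/continuousP => A oA.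
suff : down_set ((f : T0space X -> T0space Y) @^-1` A) by [].
by move=> x y yx; exact: (oA _ _ (hf _ _ yx)).
Qed.

Lemma homeomorphic_iso disp disp' (X : finPOrderType disp)
  (Y : finPOrderType disp') : homeomorphic (T0space X) (T0space Y) ->
  exists2 f : X -> Y, bijective f & {mono f : x y / x <= y}.
Proof.
move=> [f [g [cf cg fK gK]]]; exists f; first by exists g.
move=> x y; apply/idP/idP; last exact: continuous_homo.
by move=> /(continuous_homo cg); rewrite !fK.
Qed.

Lemma iso_homeomorphic disp disp' (X : finPOrderType disp)
  (Y : finPOrderType disp') (f : X -> Y) : bijective f ->
  {mono f : x y / x <= y} -> homeomorphic (T0space X) (T0space Y).
Proof.
move=> [g fK gK] mf; exists f, g; split=> //.
  by apply: homo_continuous => x y; rewrite mf.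
by apply: homo_continuous => x y xy; rewrite -mf !gK.
Qed.


(** By induction from below: if f fixes every point below x and f x < x, then
f x is the maximum of the points below x. *)
Lemma homo_le_id disp (X : finPOrderType disp) (f : X -> X) :
  minimal_space X -> {homo f : x y / x <= y} -> (forall x, f x <= x) ->
  forall x, f x = x.
Proof.
move=> Xmin hf fle x; have [n] := ubnP #|[set y : X | y < x]%SET|.
elim: n => // n IHn in x *; rewrite ltnS => ltxn.
have fix_below y : y < x -> f y = y.
  move=> yx; apply: IHn; apply: leq_trans ltxn; apply: proper_card.
  apply/properP; split; last by exists y; rewrite !inE ?ltxx.
  by apply/fintype.subsetP => z; rewrite !inE => /lt_trans; exact.
have [//|fx_neq] := eqVneq (f x) x.
have [_ nb] := Xmin x; case: nb; exists (f x); first by rewrite lt_neqAle fx_neq fle.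
by move=> y yx; rewrite -(fix_below y yx) hf // ltW.
Qed.

Lemma homo_ge_id disp (X : finPOrderType disp) (f : X -> X) :
  minimal_space X -> {homo f : x y / x <= y} -> (forall x, x <= f x) ->
  forall x, f x = x.
Proof.
move=> Xmin hf fge; apply: (@homo_le_id _ (X^d) f (minimal_dual Xmin)) => //.
by move=> x y xy; exact: hf.
Qed.

(** Stong's argument. For s near t the map H_s lies below H_t, because the
points below H (x, t) form a neighbourhood of it. By [homo_le_id] and
[homo_ge_id] the times at which the map is the identity then form an open and
closed subset of [0, 1], which contains 0. *)
Theorem minimal_contractible (R : realType) disp (X : finPOrderType disp) :
  minimal_space X -> contractible R (T0space X) -> forall x y : X, x = y.
Proof.
move=> Xmin [x0 [H [cH H0 H1 _]]].
pose A : set (T0space X * R) := (setT `*` `[0%R, 1%R])%classic.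
have near_le (x : X) (t : R) : (`[0%R, 1%R]%classic) t ->
    \forall z \near ((x : T0space X), t), A z -> (H z : X) <= H (x : T0space X, t).
  move=> t01; have Axt : A (x, t) by [].
  move/subspace_continuousP : cH => /(_ _ Axt) Hxt.
  exact: (Hxt _ (nbhs_down (H (x : T0space X, t)))).
have H_homo (t : R) : (`[0%R, 1%R]%classic) t -> {homo (fun x : X => H (x, t) : X) : x y / x <= y}.
  move=> t01 y x yx; have [[U W] /= [xU tW] UW] := near_le x t t01.
  by apply: (UW (y, t)) => //; split=> /=; [exact: nbhs_le xU yx | exact: nbhs_singleton].
have H_near (t : R) : (`[0%R, 1%R]%classic) t ->
    \forall s \near t, (`[0%R, 1%R]%classic) s -> forall x : X, (H (x, s) : X) <= H (x, t).
  move=> t01; have : \forall s \near t, forall x : X,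
      (`[0%R, 1%R]%classic) s -> (H (x, s) : X) <= H (x, t).
    apply: (@filter_forall R X (fun x s => (`[0%R, 1%R]%classic) s -> (H (x, s) : X) <= H (x, t)) (nbhs t) _) => x.
    have [[U W] /= [xU tW] UW] := near_le x t t01.
    apply: filterS tW => s Ws s01; apply: (UW (x, s)) => //.
    by split=> //=; exact: (nbhs_singleton xU).
  by apply: filterS => s + s01 x => /(_ x s01).
pose B : set R := [set t | (`[0%R, 1%R]%classic) t /\ forall x, H (x, t) = x].
have BE : B = (`[0%R, 1%R]%classic).
  apply: (@segment_connected R 0%R 1%R).
  - by exists 0%R; split=> //=; rewrite in_itv /= lexx ler01.
  - pose C := [set s : R | (`[0%R, 1%R]%classic) s -> B s].
    exists (interior C); first exact: open_interior.
    apply/seteqP; split=> [t Bt|t [t01 /interior_subset]]; last by apply.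
    have [t01 Ht] := Bt; split=> //.
    have := H_near t t01; apply: filterS => s Hs s01; split=> // x.
    apply: (homo_le_id Xmin (H_homo s s01)) => z.
    by apply: le_trans (Hs s01 z) _; rewrite Ht.
  - exists (closure B); first exact: closed_closure.
    apply/seteqP; split=> [t Bt|t [t01 clB]].
      by split; [case: Bt | exact: subset_closure].
    have [s [[s01 Hs] /(_ s01) Hst]] := clB _ (H_near t t01).
    split=> // x; apply: (homo_ge_id Xmin (H_homo t t01)) => z.
    by rewrite -{1}(Hs z); exact: Hst.
have [_ H1x] : B 1%R by rewrite BE /= in_itv /= ler01 lexx.
by move=> x y; rewrite -(H1x x) -(H1x y); have /= -> := H1 x; have /= -> := H1 y.
Qed.

End FiniteSpaces.

(** * Enumeration of codes *)

Section Codes.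
Local Open Scope nat_scope.
Implicit Types (m : seq bool) (ms Cs As rel : seq (seq bool)).

Definition bit (m : seq bool) i := nth false m i.
Definition entry (rel : seq (seq bool)) i j := bit (nth [::] rel i) j.

(** For posets in which every relation between a minimal and a maximal point
passes through a middle point. The three fields give, as bits, the middle
points above each minimal point, the strict order of the middle points, and
the middle points below each maximal point. Points are numbered in the order
minimal, middle, maximal. *)
Record code := Code {
  below : seq (seq bool); middle : seq (seq bool); above : seq (seq bool) }.

Definition meet_bits m m' := has (fun p => p.1 && p.2) (zip m m').

Definition code_lt (c : code) i j :=
  let nC := size (below c) in let k := size (middle c) in
  if i < nC then
    if j < nC then false
    else if j < nC + k then entry (below c) i (j - nC)
    else meet_bits (nth [::] (below c) i) (nth [::] (above c) (j - (nC + k)))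
  else if i < nC + k then
    if j < nC then false
    else if j < nC + k then entry (middle c) (i - nC) (j - nC)
    else entry (above c) (j - (nC + k)) (i - nC)
  else false.

Definition code_size c := size (below c) + size (middle c) + size (above c).

(** Tabulates a relation, since reading a bit is much cheaper than evaluating
[code_lt] again. *)
Definition matrix_of (n : nat) (r : rel nat) : seq (seq bool) :=
  [seq [seq r i j | j <- iota 0 n] | i <- iota 0 n].

(** What the middle points above a minimal point c satisfy: c lies below some
of them, they form an up-set, and they have no minimum, which would make c an
up-beat point. *)
Definition mask_ok k rel m :=
  [&& has id m,
      all (fun i => bit m i ==> all (fun j => entry rel i j ==> bit m j) (iota 0 k)) (iota 0 k)
    & ~~ has (fun i => bit m i && all (fun j => bit m j ==> (j == i) || entry rel i j) (iota 0 k))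
         (iota 0 k)].

(** No middle point b is a down-beat point. A maximum of the points below b is
either a minimal point, and then the only point below b, or a middle point j.
*)
Definition side_ok k rel ms :=
  all (fun b =>
    (has (fun i => entry rel i b) (iota 0 k) || (1 < count (bit^~ b) ms)) &&
    ~~ has (fun j => [&& entry rel j b,
         all (fun i => entry rel i b ==> (i == j) || entry rel i j) (iota 0 k)
       & all (fun m => bit m b ==> bit m j) ms]) (iota 0 k)) (iota 0 k).

Definition transpose k rel := [seq [seq entry rel j i | j <- iota 0 k] | i <- iota 0 k].

(** The configuration of [no_sphere], with c and a among the points below,
respectively above, both b and b'. *)
Definition sphere k rel Cs As :=
  has (fun b => has (fun b' =>
    (b != b') &&
    let C2 := [seq m <- Cs | bit m b && bit m b'] in
    let A2 := [seq m <- As | bit m b && bit m b'] in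
    [&& 1 < size C2, 1 < size A2 &
      has (fun m => has (fun m' =>
        all (fun d => bit m d && bit m' d ==> ~~ (entry rel b d || entry rel d b)) (iota 0 k))
        A2) C2]) (iota 0 k)) (iota 0 k).

Definition code_euler c :=
  let n := code_size c in
  let M := matrix_of n (code_lt c) in
  euler_one (chains (fun i j => [|| i == j, entry M i j | entry M j i]) (iota 0 n)).

Fixpoint words n : seq (seq bool) :=
  if n is n'.+1 then [seq x :: w | x <- [:: false; true], w <- words n'] else [:: [::]].

(** Strictly upper triangular relations: any strict order becomes one when the
points are numbered along a linear extension. *)
Definition rels k : seq (seq (seq bool)) :=
  foldr (fun i acc => [seq (nseq i.+1 false ++ w) :: t | w <- words (k - i.+1), t <- acc])
    [:: [::]] (iota 0 k).

Definition rel_ok k rel :=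
  all (fun i => all (fun j => entry rel i j ==>
    all (fun l => entry rel j l ==> entry rel i l) (iota 0 k)) (iota 0 k)) (iota 0 k).

(** Only one ordering of each multiset is listed, as the minimal points may be
permuted among themselves, and so may the maximal ones. *)
Fixpoint multisets (n : nat) : seq (seq bool) -> seq (seq (seq bool)) :=
  fix multi ms := if n is n'.+1 then
    if ms is m :: ms' then [seq m :: t | t <- multisets n' ms] ++ multi ms' else [::]
  else [:: [::]].

Definition sides k rel n :=
  [seq ms <- multisets n [seq m <- words k | mask_ok k rel m] | side_ok k rel ms].

(** Matches each mask with the first unused equal mask among the targets. *)
Fixpoint assign (ms : seq (seq bool)) (targets : seq (seq bool * nat)) : seq nat :=
  if ms is m :: ms' then
    let p := find (fun t => t.1 == m) targets in
    (nth (m, 0) targets p).2 :: assign ms' (take p targets ++ drop p.+1 targets)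
  else [::].

Fixpoint perms_of (s : seq nat) : seq (seq nat) :=
  if s is x :: s' then
    flatten [seq [seq take i t ++ x :: drop i t | i <- iota 0 (size s)] | t <- perms_of s']
  else [:: [::]].

Definition is_iso n (M M' : seq (seq bool)) (p : seq nat) :=
  [&& size p == n, uniq p, all (fun i => i < n) p &
    all (fun i => all (fun j => entry M i j == entry M' (nth 0 p i) (nth 0 p j))
      (iota 0 n)) (iota 0 n)].

(** A renumbering s of the middle points determines the masks, hence a
matching of the minimal and maximal points. The result is only a guess, which
[is_iso] verifies. *)
Definition iso_candidate (c t : code) (s : seq nat) : seq nat :=
  let nC := size (below c) in let k := size (middle c) in
  let move m := [seq bit m (index j s) | j <- iota 0 k] in
  assign (map move (below c)) (zip (below t) (iota 0 nC)) ++
  [seq nC + i | i <- s] ++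
  [seq nC + k + i | i <- assign (map move (above c)) (zip (above t) (iota 0 (size (above c))))].

Definition iso_code (c t : code) :=
  let n := code_size c in
  [&& size (below c) == size (below t), size (middle c) == size (middle t),
      size (above c) == size (above t) &
    let M := matrix_of n (code_lt c) in let M' := matrix_of n (code_lt t) in
    has (fun s => is_iso n M M' (iso_candidate c t s)) (perms_of (iota 0 (size (middle c))))].

(** The upper side of a poset is the lower side of its dual, whence the
transposed relation. *)
Definition classified k (ts : seq code) nC nA :=
  all (fun rel =>
    let LC := sides k rel nC in
    let LA := sides k (transpose k rel) nA in
    all (fun Cs => all (fun As =>
      [|| sphere k rel Cs As, ~~ code_euler (Code Cs rel As) |
        has (iso_code (Code Cs rel As)) ts]) LA) LC)
    [seq rel <- rels k | rel_ok k rel].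

Definition mask k (s : seq nat) := [seq i \in s | i <- iota 1 k].
Definition masks k := map (mask k).
Definition empty_rel k := nseq k (nseq k false).

(** In these codes the masks of the maximal points list the middle points
below them, and so transpose the covering relations of the types; the maximal
points keep their order. *)
Definition codeI := Code (masks 3 [:: [:: 1; 2]; [:: 1; 3]; [:: 2; 3]]) (empty_rel 3)
  (masks 3 [:: [:: 1; 2; 3]; [:: 1; 3]; [:: 2; 3]; [:: 2; 3]]).
Definition codeII := Code (masks 3 [:: [:: 1; 2]; [:: 1; 3]; [:: 2; 3]]) (empty_rel 3)
  (masks 3 [:: [:: 1; 2; 3]; [:: 1; 2]; [:: 1; 3]; [:: 2; 3]]).
Definition codeIII := Code (masks 3 [:: [:: 1; 3]; [:: 2; 3]; [:: 1; 2; 3]]) (empty_rel 3)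
  (masks 3 [:: [:: 1; 2]; [:: 1; 2]; [:: 1; 3]; [:: 2; 3]]).
Definition codeIV := Code (masks 4 [:: [:: 1; 3]; [:: 2; 4]; [:: 1; 2; 3; 4]]) (empty_rel 4)
  (masks 4 [:: [:: 1; 2; 3; 4]; [:: 1; 2]; [:: 3; 4]]).
Definition codeV := Code (masks 4 [:: [:: 1; 3]; [:: 1; 2; 4]; [:: 2; 3; 4]]) (empty_rel 4)
  (masks 4 [:: [:: 1; 2; 3; 4]; [:: 1; 2]; [:: 3; 4]]).
Definition codeVI := Code (masks 4 [:: [:: 1; 3]; [:: 2; 4]; [:: 1; 2; 3; 4]]) (empty_rel 4)
  (masks 4 [:: [:: 1; 2; 3]; [:: 1; 2; 4]; [:: 3; 4]]).
Definition codeVII := Code (masks 4 [:: [:: 1; 3]; [:: 1; 2; 4]; [:: 2; 3; 4]]) (empty_rel 4)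
  (masks 4 [:: [:: 1; 2; 3]; [:: 1; 2; 4]; [:: 3; 4]]).

Definition code_op (c : code) :=
  Code (above c) (transpose (size (middle c)) (middle c)) (below c).

Definition codes k : seq code :=
  match k with
  | 3 => [:: codeI; codeII; codeIII; code_op codeI; code_op codeII; code_op codeIII]
  | 4 => [:: codeIV; codeV; codeVI; codeVII]
  | _ => [::]
  end.

Definition classification_check :=
  all (fun k => all (fun nC => classified k (codes k) nC (10 - k - nC)) (iota 0 (11 - k)))
    [:: 1; 2; 3; 4].

(** Since [codes] is empty for one or two middle points, every candidate is
excluded in these cases. *)
Lemma classification_checked : classification_check.
Proof. by lazy. Qed.

End Codes.

(** * Posets with a given code *)

Section CodeLemmas.
Local Open Scope nat_scope.

Lemma entry_matrix n (r : rel nat) i j : i < n -> j < n ->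
  entry (matrix_of n r) i j = r i j.
Proof.
by move=> iN jN; rewrite /entry /bit !(nth_map 0) ?size_iota // !nth_iota.
Qed.

Lemma all_iotaP n (P : pred nat) :
  reflect (forall i, i < n -> P i) (all P (iota 0 n)).
Proof.
apply: (iffP allP) => H i; first by move=> iN; apply: H; rewrite mem_iota.
by rewrite mem_iota => /H.
Qed.

Lemma has_iotaP n (P : pred nat) :
  reflect (exists2 i, i < n & P i) (has P (iota 0 n)).
Proof.
by apply: (iffP hasP) => -[i]; [rewrite mem_iota | move=> iN]; exists i; rewrite ?mem_iota.
Qed.

Lemma mem_words w : w \in words (size w).
Proof.
elim: w => //= x w IHw; rewrite mem_cat; case: x; last by rewrite map_f.
by rewrite mem_cat map_f ?orbT.
Qed.

Lemma mem_rels_aux k (F : nat -> seq bool) (s : seq nat) :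
  (forall i, i \in s -> exists2 w, w \in words (k - i.+1) & F i = nseq i.+1 false ++ w) ->
  map F s \in foldr (fun i acc =>
    [seq (nseq i.+1 false ++ w) :: t | w <- words (k - i.+1), t <- acc]) [:: [::]] s.
Proof.
elim: s => //= i s IHs Fs; have [w wk ->] := Fs i (mem_head _ _).
apply/allpairsP; exists (w, map F s); split=> //=.
by apply: IHs => j js; apply: Fs; rewrite inE js orbT.
Qed.

Lemma multisets_perm (L ms : seq (seq bool)) : {subset ms <= L} ->
  exists2 ms', perm_eq ms ms' & ms' \in multisets (size ms) L.
Proof.
have [n En] : exists n, size ms = n by exists (size ms).
rewrite En; elim: n ms L En => [|n IHn] ms L En.
  by move=> _; exists [::]; [case: ms En | case: L].
elim: L => [|m L IHL] sub.
  by case: ms En sub => // x ms _ /(_ x (mem_head _ _)).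
have [mms|mms] := boolP (m \in ms).
  have [||t pt tL] := IHn (rem m ms) (m :: L).
  - by rewrite size_rem // En.
  - by move=> x /mem_rem/sub.
  exists (m :: t).
    by rewrite (perm_trans (perm_to_rem mms)) // perm_cons.
  by rewrite /= mem_cat map_f.
have [|t pt tL] := IHL.
  move=> x xms; have := sub x xms; rewrite inE => /predU1P[xm|//].
  by rewrite -xm xms in mms.
by exists t; rewrite //= mem_cat tL orbT.
Qed.

(** Lets the enumeration of the points be chosen so that their masks appear in
the order in which a multiset is listed. *)
Lemma perm_map_lift (T : eqType) (T' : eqType) (f : T -> T') (s : seq T) (t : seq T') :
  perm_eq (map f s) t -> exists2 s', perm_eq s s' & t = map f s'.
Proof.
case: s => [|x s] pt.
  by exists [::] => //; case: t pt => // y t /perm_size.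
move: pt; rewrite perm_sym => /(perm_iotaP (f x))[Is pIs ->].
rewrite size_map in pIs; exists (map (nth x (x :: s)) Is).
  by rewrite perm_sym; apply/(perm_iotaP x); exists Is.
rewrite -map_comp; apply/eq_in_map => i; rewrite (perm_mem pIs) mem_iota => iN.
exact: nth_map.
Qed.

End CodeLemmas.

Definition coding disp (X : finPOrderType disp) (c : code) (s : seq X) :=
  [/\ uniq s, forall x, x \in s, size s = code_size c &
    forall x0 i j, (i < code_size c)%N -> (j < code_size c)%N ->
      (nth x0 s i < nth x0 s j)%O = code_lt c i j].

Definition coded disp (X : finPOrderType disp) (c : code) :=
  exists s : seq X, coding c s.

Lemma coded_iso disp (X : finPOrderType disp) c t :
  coded X c -> iso_code c t -> coded X t.
Proof.
move=> [s [us fs ss ltX]] /and4P[/eqP sC /eqP sB /eqP sA].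
have ct : code_size c = code_size t by rewrite /code_size sC sB sA.
move=> /hasP[s0 _ /and4P[/eqP size_q uq /allP q_lt /all_iotaP isoE]].
set q := iso_candidate c t s0 in size_q uq q_lt isoE.
set n := code_size c in ss ltX ct size_q q_lt isoE.
have q_mem i : (i < n)%N -> i \in q.
  have sub : {subset q <= iota 0 n} by move=> j /q_lt; rewrite mem_iota.
  have [|_ ->] := uniq_min_size uq sub; first by rewrite size_iota size_q.
  by rewrite mem_iota.
case: s us fs ss ltX => [|x0 s'] us fs ss ltX.
  by exists [::]; split=> // [|x0 i j]; rewrite -ct -/n -ss.
set s := x0 :: s' in us fs ss ltX.
exists [seq nth x0 s (index j q) | j <- iota 0 n]; split.
- rewrite map_inj_in_uniq ?iota_uniq // => i j; rewrite !mem_iota !add0n => iN jN /eqP.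
  rewrite nth_uniq ?ss -?size_q ?index_mem ?q_mem // => /eqP/(congr1 (nth 0%N q)).
  by rewrite !nth_index ?q_mem.
- move=> x; have idx : (index x s < n)%N by rewrite -ss index_mem.
  apply/mapP; exists (nth 0%N q (index x s)).
    by rewrite mem_iota /= q_lt // mem_nth // size_q.
  by rewrite index_uniq ?size_q // nth_index.
- by rewrite size_map size_iota.
move=> y0 i j; rewrite -ct => iN jN.
rewrite !(nth_map 0%N) ?size_iota // !nth_iota // !add0n.
have idx k : (k < n)%N -> (index k q < n)%N by move=> kn; rewrite -size_q index_mem q_mem.
have /all_iotaP/(_ _ (idx j jN))/eqP := isoE _ (idx i iN).
by rewrite ltX ?idx // !nth_index ?q_mem // !entry_matrix ?idx.
Qed.

Lemma coded_homeomorphic disp disp' (X : finPOrderType disp)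
    (Y : finPOrderType disp') c :
  coded X c -> coded Y c -> homeomorphic (T0space X) (T0space Y).
Proof.
move=> [s [us fs ss ltX]] [p [up fp sp ltY]].
have cX : #|X| = code_size c by rewrite -ss -(card_uniqP us); apply: eq_card => x; rewrite fs.
have cY : #|Y| = code_size c by rewrite -sp -(card_uniqP up); apply: eq_card => x; rewrite fp.
have [c0|c_gt0] := posnP (code_size c).
  have noX (x : X) : False by have := fs x; rewrite (size0nil (etrans ss c0)).
  have noY (y : Y) : False by have := fp y; rewrite (size0nil (etrans sp c0)).
  exists (fun x : T0space X => match noX x with end), (fun y : T0space Y => match noY y with end).
  by split=> [x|y|x|y]; [case: (noX x) | case: (noY y) | case: (noX x) | case: (noY y)].
have /card_gt0P[y0 _] : (0 < #|Y|)%N by rewrite cY.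
have /card_gt0P[x0 _] : (0 < #|X|)%N by rewrite cX.
pose f (x : X) : Y := nth y0 p (index x s).
have idx x : (index x s < code_size c)%N by rewrite -ss index_mem.
have f_inj : injective f.
  move=> x y /eqP; rewrite nth_uniq ?sp // => /eqP/(congr1 (nth x0 s)).
  by rewrite !nth_index.
apply: (@iso_homeomorphic _ _ _ _ f).
  by apply: inj_card_bij => //; rewrite cX cY.
move=> x y; rewrite !le_eqVlt (inj_eq f_inj) /f ltY // -(ltX x0) //.
by rewrite !nth_index.
Qed.

(** * Invariants read off a code *)

Section CodedPosets.
Context {disp : Order.disp_t} {X : finPOrderType disp}.
Local Open Scope order_scope.
Variable c : code.
Local Notation n := (code_size c).

Definition up_degree i := count (code_lt c i) (iota 0 n).
Definition down_degree i := count (code_lt c ^~ i) (iota 0 n).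

(** The numbers of points with k points above, and with k points below, them:
a crude invariant that separates the listed types. *)
Definition profile : seq nat :=
  [seq count (fun i => up_degree i == k) (iota 0 n) | k <- iota 0 n] ++
  [seq count (fun i => down_degree i == k) (iota 0 n) | k <- iota 0 n].

Definition code_minimal : bool :=
  all (fun i => ~~ has (fun m => code_lt c i m &&
      all (fun j => code_lt c i j ==> (j == m) || code_lt c m j) (iota 0 n)) (iota 0 n) &&
    ~~ has (fun m => code_lt c m i &&
      all (fun j => code_lt c j i ==> (j == m) || code_lt c j m) (iota 0 n)) (iota 0 n))
    (iota 0 n).

Definition code_chains : seq (seq nat) :=
  chains (fun i j => [|| i == j, code_lt c i j | code_lt c j i]) (iota 0 n).

Hypothesis codeX : coded X c.

Lemma coded_card : #|X| = n.
Proof.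
have [s [us fs ss _]] := codeX.
by rewrite -ss -(card_uniqP us); apply: eq_card => x; rewrite fs.
Qed.

Lemma coding_count (s : seq X) x0 (P : pred X) (Q : pred nat) : coding c s ->
  (forall i, (i < n)%N -> P (nth x0 s i) = Q i) ->
  #|[set x | P x]%SET| = count Q (iota 0 n).
Proof.
move=> [us fs ss _] PQ.
have <- : count P s = count Q (iota 0 n).
  rewrite -[in LHS](mkseq_nth x0 s) ss count_map; apply: eq_in_count => i.
  by rewrite mem_iota => iN; exact: PQ.
rewrite -size_filter -(card_uniqP (filter_uniq _ us)).
by apply: eq_card => x; rewrite inE mem_filter fs andbT.
Qed.

Lemma coded_count (P : pred X) (Q : pred nat) :
  (forall s x0 i, coding c s -> (i < n)%N -> P (nth x0 s i) = Q i) ->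
  #|[set x | P x]%SET| = count Q (iota 0 n).
Proof.
have [s cs] := codeX => PQ.
have [x0 _|noX] := pickP X; last first.
  rewrite eq_card0; last by move=> x; have := noX x.
  by case: s cs => [[_ _ <-]|x s] //; have := noX x.
by apply: (coding_count (x0 := x0) cs) => i; exact: PQ.
Qed.

Lemma coded_degrees (s : seq X) x0 i : coding c s -> (i < n)%N ->
  #|[set y | nth x0 s i < y]%SET| = up_degree i /\
  #|[set y | y < nth x0 s i]%SET| = down_degree i.
Proof.
move=> cs iN; have [_ _ _ ltX] := cs.
by split; apply: (coding_count (x0 := x0) cs) => j jN; exact: ltX.
Qed.

Definition degree_profile : seq nat :=
  [seq #|[set x : X | #|[set y : X | x < y]%SET| == k]%SET| | k <- iota 0 #|X|] ++
  [seq #|[set x : X | #|[set y : X | y < x]%SET| == k]%SET| | k <- iota 0 #|X|].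

Lemma coded_profile : degree_profile = profile.
Proof.
rewrite /degree_profile coded_card; congr (_ ++ _); apply/eq_map => k.
  apply: coded_count => s x0 i cs iN.
  by have [-> _] := coded_degrees x0 cs iN.
apply: coded_count => s x0 i cs iN.
by have [_ ->] := coded_degrees x0 cs iN.
Qed.

Lemma coded_minimal : code_minimal -> minimal_space X.
Proof.
have [s [us fs ss ltX]] := codeX => /all_iotaP min x.
have xE : nth x s (index x s) = x by rewrite nth_index.
have idx y : (index y s < n)%N by rewrite -ss index_mem.
have ltE y z : (y < z) = code_lt c (index y s) (index z s).
  by rewrite -(ltX x) // !nth_index.
have [/andP[/has_iotaP up /has_iotaP down]] := min _ (idx x).
have eqE y z : (index y s == index z s) = (y == z).
  by apply/eqP/eqP => [/(congr1 (nth x s))|->//]; rewrite !nth_index.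
split=> -[m xm all_m].
  apply: up; exists (index m s) => //; rewrite -ltE xm /=.
  apply/all_iotaP => j jN; rewrite -(index_uniq x _ us (i := j)) ?ss // -!ltE eqE.
  by apply/implyP => /all_m; rewrite le_eqVlt eq_sym.
apply: down; exists (index m s) => //; rewrite -ltE xm /=.
apply/all_iotaP => j jN; rewrite -(index_uniq x _ us (i := j)) ?ss // -!ltE eqE.
by apply/implyP => /all_m; rewrite le_eqVlt.
Qed.

Lemma coded_Min : #|Min X| = count (fun i => ~~ has (code_lt c ^~ i) (iota 0 n)) (iota 0 n).
Proof.
apply: coded_count => s x0 i [us fs ss ltX] iN.
apply/forallP/negP => [noy /has_iotaP[j jN]|noj y].
  by rewrite -(ltX x0) //; apply/negP.
apply/negP => yi; apply: noj; apply/has_iotaP; exists (index y s).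
  by rewrite -ss index_mem.
by rewrite -(ltX x0) -?ss ?index_mem // ?nth_index // ss.
Qed.

Lemma coded_Max : #|Max X| = count (fun i => ~~ has (code_lt c i) (iota 0 n)) (iota 0 n).
Proof.
apply: coded_count => s x0 i [us fs ss ltX] iN.
apply/forallP/negP => [noy /has_iotaP[j jN]|noj y].
  by rewrite -(ltX x0) //; apply/negP.
apply/negP => yi; apply: noj; apply/has_iotaP; exists (index y s).
  by rewrite -ss index_mem.
by rewrite -(ltX x0) -?ss ?index_mem // ?nth_index // ss.
Qed.

Definition code_mid i := has (code_lt c ^~ i) (iota 0 n) && has (code_lt c i) (iota 0 n).

Lemma coded_mid_nth (s : seq X) x0 i : coding c s -> (i < n)%N ->
  (nth x0 s i \in Mid X) = code_mid i.
Proof.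
move=> [us fs ss ltX] iN.
have idx y : (index y s < n)%N by rewrite -ss index_mem.
apply/midP/andP => -[].
  move=> /not_min[y yi] /not_max[z iz]; split; apply/has_iotaP.
    by exists (index y s) => //; rewrite -(ltX x0) // nth_index.
  by exists (index z s) => //; rewrite -(ltX x0) // nth_index.
move=> /has_iotaP[j jN ji] /has_iotaP[l lN il]; split; apply/negP.
  by move/(min_nlt (nth x0 s j)); rewrite ltX // ji.
by move/(max_nlt (nth x0 s l)); rewrite ltX // il.
Qed.

Lemma coded_Mid : #|Mid X| = count code_mid (iota 0 n).
Proof.
rewrite -(coded_count (P := fun x => x \in Mid X)).
  by apply: eq_card => x; rewrite [RHS]inE.
by move=> s x0 i; exact: coded_mid_nth.
Qed.

Lemma coded_Mid_antichain :
  all (fun i => all (fun j => code_mid i && code_mid j ==> ~~ code_lt c i j) (iota 0 n)) (iota 0 n) ->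
  is_antichain (Mid X).
Proof.
have [s cs] := codeX; have [us fs ss ltX] := cs => /all_iotaP anti x y xM yM.
rewrite le_eqVlt => /predU1P[//|xy].
have idx z : (index z s < n)%N by rewrite -ss index_mem.
have /all_iotaP/(_ _ (idx y)) := anti _ (idx x).
by rewrite -!(coded_mid_nth x cs) // !nth_index // xM yM /= -(ltX x) // !nth_index // xy.
Qed.

Lemma coding_chains (s : seq X) x0 : coding c s ->
  chains (@comparable_rel _ X) s = map (map (nth x0 s)) code_chains.
Proof.
move=> [us fs ss ltX]; have sE : s = map (nth x0 s) (iota 0 n).
  by rewrite -ss -/(mkseq _ _) mkseq_nth.
rewrite {1}sE chains_map; congr map; apply: eq_in_chains => i j.
rewrite !mem_iota !add0n => iN jN.
rewrite /= /comparable_rel /Order.comparable !le_eqVlt !ltX //.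
rewrite !nth_uniq ?ss // [j == i]eq_sym.
by case: (i == j); case: (code_lt _ i j); case: (code_lt _ j i).
Qed.

Lemma coded_height : all (fun l => size l <= 3)%N code_chains ->
  has (fun l => size l == 3%N) code_chains -> height X = 2%N.
Proof.
have [s cs] := codeX; have [us fs ss ltX] := cs => /allP le3 /hasP[l lch /eqP l3].
have [x0 _] : exists x : X, True.
  case: s cs us fs ss ltX => [|x s]; last by exists x.
  by move=> _ _ _ /esym; case: l lch l3 => // i l; rewrite mem_chains => /andP[/mem_subseq/(_ i (mem_head _ _))]; rewrite mem_iota add0n => /[swap] _ /[swap] _ /[swap] ->.
suff -> : height X = 3.-1 by [].
congr (_.-1); apply/eqP; rewrite eqn_leq; apply/andP; split.
  apply/bigmax_leqP => A chA; rewrite -(set_filter fs A) cardsE.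
  apply: leq_trans (card_size _) _.
  have : [seq x <- s | x \in A] \in chains (@comparable_rel _ X) s.
    by rewrite mem_chains filter_subseq -is_chain_seq set_filter.
  by rewrite (coding_chains x0 cs) => /mapP[l' /le3 + ->]; rewrite size_map.
have : map (nth x0 s) l \in chains (@comparable_rel _ X) s.
  by rewrite (coding_chains x0 cs) map_f.
rewrite mem_chains => /andP[ls chl].
have <- : #|[set x in map (nth x0 s) l]%SET| = 3%N.
  by rewrite cardsE (card_uniqP (subseq_uniq ls us)) size_map.
by apply: leq_bigmax_cond; rewrite is_chain_seq.
Qed.

End CodedPosets.

Lemma homeomorphic_profile disp disp' (X : finPOrderType disp) (Y : finPOrderType disp') :
  homeomorphic (T0space X) (T0space Y) -> @degree_profile _ X = @degree_profile _ Y.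
Proof.
case/homeomorphic_iso => f bf mf; have f_inj := bij_inj bf.
have cXY : #|X| = #|Y| := bij_eq_card bf.
have f_lt x y : (f x < f y)%O = (x < y)%O by rewrite !lt_neqAle mf (inj_eq f_inj).
have transfer (P : pred X) (Q : pred Y) : (forall x, Q (f x) = P x) ->
    #|[set x | P x]%SET| = #|[set y | Q y]%SET|.
  move=> PQ; rewrite -(card_imset _ f_inj); apply: eq_card => y.
  have [g fK gK] := bf; apply/imsetP/idP => [[x + ->]|].
    by rewrite !inE PQ.
  by rewrite inE => Qy; exists (g y); rewrite ?gK // inE -PQ gK.
rewrite /degree_profile cXY; congr (_ ++ _); apply/eq_map => k;
  apply: (transfer) => x; congr (_ == _); apply/esym; apply: (transfer) => y;
  exact: f_lt.
Qed.

(** * The code of a minimal poset with contractible order complex *)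

Section Sides.
Context {R : realType} {disp : Order.disp_t} {X : finPOrderType disp}.
Local Open Scope order_scope.
Implicit Types (x y b c a : X).
Hypotheses (cX : order_complex_contractible R X) (Xmin : minimal_space X)
  (X_big : (1 < #|X|)%N) (M5 : (#|Mid X| <= 5)%N).

Lemma has_comparable x : exists y, comparable_lt x y.
Proof.
have /card_gt1P[y [z [_ _ yz]]] := X_big.
have [xy|] := eqVneq x y; last exact: not_isolated cX.
by apply: (not_isolated cX (y := z)); rewrite xy.
Qed.

Lemma min_max_disjoint x : x \in Min X -> x \in Max X -> False.
Proof.
move=> xMin xMax; have [y] := has_comparable x.
by rewrite /comparable_lt (min_nlt y xMin) (max_nlt y xMax).
Qed.

(** Otherwise c < a would be a bridge. *)
Lemma mid_between c a : c \in Min X -> a \in Max X -> c < a ->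
  exists b : X, [/\ b \in Mid X, c < b & b < a].
Proof.
move=> cMin aMax ca; have [b /andP[cb ba]|none] := pickP (fun b : X => (c < b) && (b < a)).
  by exists b; split=> //; exact: between_mid cb ba.
case: (@no_bridge R _ X c a cX Xmin M5); split=> // b cb ba.
by have := none b; rewrite cb ba.
Qed.

Lemma mid_above c : c \in Min X -> exists2 b : X, b \in Mid X & c < b.
Proof.
move=> cMin; have [y] := has_comparable c.
rewrite /comparable_lt (min_nlt y cMin) orbF => cy.
have [yMax|yMax] := boolP (y \in Max X).
  by have [b [bM cb _]] := mid_between cMin yMax cy; exists b.
exists y => //; apply/midP; split=> //.
by apply/negP => /(min_nlt c); rewrite cy.
Qed.

Variable sB : seq X.
Hypotheses (uB : uniq sB) (memB : forall x, (x \in sB) = (x \in Mid X)).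

Definition up_mask c : seq bool := [seq c < b | b <- sB].
Definition middle_rel : seq (seq bool) := map up_mask sB.

Lemma bit_up_mask x0 c i : (i < size sB)%N -> bit (up_mask c) i = (c < nth x0 sB i).
Proof. by move=> iB; rewrite /bit (nth_map x0). Qed.

Lemma entry_middle x0 i j : (i < size sB)%N -> (j < size sB)%N ->
  entry middle_rel i j = (nth x0 sB i < nth x0 sB j).
Proof. by move=> iB jB; rewrite /entry (nth_map x0) // (bit_up_mask x0). Qed.

Lemma sB_idx x0 b : b \in Mid X -> exists2 i, (i < size sB)%N & nth x0 sB i = b.
Proof. by rewrite -memB => bB; exists (index b sB); rewrite ?index_mem // nth_index. Qed.

Lemma sB_mid x0 i : (i < size sB)%N -> nth x0 sB i \in Mid X.
Proof. by move=> iB; rewrite -memB mem_nth. Qed.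

Lemma sB_eq x0 i j : (i < size sB)%N -> (j < size sB)%N ->
  (i == j) = (nth x0 sB i == nth x0 sB j).
Proof. by move=> iB jB; rewrite nth_uniq. Qed.

(** A minimum of the middle points above c would be an up-beat witness for c,
since a maximal point above c is above one of these middle points. *)
Lemma min_mask_ok c : c \in Min X -> mask_ok (size sB) middle_rel (up_mask c).
Proof.
move=> cMin; apply/and3P; split.
- have [b bM cb] := mid_above cMin.
  by apply/hasP; exists true => //; apply/mapP; exists b; rewrite ?memB.
- apply/all_iotaP => i iB; apply/implyP; rewrite (bit_up_mask c) // => ci.
  apply/all_iotaP => j jB; apply/implyP; rewrite (entry_middle c) // (bit_up_mask c) //.
  exact: lt_trans.
- apply/has_iotaP => -[i iB /andP[]]; rewrite (bit_up_mask c) // => ci /all_iotaP all_ge.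
  set b := nth c sB i in ci.
  have above_b b' : b' \in Mid X -> c < b' -> b <= b'.
    case/(sB_idx c) => j jB <- cj; have := all_ge _ jB.
    rewrite (bit_up_mask c) // cj /= (entry_middle c) // (sB_eq c) // le_eqVlt.
    by rewrite eq_sym.
  have [nb _] := Xmin c; apply: nb; exists b => // y cy.
  have [yMax|yMax] := boolP (y \in Max X).
    have [b' [b'M cb' b'y]] := mid_between cMin yMax cy.
    exact: le_trans (above_b _ b'M cb') (ltW b'y).
  apply: above_b => //; apply/midP; split=> //.
  by apply/negP => /(min_nlt c); rewrite cy.
Qed.

Lemma min_side_ok (sC : seq X) : uniq sC -> (forall x, (x \in sC) = (x \in Min X)) ->
  side_ok (size sB) middle_rel (map up_mask sC).
Proof.
move=> uC memC; apply/all_iotaP => i iB.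
have [x0 _] : exists x : X, True by case: (sB) iB => // x; exists x.
set b := nth x0 sB i; have bMid : b \in Mid X := sB_mid x0 iB.
have [bMin _] := midP _ bMid.
apply/andP; split.
  case: has_iotaP => //= no_lower; rewrite count_map.
  have [c [c' [cb c'b cc' _]]] := two_below Xmin bMin.
  have in_min y : y < b -> y \in sC.
    move=> yb; rewrite memC; apply/negPn/negP => yMin; apply: no_lower.
    have yMid : y \in Mid X.
      by apply/midP; split=> //; apply/negP => /(max_nlt b); rewrite yb.
    have [j jB yE] := sB_idx x0 yMid; exists j => //.
    by rewrite (entry_middle x0) // yE.
  rewrite -size_filter; apply: (@uniq_leq_size _ [:: c; c']).
    by rewrite /= inE cc'.
  by move=> y; rewrite !inE mem_filter /= (bit_up_mask x0) // => /orP[]/eqP->;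
    rewrite in_min // ?cb ?c'b.
apply/has_iotaP => -[j jB /and3P[]]; rewrite (entry_middle x0) // -/b => jb.
move=> /all_iotaP lowers; rewrite all_map => /allP below_j.
have [_ nb] := Xmin b; apply: nb; exists (nth x0 sB j) => // y yb.
have [yMin|yMin] := boolP (y \in Min X).
  have := below_j y; rewrite memC => /(_ yMin) /=.
  by rewrite !(bit_up_mask x0) // yb => /ltW.
have yMid : y \in Mid X.
  by apply/midP; split=> //; apply/negP => /(max_nlt b); rewrite yb.
have [l lB yE] := sB_idx x0 yMid; have := lowers _ lB.
rewrite !(entry_middle x0) // yE yb /= (sB_eq x0) // yE => /orP[/eqP->|/ltW //].
exact: lexx.
Qed.

End Sides.

Lemma transpose_map (T : Type) (r : rel T) (s : seq T) :
  transpose (size s) [seq [seq r x y | y <- s] | x <- s] = [seq [seq r y x | y <- s] | x <- s].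
Proof.
case: s => // x0 s; set t := x0 :: s.
have iotaE (U : Type) (h : nat -> U) (h' : T -> U) :
    (forall i, (i < size t)%N -> h i = h' (nth x0 t i)) -> [seq h i | i <- iota 0 (size t)] = map h' t.
  move=> hh'; rewrite -[in RHS](mkseq_nth x0 t) /mkseq -map_comp.
  by apply/eq_in_map => i; rewrite mem_iota => /hh'.
apply: (iotaE) => i it; apply: (iotaE) => j jt.
by rewrite /entry /bit (nth_map x0) // (nth_map x0).
Qed.

Section Coding.
Context {R : realType} {disp : Order.disp_t} {X : finPOrderType disp}.
Local Open Scope order_scope.
Implicit Types (x y b c a : X).
Hypotheses (cX : order_complex_contractible R X) (Xmin : minimal_space X)
  (X_big : (1 < #|X|)%N) (M5 : (#|Mid X| <= 5)%N).

Section WithLists.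
Variables (sC sB sA : seq X).
Hypotheses (uC : uniq sC) (memC : forall x, (x \in sC) = (x \in Min X)).
Hypotheses (uB : uniq sB) (memB : forall x, (x \in sB) = (x \in Mid X)).
Hypotheses (uA : uniq sA) (memA : forall x, (x \in sA) = (x \in Max X)).

Definition down_mask a : seq bool := @up_mask _ (X^d) sB a.

Lemma bit_down_mask x0 a i : (i < size sB)%N ->
  bit (down_mask a) i = (nth x0 sB i < a).
Proof. exact: (@bit_up_mask _ (X^d)). Qed.

Definition poset_code : code :=
  Code (map (up_mask sB) sC) (middle_rel sB) (map down_mask sA).

(** A code does not record the relations from minimal to maximal points;
[mid_between] recovers them. *)
Lemma poset_codeP : coded X poset_code.
Proof.
have sizeE : code_size poset_code = (size sC + size sB + size sA)%N.
  by rewrite /code_size /= !size_map.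
exists (sC ++ sB ++ sA); split.
- rewrite !cat_uniq uC uB uA /= andbT; apply/andP; split.
    rewrite has_cat negb_or; apply/andP; split; apply/hasPn => x; rewrite ?memB ?memA.
      by move=> /midP[xMin _]; change (x \notin sC); rewrite memC.
    move=> xMax; change (x \notin sC); rewrite memC; apply/negP => xMin.
    exact: (min_max_disjoint cX X_big xMin xMax).
  apply/hasPn => x; rewrite memA => xMax; change (x \notin sB); rewrite memB.
  exact: max_notin_mid.
- move=> x; rewrite !mem_cat memC memB memA finset.in_setC finset.in_setU.
  by case: (x \in Min X); case: (x \in Max X).
- by rewrite !size_cat sizeE addnA.
move=> x0 i j; rewrite sizeE => iN jN; rewrite /code_lt /= !size_map.
have Cnth l : (l < size sC)%N -> nth x0 sC l \in Min X by move=> lC; rewrite -memC mem_nth.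
have Bnth l : (l < size sB)%N -> nth x0 sB l \in Mid X by move=> lB; rewrite -memB mem_nth.
have Anth l : (l < size sA)%N -> nth x0 sA l \in Max X by move=> lA; rewrite -memA mem_nth.
have pos l : (l < size sC + size sB + size sA)%N ->
  [\/ (l < size sC)%N /\ nth x0 (sC ++ sB ++ sA) l = nth x0 sC l,
      [/\ (l < size sC)%N = false, (l < size sC + size sB)%N, (l - size sC < size sB)%N
        & nth x0 (sC ++ sB ++ sA) l = nth x0 sB (l - size sC)]
    | [/\ (l < size sC)%N = false, (l < size sC + size sB)%N = false,
        (l - (size sC + size sB) < size sA)%N
        & nth x0 (sC ++ sB ++ sA) l = nth x0 sA (l - (size sC + size sB))]].
  move=> lN; rewrite !nth_cat; have [lC|Cl] := ltnP l (size sC).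
    by constructor 1.
  have [lB|Bl] := ltnP l (size sC + size sB).
    by constructor 2; rewrite ltn_subLR // lB; split.
  constructor 3; split=> //; first by rewrite ltn_subLR // addnC.
  by rewrite ltnNge leq_subRL // Bl /= subnDA.
have not_max_mid y : y \in Mid X -> y \in Min X = false by case/midP => /negbTE.
case: (pos i iN) => [[iC ->]|[iC iB iB' ->]|[iC iB iA ->]]; rewrite ?iC ?iB.
- case: (pos j jN) => [[jC ->]|[jC jB jB' ->]|[jC jB jA ->]]; rewrite ?jC ?jB.
  + exact/min_nlt/Cnth.
  + by rewrite /entry (nth_map x0) // (bit_up_mask x0).
  + rewrite (nth_map x0) // (nth_map x0) // /meet_bits /down_mask /up_mask zip_map has_map.
    apply/idP/hasP => [ca|[b _ /andP[/= cb ba]]]; last exact: lt_trans cb ba.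
    have [b [bM cb ba]] := mid_between cX Xmin M5 (Cnth _ iC) (Anth _ jA) ca.
    by exists b; rewrite ?memB //=; apply/andP; split.
- case: (pos j jN) => [[jC ->]|[jC jB jB' ->]|[jC jB jA ->]]; rewrite ?jC ?jB.
  + exact/min_nlt/Cnth.
  + by rewrite (entry_middle x0).
  + by rewrite /entry (nth_map x0) // (bit_down_mask x0).
- exact/max_nlt/Anth.
Qed.

Lemma poset_code_sphere :
  ~~ sphere (size sB) (middle_rel sB) (map (up_mask sB) sC) (map down_mask sA).
Proof.
apply/has_iotaP => -[i iB /has_iotaP[j jB /andP[ij]]].
have [x0 _] : exists x : X, True by case: (sB) iB => // x; exists x.
set b := nth x0 sB i; set b' := nth x0 sB j.
have bM : b \in Mid X by rewrite -memB mem_nth.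
have bb' : b != b' by rewrite nth_uniq.
rewrite /= !filter_map !size_map => /and3P[C2 A2 /hasP[_ /mapP[c + ->] /hasP[_ /mapP[a + ->] /all_iotaP iso]]].
have other (t : seq X) x : uniq t -> (1 < size t)%N -> x \in t -> exists2 y, y \in t & x != y.
  case: t => [|y [|z t]] //= /andP[+ _] _ _; rewrite inE negb_or => /andP[yz _].
  have [->|xy] := eqVneq x y; first by exists z; rewrite ?inE ?eqxx ?orbT // inE.
  by exists y; rewrite ?mem_head.
have below2 x : x \in [seq x <- sC | preim (up_mask sB) (fun m => bit m i && bit m j) x] ->
    [/\ x \in Min X, x < b & x < b'].
  by rewrite mem_filter memC /= !(bit_up_mask x0) // => /andP[/andP[-> ->] ->].
have above2 x : x \in [seq x <- sA | preim down_mask (fun m => bit m i && bit m j) x] ->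
    [/\ x \in Max X, b < x & b' < x].
  by rewrite mem_filter memA /= !(bit_down_mask x0) // => /andP[/andP[]].
move=> cIn aIn.
have [c' /below2[_ c'b c'b'] cc'] := other _ c (filter_uniq _ uC) C2 cIn.
have [a' /above2[_ ba' b'a'] aa'] := other _ a (filter_uniq _ uA) A2 aIn.
have [cMin cb cb'] := below2 c cIn; have [aMax ba b'a] := above2 a aIn.
apply: (@no_sphere R _ X cX c c' b b' a a') => // x cx xa bx.
have xM := between_mid cx xa; have [l lB xE] := sB_idx memB x0 xM.
have := iso l lB; rewrite (bit_up_mask x0) // (bit_down_mask x0) //.
rewrite xE cx !(entry_middle x0) // -/b xE.
by rewrite xa /=; case: bx => ->; rewrite ?orbT.
Qed.

Lemma poset_code_euler : code_euler poset_code.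
Proof.
have [s cs] := poset_codeP; have [us fs _ _] := cs.
have /card_gt1P[x0 _] := X_big.
have := euler_chains us fs cX; rewrite (coding_chains x0 cs) /euler_one !count_map.
rewrite /code_euler /euler_one -[chains _ _](_ : code_chains poset_code = _); last first.
  apply: eq_in_chains => i j; rewrite !mem_iota !add0n => iN jN.
  by rewrite !entry_matrix.
move=> euler_s; apply: etrans euler_s.
by apply: (congr2 (fun m n : nat => m == n)); apply: eq_count => l /=; rewrite size_map.
Qed.

End WithLists.

(** The points have to be numbered as in the enumeration: the middle points by
the number of points below them, which makes their order triangular, and the
minimal and maximal points so that their masks form the listed representatives
of multisets. *)
Theorem poset_classified : #|X| = 10%N -> (0 < #|Mid X| <= 4)%N ->
  exists k : code, coded X k /\ has (iso_code k) (codes #|Mid X|).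
Proof.
move=> X10 /andP[k_gt0 k_le4].
pose r b := #|[set y : X | y < b]%SET|.
pose sB := sort (relpre r leq) (enum (Mid X)).
have uB : uniq sB by rewrite sort_uniq enum_uniq.
have memB x : (x \in sB) = (x \in Mid X) by rewrite mem_sort mem_enum.
have sizeB : size sB = #|Mid X| by rewrite size_sort -cardE.
have XminD := minimal_dual Xmin; have cXD := contractible_dual cX.
have [msC pC mC] : exists2 ms, perm_eq (map (up_mask sB) (enum (Min X))) ms &
    ms \in multisets #|Min X| [seq m <- words (size sB) | mask_ok (size sB) (middle_rel sB) m].
  rewrite cardE -(size_map (up_mask sB) (enum (Min X))); apply: multisets_perm => _ /mapP[c + ->].
  rewrite mem_enum => cMin; rewrite mem_filter (min_mask_ok cX Xmin X_big M5 uB memB cMin) /=.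
  by rewrite -(size_map (fun b => c < b) sB) mem_words.
have [sC psC msCE] := perm_map_lift pC.
have trE : @middle_rel _ (X^d) sB = transpose (size sB) (middle_rel sB).
  exact/esym/transpose_map.
have M5D : (#|Mid (X^d)| <= 5)%N by rewrite Mid_dual.
have memBD (x : X^d) : (x \in sB) = (x \in Mid (X^d)) by rewrite Mid_dual memB.
have [msA pA mA] : exists2 ms, perm_eq (map (down_mask sB) (enum (Max X))) ms &
    ms \in multisets #|Max X| [seq m <- words (size sB) | mask_ok (size sB) (transpose (size sB) (middle_rel sB)) m].
  rewrite cardE -(size_map (down_mask sB) (enum (Max X))); apply: multisets_perm => _ /mapP[a + ->].
  rewrite mem_enum => aMax; rewrite mem_filter -trE.
  rewrite (@min_mask_ok R _ (X^d) cXD XminD X_big M5D sB uB memBD a aMax) /=.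
  by rewrite -(size_map (fun b => b < a) sB) mem_words.
have [sA psA msAE] := perm_map_lift pA.
have uC : uniq sC by rewrite -(perm_uniq psC) enum_uniq.
have uA : uniq sA by rewrite -(perm_uniq psA) enum_uniq.
have memC x : (x \in sC) = (x \in Min X) by rewrite -(perm_mem psC) mem_enum.
have memA x : (x \in sA) = (x \in Max X) by rewrite -(perm_mem psA) mem_enum.
have sum10 : (#|Min X| + #|Mid X| + #|Max X| = 10)%N.
  have [s [us fs ss _]] := poset_codeP uC memC uB memB uA memA.
  rewrite -X10 -[RHS](_ : #|s| = _); last by apply: eq_card => x; rewrite fs.
  rewrite (card_uniqP us) ss /code_size /= !size_map sizeB.
  by rewrite -(perm_size psC) -(perm_size psA) -!cardE.
exists (poset_code sC sB sA); split; first exact: poset_codeP.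
have /allP/(_ #|Mid X|) := classification_checked.
have -> : #|Mid X| \in [:: 1; 2; 3; 4] by case: #|Mid X| k_gt0 k_le4 => [|[|[|[|[|]]]]].
move=> /(_ isT)/allP/(_ #|Min X|).
have -> : #|Min X| \in iota 0 (11 - #|Mid X|) by rewrite mem_iota; lia.
have -> : (10 - #|Mid X| - #|Min X| = #|Max X|)%N by lia.
move=> /(_ isT)/allP/(_ (middle_rel sB)); rewrite -sizeB.
have relP : middle_rel sB \in [seq rel <- rels (size sB) | rel_ok (size sB) rel].
  have [x0 _] : exists x : X, True by have /card_gt1P[y] := X_big; exists y.
  rewrite mem_filter; apply/andP; split.
    apply/all_iotaP => i iB; apply/all_iotaP => j jB; apply/implyP => ij.
    apply/all_iotaP => l lB; apply/implyP; move: ij.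
    by rewrite !(entry_middle x0) //; exact: lt_trans.
  have -> : middle_rel sB = [seq up_mask sB (nth x0 sB i) | i <- iota 0 (size sB)].
    by rewrite map_comp -/(mkseq _ _) mkseq_nth.
  apply: mem_rels_aux => i; rewrite mem_iota add0n => /andP[_ iB].
  have size_mask : size (up_mask sB (nth x0 sB i)) = size sB by rewrite size_map.
  exists (drop i.+1 (up_mask sB (nth x0 sB i))).
    by rewrite -size_mask -size_drop mem_words.
  apply: etrans (esym (cat_take_drop i.+1 _)) _; congr (_ ++ _).
  apply: (@eq_from_nth _ false) => [|j]; first by rewrite size_takel ?size_nseq ?size_mask.
  rewrite size_takel ?size_mask // ltnS => ji.
  rewrite nth_take // nth_nseq ltnS ji -/(bit _ _) (bit_up_mask x0); last exact: leq_ltn_trans ji iB.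
  apply/negP => lt_ij; have : (r (nth x0 sB j) <= r (nth x0 sB i))%N.
    apply: (sorted_leq_nth (leT := relpre r leq)) => //.
    - by move=> x y z; exact: leq_trans.
    - by move=> x; exact: leqnn.
    - exact: (sort_sorted (fun x y => leq_total (r x) (r y))).
    - by rewrite inE (leq_ltn_trans ji).
  apply/negP; rewrite -ltnNge; apply: proper_card; apply/properP; split.
    by apply/fintype.subsetP => y; rewrite !inE => /lt_trans; exact.
  by exists (nth x0 sB i); rewrite !inE ?ltxx.
move=> /(_ relP)/allP/(_ msC).
have -> : msC \in sides (size sB) (middle_rel sB) #|Min X|.
  by rewrite mem_filter mC msCE (min_side_ok Xmin uB memB uC memC).
move=> /(_ isT)/allP/(_ msA).
have -> : msA \in sides (size sB) (transpose (size sB) (middle_rel sB)) #|Max X|.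
  by rewrite mem_filter mA msAE -trE (@min_side_ok _ (X^d) XminD sB uB memBD sA uA memA).
move=> /(_ isT); rewrite msCE msAE -/(poset_code sC sB sA).
rewrite (negbTE (poset_code_sphere _ _ _ _ _ _)) // poset_code_euler //=.
Qed.

End Coding.

(** * The listed posets *)

Section GeneratedPosets.
Context {T : finType} (e : T -> seq T) (e_anti : antisymmetric (connect (grel e))).
Local Notation X := (generated_poset e_anti).

Definition generated_lt (x y : T) : bool :=
  (x != y) && ((y \in e x) || has (fun z => y \in e z) (e x)).

Definition two_steps : Prop :=
  forall x, all (fun y => all (fun z => e z == [::]) (e y)) (e x).

(** No path has more than two edges, so that the transitive closure is
computed by looking two steps ahead. *)
Lemma generated_ltE (x y : X) : two_steps -> (x < y)%O = generated_lt x y.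
Proof.
move=> steps; rewrite lt_neqAle /generated_lt.
case: (eqVneq x y) => //= xy; rewrite -[(x <= y)%O]/(connect (grel e) x y).
apply/connectP/orP => [[[|z [|w [|u p]]] /= pth yE]|[exy|/hasP[z ez zy]]].
- by rewrite yE eqxx in xy.
- by left; rewrite yE; case/andP: pth.
- by right; apply/hasP; exists z; rewrite ?yE; case/and3P: pth.
- case/and4P: pth => xz zw wu _.
  by have /eqP E := allP (allP (steps x) z xz) w zw; rewrite E in wu.
- by exists [:: y]; rewrite //= andbT.
- by exists [:: z; y]; rewrite //= ez [_ \in _]zy.
Qed.

End GeneratedPosets.

Definition table_ok (T : eqType) (lt : rel T) (x0 : T) (s : seq T) (c : code) : bool :=
  [&& uniq s, size s == code_size c &
    all (fun i => all (fun j => lt (nth x0 s i) (nth x0 s j) == code_lt c i j)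
      (iota 0 (code_size c))) (iota 0 (code_size c))].

Lemma table_coding disp (X : finPOrderType disp) (lt : rel X) x0 (s : seq X) c :
  (forall x y : X, (x < y)%O = lt x y) -> (forall x, x \in s) ->
  table_ok lt x0 s c -> coding c s.
Proof.
move=> ltE fs /and3P[us /eqP ss /all_iotaP tab]; split=> // x1 i j iN jN.
rewrite !(set_nth_default x0) ?ss // ltE.
by have /all_iotaP/(_ _ jN)/eqP := tab _ iN.
Qed.

Definition collapsible_poset (T : finType) (lt : rel T) (s : seq T) : bool :=
  let L := chains (fun x y => [|| x == y, lt x y | lt y x]) s in
  collapsible (size L) [seq l <- L | l != [::]].

Lemma collapsible_contractible (R : realType) disp (X : finPOrderType disp)
    (lt : rel X) (s : seq X) :
  (forall x y : X, (x < y)%O = lt x y) -> uniq s -> (forall x, x \in s) ->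
  collapsible_poset lt s -> order_complex_contractible R X.
Proof.
move=> ltE us fs; rewrite /collapsible_poset.
rewrite (@eq_in_chains _ _ (@comparable_rel _ X)); last first.
  move=> x y _ _; rewrite /comparable_rel /Order.comparable !le_eqVlt !ltE [y == x]eq_sym.
  by case: (x == y); case: (lt x y); case: (lt y x).
set L := [seq l <- _ | _]; have KE : order_complex X = seq_complex L.
  apply/setP => A; rewrite (order_complex_chains fs) inE.
  apply/hasP/hasP => -[l]; first by move=> lch /andP[l0 lA]; exists l; rewrite ?mem_filter ?l0.
  by rewrite mem_filter => /andP[l0 lch] lA; exists l; rewrite ?l0.
move=> colL; apply: ambient_contractible; rewrite KE.
apply: collapsible_contraction colL; rewrite -KE.
exact: order_complex_face.
Qed.

Lemma mem_points334 (x : Points334.point) : x \in Points334.points.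
Proof. by case: x. Qed.

Lemma mem_points343 (x : Points343.point) : x \in Points343.points.
Proof. by case: x. Qed.

(** The dual order lists the points a_i first, as they are its minimal points.
*)
Definition points334_op : seq Points334.point :=
  [:: Points334.a1; Points334.a2; Points334.a3; Points334.a4;
      Points334.b1; Points334.b2; Points334.b3;
      Points334.c1; Points334.c2; Points334.c3].

Lemma mem_points334_op (x : Points334.point) : x \in points334_op.
Proof. by case: x. Qed.

Lemma relI_steps : two_steps Points334.relI. Proof. by case. Qed.
Lemma relII_steps : two_steps Points334.relII. Proof. by case. Qed.
Lemma relIII_steps : two_steps Points334.relIII. Proof. by case. Qed.
Lemma relIV_steps : two_steps Points343.relIV. Proof. by case. Qed.
Lemma relV_steps : two_steps Points343.relV. Proof. by case. Qed.
Lemma relVI_steps : two_steps Points343.relVI. Proof. by case. Qed.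
Lemma relVII_steps : two_steps Points343.relVII. Proof. by case. Qed.

Section Generated.
Context {T : finType} {e : T -> seq T}.
Variable e_anti : antisymmetric (connect (grel e)).
Hypothesis steps : two_steps e.
Implicit Types s : seq T.

Lemma generated_coded s (x0 : T) c : (forall x, x \in s) ->
  table_ok (generated_lt e) x0 s c -> coded (generated_poset e_anti) c.
Proof.
move=> fs tab; exists s.
apply: (@table_coding _ (generated_poset e_anti) (generated_lt e)) tab => //.
by move=> x y; exact: generated_ltE.
Qed.

Lemma generated_dual_coded s (x0 : T) c : (forall x, x \in s) ->
  table_ok (fun x y => generated_lt e y x) x0 s c ->
  coded ((generated_poset e_anti)^d)%O c.
Proof.
move=> fs tab; exists s.
apply: (@table_coding _ ((generated_poset e_anti)^d)%O (fun x y => generated_lt e y x)) tab => //.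
by move=> x y; exact: (@generated_ltE _ _ e_anti y x steps).
Qed.

Lemma generated_contractible (R : realType) s : (forall x, x \in s) -> uniq s ->
  collapsible_poset (generated_lt e) s ->
  order_complex_contractible R (generated_poset e_anti).
Proof.
move=> fs us.
apply: (@collapsible_contractible R _ (generated_poset e_anti) (generated_lt e) s) => //.
by move=> x y; exact: generated_ltE.
Qed.

End Generated.

Lemma codedI : coded typeI codeI.
Proof. by apply: (generated_coded _ relI_steps (x0 := Points334.c1) mem_points334); lazy. Qed.
Lemma codedII : coded typeII codeII.
Proof. by apply: (generated_coded _ relII_steps (x0 := Points334.c1) mem_points334); lazy. Qed.
Lemma codedIII : coded typeIII codeIII.
Proof. by apply: (generated_coded _ relIII_steps (x0 := Points334.c1) mem_points334); lazy. Qed.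
Lemma codedI_op : coded (opposite typeI) (code_op codeI).
Proof. by apply: (generated_dual_coded _ relI_steps (x0 := Points334.a1) mem_points334_op); lazy. Qed.
Lemma codedII_op : coded (opposite typeII) (code_op codeII).
Proof. by apply: (generated_dual_coded _ relII_steps (x0 := Points334.a1) mem_points334_op); lazy. Qed.
Lemma codedIII_op : coded (opposite typeIII) (code_op codeIII).
Proof. by apply: (generated_dual_coded _ relIII_steps (x0 := Points334.a1) mem_points334_op); lazy. Qed.
Lemma codedIV : coded typeIV codeIV.
Proof. by apply: (generated_coded _ relIV_steps (x0 := Points343.c1) mem_points343); lazy. Qed.
Lemma codedV : coded typeV codeV.
Proof. by apply: (generated_coded _ relV_steps (x0 := Points343.c1) mem_points343); lazy. Qed.
Lemma codedVI : coded typeVI codeVI.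
Proof. by apply: (generated_coded _ relVI_steps (x0 := Points343.c1) mem_points343); lazy. Qed.
Lemma codedVII : coded typeVII codeVII.
Proof. by apply: (generated_coded _ relVII_steps (x0 := Points343.c1) mem_points343); lazy. Qed.

Section Types.
Variable R : realType.

Lemma contractibleI : order_complex_contractible R typeI.
Proof. by apply: (generated_contractible _ relI_steps R mem_points334); lazy. Qed.
Lemma contractibleII : order_complex_contractible R typeII.
Proof. by apply: (generated_contractible _ relII_steps R mem_points334); lazy. Qed.
Lemma contractibleIII : order_complex_contractible R typeIII.
Proof. by apply: (generated_contractible _ relIII_steps R mem_points334); lazy. Qed.
Lemma contractibleIV : order_complex_contractible R typeIV.
Proof. by apply: (generated_contractible _ relIV_steps R mem_points343); lazy. Qed.
Lemma contractibleV : order_complex_contractible R typeV.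
Proof. by apply: (generated_contractible _ relV_steps R mem_points343); lazy. Qed.
Lemma contractibleVI : order_complex_contractible R typeVI.
Proof. by apply: (generated_contractible _ relVI_steps R mem_points343); lazy. Qed.
Lemma contractibleVII : order_complex_contractible R typeVII.
Proof. by apply: (generated_contractible _ relVII_steps R mem_points343); lazy. Qed.

Lemma coded_exceptional disp (X : finPOrderType disp) c : coded X c ->
  code_size c = 10%N -> code_minimal c -> order_complex_contractible R X ->
  exceptional R X.
Proof.
move=> cX n10 minc contrX; have Xmin := coded_minimal cX minc.
have X10 : #|X| = 10%N by rewrite (coded_card cX).
split=> // contr; have /card_gt1P[x [y [_ _ /eqP]]] : (1 < #|X|)%N by rewrite X10.
by case; exact: minimal_contractible Xmin contr x y.
Qed.

Lemma types_I_III_op_coded i : coded (types_I_III_op i) (nth codeI (codes 3) i).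
Proof.
case: i => -[|[|[|[|[|[|//]]]]]] i6.
- exact: codedI.
- exact: codedII.
- exact: codedIII.
- exact: codedI_op.
- exact: codedII_op.
- exact: codedIII_op.
Qed.

Lemma types_I_III_op_contractible i :
  order_complex_contractible R (types_I_III_op i).
Proof.
case: i => -[|[|[|[|[|[|//]]]]]] i6.
- exact: contractibleI.
- exact: contractibleII.
- exact: contractibleIII.
- exact: contractible_dual contractibleI.
- exact: contractible_dual contractibleII.
- exact: contractible_dual contractibleIII.
Qed.

Lemma types_IV_VII_coded i : coded (types_IV_VII i) (nth codeIV (codes 4) i).
Proof.
case: i => -[|[|[|[|//]]]] i4.
- exact: codedIV.
- exact: codedV.
- exact: codedVI.
- exact: codedVII.
Qed.

Lemma types_IV_VII_contractible i :
  order_complex_contractible R (types_IV_VII i).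
Proof.
case: i => -[|[|[|[|//]]]] i4.
- exact: contractibleIV.
- exact: contractibleV.
- exact: contractibleVI.
- exact: contractibleVII.
Qed.

Definition code_spec k c :=
  [&& code_size c == 10%N, code_minimal c,
      count (code_mid c) (iota 0 (code_size c)) == k,
      all (fun i => all (fun j => code_mid c i && code_mid c j ==> ~~ code_lt c i j)
        (iota 0 (code_size c))) (iota 0 (code_size c)),
      all (fun l => size l <= 3)%N (code_chains c)
    & has (fun l => size l == 3%N) (code_chains c)].

Lemma codes3_spec : all (code_spec 3) (codes 3). Proof. by lazy. Qed.
Lemma codes4_spec : all (code_spec 4) (codes 4). Proof. by lazy. Qed.
Lemma codes3_profile : uniq (map profile (codes 3)). Proof. by lazy. Qed.
Lemma codes4_profile : uniq (map profile (codes 4)). Proof. by lazy. Qed.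

Lemma exceptional_coded disp (X : finPOrderType disp) :
  exceptional R X -> (0 < #|Mid X| <= 4)%N ->
  exists i, (i < size (codes #|Mid X|))%N /\ coded X (nth codeI (codes #|Mid X|) i).
Proof.
move=> [X10 Xmin cX _] Mid4; have /andP[_ M4] := Mid4.
have M5 : (#|Mid X| <= 5)%N := leqW M4; have X_big : (1 < #|X|)%N by rewrite X10.
have [k [ck /(has_nthP codeI)[i iN iso]]] := poset_classified cX Xmin X_big M5 X10 Mid4.
by exists i; split=> //; exact: coded_iso ck iso.
Qed.

End Types.

Theorem theorem1p1 (R : realType) :
  [/\ (forall (d : Order.disp_t) (X : finPOrderType d),
         exceptional R X -> #|Mid X| <> 1%N),
      (forall (d : Order.disp_t) (X : finPOrderType d),
         exceptional R X -> #|Mid X| <> 2%N),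
      classifies_up_to_homeo
        (fun (d : Order.disp_t) (X : finPOrderType d) =>
           exceptional R X /\ #|Mid X| = 3%N)
        types_I_III_op
      /\ (forall i : 'I_3, let X := types_I_III i in
            #|Min X| = 3%N /\ #|Max X| = 4%N),
      classifies_up_to_homeo
        (fun (d : Order.disp_t) (X : finPOrderType d) =>
           exceptional R X /\ #|Mid X| = 4%N)
        types_IV_VII
      /\ (forall i : 'I_4, let X := types_IV_VII i in
            #|Min X| = 3%N /\ #|Max X| = 3%N)
    & forall (d : Order.disp_t) (X : finPOrderType d),
        exceptional R X -> #|Mid X| = 3%N \/ #|Mid X| = 4%N ->
        [/\ height X = 2%N, is_antichain (Mid X)
          & order_complex_contractible R X]].
Proof.
split.
- by move=> d X eX M1; have [|i []] := exceptional_coded eX; rewrite M1.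
- by move=> d X eX M2; have [|i []] := exceptional_coded eX; rewrite M2.
- split; [split|].
  + move=> i; have /and5P[/eqP n10 minc /eqP mid3 _ _] :
        code_spec 3 (nth codeI (codes 3) i).
      by apply: (all_nthP _ codes3_spec); exact: ltn_ord.
    have ci := types_I_III_op_coded i; split; last by rewrite (coded_Mid ci).
    exact: coded_exceptional ci n10 minc (types_I_III_op_contractible R i).
  + move=> i j /homeomorphic_profile.
    rewrite (coded_profile (types_I_III_op_coded i)) (coded_profile (types_I_III_op_coded j)).
    move=> pij; apply/val_inj/eqP; rewrite -(nth_uniq [::] _ _ codes3_profile) ?size_map ?ltn_ord //.
    by rewrite !(nth_map codeI) ?ltn_ord // pij.
  + move=> d X [eX M3]; have [|i [iN cX]] := exceptional_coded eX; rewrite ?M3 //.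
    rewrite M3 in iN cX; exists (Ordinal iN : 'I_6).
    exact: coded_homeomorphic cX (types_I_III_op_coded (Ordinal iN : 'I_6)).
  case=> -[|[|[|//]]] i3 /=.
  + by rewrite (coded_Min codedI) (coded_Max codedI).
  + by rewrite (coded_Min codedII) (coded_Max codedII).
  + by rewrite (coded_Min codedIII) (coded_Max codedIII).
- split; [split|].
  + move=> i; have /and5P[/eqP n10 minc /eqP mid4 _ _] :
        code_spec 4 (nth codeIV (codes 4) i).
      by apply: (all_nthP _ codes4_spec); exact: ltn_ord.
    have ci := types_IV_VII_coded i; split; last by rewrite (coded_Mid ci).
    exact: coded_exceptional ci n10 minc (types_IV_VII_contractible R i).
  + move=> i j /homeomorphic_profile.
    rewrite (coded_profile (types_IV_VII_coded i)) (coded_profile (types_IV_VII_coded j)).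
    move=> pij; apply/val_inj/eqP; rewrite -(nth_uniq [::] _ _ codes4_profile) ?size_map ?ltn_ord //.
    by rewrite !(nth_map codeIV) ?ltn_ord // pij.
  + move=> d X [eX M4]; have [|i [iN cX]] := exceptional_coded eX; rewrite ?M4 //.
    rewrite M4 in iN cX; exists (Ordinal iN : 'I_4).
    apply: coded_homeomorphic cX _; rewrite (set_nth_default codeIV) //.
    exact: (types_IV_VII_coded (Ordinal iN : 'I_4)).
  case=> -[|[|[|[|//]]]] i4 /=.
  + by rewrite (coded_Min codedIV) (coded_Max codedIV).
  + by rewrite (coded_Min codedV) (coded_Max codedV).
  + by rewrite (coded_Min codedVI) (coded_Max codedVI).
  + by rewrite (coded_Min codedVII) (coded_Max codedVII).
move=> d X eX M34; have [|i [iN cX]] := exceptional_coded eX.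
- by case: M34 => ->.
have [_ _ contrX _] := eX.
have /and5P[_ _ _ antiX /andP[le3 has3]] : code_spec #|Mid X| (nth codeI (codes #|Mid X|) i).
  apply: (all_nthP _ _ _ iN).
  by case: M34 => ->; [exact: codes3_spec | exact: codes4_spec].
split=> //; last exact: coded_Mid_antichain cX antiX.
exact: coded_height cX le3 has3.
Qed.
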